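(* For every $r>1$, $b>0$, $h\ge 0$, there exists a unique $c_\star=c_\star(b,r,h)$ for which the delayed Belousov–Zhabotinsky system $$ \begin{aligned} u_t(t,x) &= \Delta u(t,x) + u(t,x)\bigl(1-r-u(t,x)+r\,v(t-h,x)\bigr),\\ v_t(t,x) &= \Delta v(t,x) + b\,u(t,x)\bigl(1-v(t,x)\bigr),\qquad u,v\in[0,1],\ x\in\mathbb{R}^2, \end{aligned} $$ admits a wavefront $(u,v)(t,x)=(\phi,\psi)(\nu\cdot x+c_\star t)$. Furthermore, $\phi'(t)>0$, $\psi'(t)>0$ and $\phi(t)<\psi(t)$ for all $t\in\mathbb{R}$, and $c_\star\in(0,2)$.
   Context: A wavefront with speed $c\in\mathbb{R}$ is a classical solution of the form $(u,v)(t,x)=(\phi,\psi)(\nu\cdot x+ct)$, where $\nu\in\mathbb{R}^2$ is a unit vector, $0\le\phi\le1$, $0\le\psi\le1$ on $\mathbb{R}$, and the boundary conditions $(\phi,\psi)(-\infty)=(0,0)$, $(\phi,\psi)(+\infty)=(1,1)$ hold (as limits). Equivalently, the profile $(\phi,\psi)$ is a $C^2$ solution on $\mathbb{R}$, with values in $[0,1]^2$ and with these boundary conditions, of $$ \begin{aligned} &\phi''(t)-c\phi'(t)+\phi(t)\bigl(1-r-\phi(t)+r\psi(t-ch)\bigr)=0,\\ &\psi''(t)-c\psi'(t)+b\phi(t)\bigl(1-\psi(t)\bigr)=0. \end{aligned} $$ *)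

(* Defs.v *)
From Stdlib Require Import Reals.
From Coquelicot Require Import Coquelicot.
Open Scope R_scope.

(** Scalar fields [u t x] of time [t : R] and position [x : R * R]. *)
Definition field : Type := R -> R * R -> R.

Definition dt (u : field) : field :=
  fun t x => Derive (fun s => u s x) t.
Definition dx1 (u : field) : field :=
  fun t x => Derive (fun s => u t (s, snd x)) (fst x).
Definition dx2 (u : field) : field :=
  fun t x => Derive (fun s => u t (fst x, s)) (snd x).

Definition laplacian (u : field) : field :=
  fun t x => dx1 (dx1 u) t x + dx2 (dx2 u) t x.

Definition jointly_continuous (u : field) : Prop :=
  forall p : R * (R * R),
    continuous (fun q : R * (R * R) => u (fst q) (snd q)) p.

(** [Derive] is total, so existence of each derivative is required
    separately from its continuity. *)
Definition C1_t (u : field) : Prop :=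
  (forall t x, ex_derive (fun s => u s x) t) /\ jointly_continuous (dt u).
Definition C1_x1 (u : field) : Prop :=
  (forall t x, ex_derive (fun s => u t (s, snd x)) (fst x)) /\
  jointly_continuous (dx1 u).
Definition C1_x2 (u : field) : Prop :=
  (forall t x, ex_derive (fun s => u t (fst x, s)) (snd x)) /\
  jointly_continuous (dx2 u).

(** Classical regularity: once continuously differentiable in time,
    twice in space. *)
Definition C12 (u : field) : Prop :=
  jointly_continuous u /\ C1_t u /\ C1_x1 u /\ C1_x2 u /\
  C1_x1 (dx1 u) /\ C1_x2 (dx1 u) /\ C1_x1 (dx2 u) /\ C1_x2 (dx2 u).

(** Solutions are entire in time: the equations hold for all [t : R], so the
    delay needs no initial history. *)
Definition BZ_classical_solution (b r h : R) (u v : field) : Prop :=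
  C12 u /\ C12 v /\
  (forall t x, 0 <= u t x <= 1 /\ 0 <= v t x <= 1) /\
  (forall t x,
     dt u t x = laplacian u t x + u t x * (1 - r - u t x + r * v (t - h) x)) /\
  (forall t x,
     dt v t x = laplacian v t x + b * u t x * (1 - v t x)).

Definition planar_wave (nu : R * R) (c : R) (f : R -> R) : field :=
  fun t x => f (fst nu * fst x + snd nu * snd x + c * t).

Definition is_wavefront (b r h c : R) (nu : R * R) (phi psi : R -> R) : Prop :=
  fst nu ^ 2 + snd nu ^ 2 = 1 /\
  BZ_classical_solution b r h (planar_wave nu c phi) (planar_wave nu c psi) /\
  (forall s, 0 <= phi s <= 1 /\ 0 <= psi s <= 1) /\
  is_lim phi m_infty 0 /\ is_lim psi m_infty 0 /\
  is_lim phi p_infty 1 /\ is_lim psi p_infty 1.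

Definition admits_wavefront (b r h c : R) : Prop :=
  exists (nu : R * R) (phi psi : R -> R), is_wavefront b r h c nu phi psi.

(* Main.v *)
Require Import Defs.
From Stdlib Require Import Reals Lra Lia Psatz Classical ClassicalEpsilon FunctionalExtensionality.
From Coquelicot Require Import Coquelicot.
From mathcomp Require filter.
Open Scope R_scope.

(** A planar field [phi (nu . x + c t)] solves the system exactly when [phi] and
    [psi] solve the profile equations with delay [D = c h], since [nu] is a unit
    vector. Everything happens for these two ordinary differential equations.

    Two features of the nonlinearity are used throughout. The system is
    cooperative on the unit square: each reaction term is nondecreasing in the
    other component, delayed or not. And the growth rate
    [1 - r - phi + r psi (t - D)] of [phi] decreases in [phi], so multiples of a
    solution by a factor above 1 are supersolutions of its equation. The state
    [phi = 0] is linearly stable while [psi] lies below [(r - 1) / (2 r)], so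
    that the fronts are of bistable type, except that at (0, 0) the second
    equation is only neutrally stable in [psi].

    A priori properties. [psi] increases because [psi'' <= c psi']. The function
    [psi' - c psi] decreases, which is incompatible with [c <= 0]
    ([wave_speed_pos]). Comparison with exponentials gives the decay of both
    components at [- oo] ([wave_decay]). The equation satisfied at a point of
    contact of [phi] with a multiple of one of its translates shows that [phi]
    increases ([wave_phi_strict], [wave_phi_incr]). A nonpositive minimum of
    [psi - phi] contradicts the two equations ([wave_phi_lt_psi]). Finally
    [phi exp (- c t / 2)] would have an interior maximum if [c >= 2], which the
    bound 1 on the growth rate excludes ([wave_speed_lt_2]).

    Uniqueness of the speed ([wave_speed_unique]). The faster of two waves is a
    strict subsolution for the slower speed, as its derivatives are positive and
    its delay is no shorter. A translate of the slower wave
    dominates it, and the translate can be moved until it can no further; it is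
    then still strictly above on compact intervals. The ordering at both ends,
    which lets the domination survive a small further move, comes from maximum
    principles for suitable measures of the difference: with the weight
    [exp (c t / 4)] at [- oo], which makes the neutral direction stable, and
    through the ratio of the first components at [+ oo].

    Existence ([wave_exists]). On [(- a, a)], with boundary values (0, 0) and
    (1, 1) continued outside, monotone iteration from (0, 0) gives a solution for
    each [c >= 0] ([truncated_exists]); sliding and the strong maximum principle
    show that it is unique ([truncated_le]), hence continuous in [c]. At [c = 0]
    the concavity of [psi] puts [psi 0] above [(r - 1) / (2 r)], at [c = 3 + b]
    an exponential barrier puts it below, so some [c] gives equality
    ([truncated_level]). The slopes are bounded independently of [a], so these
    solutions converge, along an ultrafilter, to a monotone solution on the
    line. The point to check is that its speed is not 0
    ([approximation_speed_pos]); then the exponential bounds pass to the limit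
    and force (0, 0) at [- oo], and at [+ oo] the limit is an equilibrium
    with [phi > 0], which must be (1, 1). *)

(** * Calculus on intervals *)

Lemma derive_continuous (f : R -> R) (t l : R) : is_derive f t l -> continuous f t.
Proof. intros H. apply (ex_derive_continuous f). exists l; exact H. Qed.

Lemma mean_value (f f' : R -> R) (x y : R) :
  x < y ->
  (forall t, x < t < y -> is_derive f t (f' t)) ->
  (forall t, x <= t <= y -> continuous f t) ->
  exists t, x < t < y /\ f y - f x = f' t * (y - x).
Proof.
  intros Hxy Hd Hc.
  assert (pr1 : forall t, x < t < y -> derivable_pt f t).
  { intros t Ht. exists (f' t). apply is_derive_Reals. auto. }
  assert (pr2 : forall t, x < t < y -> derivable_pt id t).
  { intros t _. apply derivable_pt_id. }
  destruct (MVT f id x y pr1 pr2 Hxy) as [t [Ht E]].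
  - intros t Ht. apply continuity_pt_filterlim. apply Hc; auto.
  - intros t _. apply derivable_continuous_pt, derivable_pt_id.
  - exists t. split; [exact Ht|].
    assert (E1 : derive_pt f t (pr1 t Ht) = f' t).
    { apply derive_pt_eq_0. apply is_derive_Reals. auto. }
    assert (E2 : derive_pt id t (pr2 t Ht) = 1).
    { apply derive_pt_eq_0. apply derivable_pt_lim_id. }
    rewrite E1, E2 in E. unfold id in E. lra.
Qed.

Lemma slope_ge (f f' : R -> R) (x y k : R) :
  x <= y -> (forall t, x <= t <= y -> continuous f t) ->
  (forall t, x < t < y -> is_derive f t (f' t) /\ k <= f' t) ->
  k * (y - x) <= f y - f x.
Proof.
  intros [Hxy| ->] Hc Hd; [|lra].
  destruct (mean_value f f' x y Hxy) as [t [Ht ->]]; [apply Hd|auto|].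
  apply Rmult_le_compat_r; [lra|apply Hd; auto].
Qed.

Lemma slope_le (f f' : R -> R) (x y k : R) :
  x <= y -> (forall t, x <= t <= y -> continuous f t) ->
  (forall t, x < t < y -> is_derive f t (f' t) /\ f' t <= k) ->
  f y - f x <= k * (y - x).
Proof.
  intros [Hxy| ->] Hc Hd; [|lra].
  destruct (mean_value f f' x y Hxy) as [t [Ht ->]]; [apply Hd|auto|].
  apply Rmult_le_compat_r; [lra|apply Hd; auto].
Qed.

Lemma is_derive_exp_lin (k t : R) : is_derive (fun s => exp (k * s)) t (k * exp (k * t)).
Proof. auto_derive; [auto|ring]. Qed.

Lemma is_derive_mul_exp (u : R -> R) (t l k : R) :
  is_derive u t l ->
  is_derive (fun s => u s * exp (k * s)) t ((l + k * u t) * exp (k * t)).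
Proof.
  intros H. evar_last.
  - apply (is_derive_mult u (fun s => exp (k * s))); [exact H|apply is_derive_exp_lin|].
    intros a b; apply Rmult_comm.
  - unfold plus, mult; simpl. ring.
Qed.

Lemma is_derive_lin (u v : R -> R) (a b t l m : R) :
  is_derive u t l -> is_derive v t m ->
  is_derive (fun s => a * u s + b * v s) t (a * l + b * m).
Proof.
  intros Hu Hv. apply (is_derive_plus (fun s => a * u s) (fun s => b * v s)).
  - apply (is_derive_scal u t a l Hu).
  - apply (is_derive_scal v t b m Hv).
Qed.

Lemma is_derive_shift (u : R -> R) (tau t l : R) :
  is_derive u (t + tau) l -> is_derive (fun s => u (s + tau)) t l.
Proof.
  intros H. evar_last.
  - apply (is_derive_comp u (fun s => s + tau)); [exact H|].
    apply (is_derive_plus (fun s => s) (fun _ => tau)); [apply is_derive_id|apply is_derive_const].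
  - unfold scal, plus, zero, one; simpl; unfold mult; simpl. ring.
Qed.

Lemma is_derive_ext_open (f g : R -> R) (x y t l : R) :
  x < t < y -> (forall s, x < s < y -> f s = g s) -> is_derive f t l -> is_derive g t l.
Proof.
  intros Ht H Hd. apply (is_derive_ext_loc f g); [|exact Hd].
  apply (locally_interval _ t x y); try (simpl; lra).
  intros s H1 H2. simpl in H1, H2. apply H. lra.
Qed.

Lemma continuous_shift (u : R -> R) (tau t : R) :
  continuous u (t + tau) -> continuous (fun s => u (s + tau)) t.
Proof.
  intros H. apply (continuous_comp (fun s => s + tau) u); [|exact H].
  apply (continuous_plus (fun s => s) (fun _ => tau)); [apply continuous_id|apply continuous_const].
Qed.

Lemma continuous_cmul (k : R) (u : R -> R) (t : R) :
  continuous u t -> continuous (fun s => k * u s) t.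
Proof. apply (continuous_mult (fun _ => k) u). apply continuous_const. Qed.

Lemma continuous_lin (u v : R -> R) (a b t : R) :
  continuous u t -> continuous v t -> continuous (fun s => a * u s + b * v s) t.
Proof.
  intros Hu Hv.
  apply (continuous_plus (fun s => a * u s) (fun s => b * v s)); apply continuous_cmul; auto.
Qed.

Lemma continuous_ratio (u v : R -> R) (t : R) :
  continuous u t -> continuous v t -> 0 < v t -> continuous (fun s => u s / v s) t.
Proof.
  intros Hu Hv Hpos. apply (continuous_mult u (fun s => / v s)); [exact Hu|].
  apply continuous_comp; [exact Hv|].
  apply continuity_pt_filterlim. apply (derivable_continuous_pt (fun x => / x)).
  apply derivable_pt_inv; [lra|apply derivable_pt_id].
Qed.

Lemma continuous_Rmax (f g : R -> R) (t : R) :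
  continuous f t -> continuous g t -> continuous (fun s => Rmax (f s) (g s)) t.
Proof.
  intros Hf Hg.
  apply (continuous_ext (fun s => (f s + g s + Rabs (f s - g s)) / 2)).
  { intros s. unfold Rmax, Rabs. destruct (Rle_dec (f s) (g s)), (Rcase_abs (f s - g s)); lra. }
  apply (continuous_mult (fun s => f s + g s + Rabs (f s - g s)) (fun _ => / 2)); [|apply continuous_const].
  apply (continuous_plus (fun s => f s + g s)); [apply (continuous_plus f g); auto|].
  apply (continuous_comp (fun s => f s - g s) Rabs); [apply (continuous_minus f g); auto|].
  apply continuity_pt_filterlim. apply Rcontinuity_abs.
Qed.

Lemma exists_max_interval (f : R -> R) (x y x0 m : R) :
  (forall t, x <= t <= y -> continuous f t) ->
  x <= x0 <= y -> m < f x0 -> f x <= m -> f y <= m ->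
  exists tm, x < tm < y /\ m < f tm /\ forall t, x <= t <= y -> f t <= f tm.
Proof.
  intros Hc Hx0 Hm Hx Hy.
  destruct (continuity_ab_maj f x y) as [tm [H1 H2]]; [lra| |].
  - intros t Ht. apply continuity_pt_filterlim. apply Hc; auto.
  - exists tm.
    assert (m < f tm) by (specialize (H1 x0 Hx0); lra).
    assert (tm <> x) by (intros ->; lra).
    assert (tm <> y) by (intros ->; lra).
    split; [lra|]. split; auto.
Qed.

Lemma exists_max_global (f : R -> R) (x y x0 m : R) :
  (forall t, continuous f t) ->
  m < f x0 -> (forall t, t <= x -> f t <= m) -> (forall t, y <= t -> f t <= m) ->
  exists tm, m < f tm /\ forall t, f t <= f tm.
Proof.
  intros Hc Hm Hx Hy.
  assert (x < x0) by (apply Rnot_le_lt; intros H; apply Hx in H; lra).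
  assert (x0 < y) by (apply Rnot_le_lt; intros H'; apply Hy in H'; lra).
  destruct (exists_max_interval f x y x0 m) as [tm [H1 [H2 H3]]]; auto; try lra.
  - apply Hx; lra.
  - apply Hy; lra.
  - exists tm. split; [exact H2|]. intros t.
    destruct (Rle_dec t x); [specialize (Hx t); lra|].
    destruct (Rle_dec y t); [specialize (Hy t); lra|]. apply H3; lra.
Qed.

Lemma exp_small_left (k eps : R) :
  0 < k -> 0 < eps -> exists x, forall t, t <= x -> exp (k * t) < eps.
Proof.
  intros Hk He. exists (ln eps / k - 1). intros t Ht.
  rewrite <- (exp_ln eps He) at 1. apply exp_increasing.
  assert (k * t <= k * (ln eps / k - 1)) by (apply Rmult_le_compat_l; lra).
  assert (k * (ln eps / k - 1) = ln eps - k) by (field; lra). lra.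
Qed.

Lemma exp_le (x y : R) : x <= y -> exp x <= exp y.
Proof. intros [H| ->]; [left; apply exp_increasing; exact H|lra]. Qed.

Lemma exp_neg_cancel (x : R) : exp (- x) * exp x = 1.
Proof. rewrite <- exp_plus, Rplus_opp_l. apply exp_0. Qed.

Lemma increasing_derive_nonneg (f : R -> R) (t l : R) :
  (forall a b, a <= b -> f a <= f b) -> is_derive f t l -> 0 <= l.
Proof.
  intros Hinc H. apply Rnot_lt_le; intros Hl.
  apply is_derive_Reals in H. destruct (H (- l / 2)) as [d Hd]; [lra|].
  pose proof (cond_pos d).
  specialize (Hd (d / 2)).
  assert (Hq : Rabs ((f (t + d / 2) - f t) / (d / 2) - l) < - l / 2).
  { apply Hd; [lra|]. rewrite Rabs_pos_eq; lra. }
  apply Rabs_def2 in Hq. destruct Hq as [Hq _].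
  assert (0 <= (f (t + d / 2) - f t) / (d / 2)); [|lra].
  apply Rdiv_le_0_compat; [|lra]. assert (f t <= f (t + d / 2)) by (apply Hinc; lra). lra.
Qed.

(** The integrating factor of [p' - c p]: if [p' <= c p] and [p] is not
    positive at [x], it stays so to the right. *)
Lemma stays_nonpos (c x y : R) (p s : R -> R) :
  x <= y -> (forall t, x <= t <= y -> is_derive p t (s t) /\ s t <= c * p t) ->
  p x <= 0 -> p y <= 0.
Proof.
  intros Hxy Hd Hx.
  assert (H : p y * exp (- c * y) - p x * exp (- c * x) <= 0 * (y - x)).
  { apply (slope_le (fun t => p t * exp (- c * t)) (fun t => (s t + - c * p t) * exp (- c * t))); [exact Hxy| |].
    - intros t Ht. eapply derive_continuous, is_derive_mul_exp. apply Hd, Ht.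
    - intros t Ht. destruct (Hd t) as [D1 D2]; [lra|]. split; [apply is_derive_mul_exp, D1|].
      pose proof (exp_pos (- c * t)). nra. }
  pose proof (exp_pos (- c * x)). pose proof (exp_pos (- c * y)). nra.
Qed.

(** A slope bounded below by [k > 0] on an interval of length [2 / k] is
    incompatible with values in [0, 1]. *)
Lemma no_steep_run (u p : R -> R) (x k : R) :
  0 < k -> (forall t, 0 <= u t <= 1) ->
  (forall t, x <= t <= x + 2 / k -> is_derive u t (p t) /\ k <= p t) -> False.
Proof.
  intros Hk Hu Hd. assert (HL : 0 < 2 / k) by (apply Rdiv_lt_0_compat; lra).
  assert (k * (x + 2 / k - x) <= u (x + 2 / k) - u x).
  { apply (slope_ge u p); [lra| |].
    - intros t Ht. eapply derive_continuous. apply Hd, Ht.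
    - intros t Ht. apply Hd; lra. }
  assert (k * (x + 2 / k - x) = 2) by (field; lra).
  pose proof (Hu x). pose proof (Hu (x + 2 / k)). lra.
Qed.

Lemma greatest_lower_bound (P : R -> Prop) (lo hi : R) :
  P hi -> (forall t, P t -> lo <= t) ->
  exists inf, (forall t, P t -> inf <= t) /\ forall t, inf < t -> exists s, P s /\ s < t.
Proof.
  intros Hhi Hlo.
  destruct (completeness (fun x => P (- x))) as [s [Hs1 Hs2]].
  - exists (- lo). intros x Hx. specialize (Hlo _ Hx). lra.
  - exists (- hi). rewrite Ropp_involutive. exact Hhi.
  - exists (- s). split.
    + intros t Ht. assert (- t <= s); [|lra]. apply Hs1. rewrite Ropp_involutive. exact Ht.
    + intros t Ht. apply NNPP; intros Hno.
      assert (s <= - t); [|lra]. apply Hs2. intros x Hx. apply Rnot_lt_le; intros Hlt.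
      apply Hno. exists (- x). split; [exact Hx|lra].
Qed.

Lemma le_of_right_limit (f : R -> R) (x m : R) :
  continuous f x -> (forall y, x < y -> m <= f y) -> m <= f x.
Proof.
  intros Hc H. apply Rnot_lt_le; intros Hlt.
  apply continuity_pt_filterlim in Hc.
  destruct (Hc (m - f x)) as [d [Hd0 Hd]]; [lra|].
  specialize (Hd (x + d / 2)).
  assert (Ha : Rabs (f (x + d / 2) - f x) < m - f x).
  { apply Hd. split; [split; [exact I|lra]|]. simpl. unfold R_dist.
    replace (x + d / 2 - x) with (d / 2) by ring. rewrite Rabs_pos_eq; lra. }
  apply Rabs_def2 in Ha. specialize (H (x + d / 2)). lra.
Qed.

(** The last step of every sliding argument: a strict ordering on a compact
    interval leaves room for a slightly smaller translation. *)
Lemma slide_compact (f u : R -> R) (x y tau : R) :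
  x <= y -> (forall t, continuous f t) -> (forall t, continuous u t) ->
  (forall t, x <= t <= y -> u t < f (t + tau)) ->
  exists d, 0 < d <= 1 /\ forall e t, 0 <= e <= d -> x <= t <= y -> u t <= f (t + tau - e).
Proof.
  intros Hxy Hf Hu Hlt.
  destruct (continuity_ab_min (fun t => 1 * f (t + tau) + -1 * u t) x y Hxy) as [tm [H2 H1]].
  { intros t _. apply continuity_pt_filterlim.
    apply (continuous_lin (fun t => f (t + tau)) u); auto. apply continuous_shift; auto. }
  set (eta := 1 * f (tm + tau) + -1 * u tm) in *.
  assert (He : 0 < eta) by (unfold eta; specialize (Hlt tm H1); lra).
  assert (Hcf : forall t, x + tau - 1 <= t <= y + tau -> continuity_pt f t).
  { intros t _. apply continuity_pt_filterlim, Hf. }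
  destruct (Heine_cor2 Hcf (mkposreal eta He)) as [d Hd].
  pose proof (cond_pos d). simpl in Hd.
  exists (Rmin 1 (d / 2)). split.
  - split; [apply Rmin_glb_lt; lra|apply Rmin_l].
  - intros e t He0 Ht. pose proof (Rmin_l 1 (d / 2)). pose proof (Rmin_r 1 (d / 2)).
    assert (Ha : Rabs (f (t + tau - e) - f (t + tau)) < eta).
    { apply Hd; try lra. replace (t + tau - e - (t + tau)) with (- e) by ring.
      rewrite Rabs_Ropp, Rabs_pos_eq; lra. }
    apply Rabs_def2 in Ha. specialize (H2 t Ht). fold eta in H2. lra.
Qed.

(** * Maximum principles *)

(** [p] and [s] are the first and second derivatives of [u] on [(x, y)];
    carrying them as functions keeps every differential inequality below an
    inequality between explicit terms. *)
Definition jet (x y : R) (u p s : R -> R) : Prop :=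
  forall t, x < t < y -> is_derive u t (p t) /\ is_derive p t (s t).

Lemma jet_lin {x y u p s v q z} (a b : R) :
  jet x y u p s -> jet x y v q z ->
  jet x y (fun t => a * u t + b * v t) (fun t => a * p t + b * q t) (fun t => a * s t + b * z t).
Proof.
  intros J1 J2 t Ht. destruct (J1 t Ht), (J2 t Ht). split; apply is_derive_lin; auto.
Qed.

Lemma jet_const {x y} (k : R) : jet x y (fun _ => k) (fun _ => 0) (fun _ => 0).
Proof. intros t _. split; apply @is_derive_const. Qed.

Lemma jet_exp {x y} (k : R) :
  jet x y (fun t => exp (k * t)) (fun t => k * exp (k * t)) (fun t => k * (k * exp (k * t))).
Proof. intros t _. split; [|apply is_derive_scal]; apply is_derive_exp_lin. Qed.

Lemma jet_mul_exp {x y u p s} (k : R) :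
  jet x y u p s ->
  jet x y (fun t => u t * exp (k * t)) (fun t => (p t + k * u t) * exp (k * t))
    (fun t => (s t + k * p t + k * (p t + k * u t)) * exp (k * t)).
Proof.
  intros J t Ht. destruct (J t Ht) as [D1 D2]. split; [apply is_derive_mul_exp, D1|].
  apply (is_derive_mul_exp (fun t => p t + k * u t)).
  apply (is_derive_plus p (fun t => k * u t)); [exact D2|apply is_derive_scal, D1].
Qed.

Lemma jet_shift {x y u p s} (tau : R) :
  jet (x + tau) (y + tau) u p s ->
  jet x y (fun t => u (t + tau)) (fun t => p (t + tau)) (fun t => s (t + tau)).
Proof.
  intros J t Ht. destruct (J (t + tau)) as [D1 D2]; [lra|]. split; apply is_derive_shift; auto.
Qed.

Lemma jet_weaken {x y x' y' u p s} : x <= x' -> y' <= y -> jet x y u p s -> jet x' y' u p s.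
Proof. intros Hx Hy J t Ht. apply J; lra. Qed.

Lemma jet_continuous {x y u p s} : jet x y u p s -> forall t, x < t < y -> continuous u t.
Proof. intros J t Ht. destruct (J t Ht) as [D _]. exact (derive_continuous u t _ D). Qed.

Lemma interior_min {x y u p s} (t0 : R) :
  jet x y u p s -> x < t0 < y -> (forall t, x < t < y -> u t0 <= u t) -> p t0 = 0 /\ 0 <= s t0.
Proof.
  intros J Ht0 Hmin.
  assert (P0 : p t0 = 0).
  { assert (pr : derivable_pt u t0). { exists (p t0). apply is_derive_Reals, J, Ht0. }
    rewrite <- (derive_pt_eq_0 u t0 (p t0) pr).
    - apply (deriv_minimum u x y t0 pr); try lra. intros t H1 H2; apply Hmin; lra.
    - apply is_derive_Reals, J, Ht0. }
  split; [exact P0|].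
  apply Rnot_lt_le; intros Hs.
  (* a negative second derivative makes [p] negative just to the right of [t0] *)
  destruct (J t0 Ht0) as [_ Hp]. apply is_derive_Reals in Hp.
  destruct (Hp (- s t0 / 2)) as [d Hd]; [lra|].
  pose proof (cond_pos d) as Hdp.
  set (e := Rmin (d / 2) ((y - t0) / 2)).
  assert (He : 0 < e) by (unfold e; apply Rmin_glb_lt; lra).
  assert (He1 : e <= d / 2) by apply Rmin_l.
  assert (He2 : e <= (y - t0) / 2) by apply Rmin_r.
  destruct (mean_value u p t0 (t0 + e)) as [t [Ht E]]; [lra| | |].
  - intros t Ht; apply J; lra.
  - intros t Ht; apply (jet_continuous J); lra.
  - assert (Hpt : p t < 0).
    { specialize (Hd (t - t0)).
      assert (H : Rabs ((p (t0 + (t - t0)) - p t0) / (t - t0) - s t0) < - s t0 / 2).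
      { apply Hd; [lra|]. rewrite Rabs_pos_eq; lra. }
      replace (t0 + (t - t0)) with t in H by ring.
      rewrite P0 in H. apply Rabs_def2 in H. destruct H as [H _].
      assert (H' : (p t - 0) / (t - t0) < 0) by lra.
      apply (Rmult_lt_compat_r (t - t0)) in H'; [|lra].
      unfold Rdiv in H'. rewrite Rmult_assoc, Rinv_l in H'; lra. }
    assert (u t0 <= u (t0 + e)) by (apply Hmin; lra).
    nra.
Qed.

(** Comparing [u] with a multiple of [v] through a point of contact replaces
    the differentiation of the quotient [u / v]. *)
Lemma touching {x y u p s v q z} (k t : R) :
  jet x y u p s -> jet x y v q z -> x < t < y ->
  (forall a, x < a < y -> u a <= k * v a) -> u t = k * v t ->
  p t = k * q t /\ s t <= k * z t.
Proof.
  intros J1 J2 Ht Hle Heq.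
  destruct (interior_min t (jet_lin (-1) k J1 J2) Ht) as [P0 S0]; [|lra].
  intros a Ha. specialize (Hle a Ha). lra.
Qed.

Lemma max_principle {x y w p s} (eps : R) :
  jet x y w p s -> (forall t, x <= t <= y -> continuous w t) ->
  w x <= eps -> w y <= eps ->
  (forall t, x < t < y -> eps < w t -> p t = 0 -> 0 < s t) ->
  forall t, x <= t <= y -> w t <= eps.
Proof.
  intros J Hc Hx Hy Hs t Ht. apply Rnot_lt_le; intros Hlt.
  destruct (exists_max_interval w x y t eps) as [tm [H1 [H2 H3]]]; auto.
  destruct (touching (w tm) tm J (jet_const 1) H1) as [P0 S0].
  - intros a Ha. specialize (H3 a). lra.
  - lra.
  - specialize (Hs tm H1 H2). lra.
Qed.

(** Strong maximum principle in one variable, without barriers: the operator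
    [z'' - c z' - K z] factors as [(d/dt - a) (d/dt - (c - a))] over the two
    real roots [a] of [a^2 - c a - K], so that two integrating factors, one
    for each root, carry [e = e' = 0] from [t1] to both sides. *)
Lemma strong_minimum {x y e p s} (c K t1 : R) :
  0 < K -> jet x y e p s ->
  (forall t, x < t < y -> s t - c * p t - K * e t <= 0) ->
  (forall t, x < t < y -> 0 <= e t) ->
  x < t1 < y -> e t1 = 0 ->
  forall t, x < t < y -> e t = 0.
Proof.
  intros HK J Hs He Ht1 E0.
  destruct (interior_min t1 J Ht1) as [P0 _].
  { intros t Ht. rewrite E0. auto. }
  set (q := sqrt (c * c + 4 * K)).
  assert (Hq : q * q = c * c + 4 * K) by (apply sqrt_sqrt; nra).
  (* the first factor: [e' - (c - a) e] times [exp (- a t)] is nonincreasing *)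
  assert (Hfac : forall a, a * a - c * a - K = 0 -> forall u v, x < u -> u <= v -> v < y ->
    (1 * p v + - (c - a) * e v) * exp (- a * v) <= (1 * p u + - (c - a) * e u) * exp (- a * u)).
  { intros a Ha u v Hu Huv Hv.
    assert (Hder : forall t, x < t < y ->
      is_derive (fun t => (1 * p t + - (c - a) * e t) * exp (- a * t)) t
        ((s t - c * p t - K * e t) * exp (- a * t))).
    { intros t Ht. destruct (J t Ht) as [D1 D2]. evar_last.
      - apply (is_derive_mul_exp (fun t => 1 * p t + - (c - a) * e t)), is_derive_lin; [exact D2|exact D1].
      - simpl. replace K with (a * a - c * a) by lra. ring. }
    assert (H : (1 * p v + - (c - a) * e v) * exp (- a * v) - (1 * p u + - (c - a) * e u) * exp (- a * u)
                <= 0 * (v - u)); [|lra].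
    apply (slope_le (fun t => (1 * p t + - (c - a) * e t) * exp (- a * t))
             (fun t => (s t - c * p t - K * e t) * exp (- a * t))); auto.
    - intros t Ht. eapply derive_continuous. apply Hder. lra.
    - intros t Ht. split; [apply Hder; lra|].
      assert (H1 : s t - c * p t - K * e t <= 0) by (apply Hs; lra).
      pose proof (exp_pos (- a * t)). nra. }
  assert (Hder2 : forall k t, x < t < y ->
    is_derive (fun t => e t * exp (k * t)) t ((p t + k * e t) * exp (k * t))).
  { intros k t Ht. apply is_derive_mul_exp. apply J; auto. }
  intros t Ht. apply Rle_antisym; [|auto].
  destruct (Rle_dec t t1) as [Hle|Hgt].
  - set (a := (c - q) / 2). set (k := - (c - a)).
    assert (Ha : a * a - c * a - K = 0) by (unfold a; nra).
    assert (H : 0 * (t1 - t) <= e t1 * exp (k * t1) - e t * exp (k * t)).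
    { apply (slope_ge (fun t => e t * exp (k * t)) (fun t => (p t + k * e t) * exp (k * t))); auto.
      - intros u Hu. eapply derive_continuous. apply Hder2. lra.
      - intros u Hu. split; [apply Hder2; lra|].
        assert (H := Hfac a Ha u t1). rewrite E0, P0 in H.
        assert (H' : 0 <= (1 * p u + - (c - a) * e u) * exp (- a * u)).
        { eapply Rle_trans; [|apply H; lra]. right; ring. }
        pose proof (exp_pos (- a * u)). pose proof (exp_pos (k * u)).
        assert (0 <= p u + k * e u) by (unfold k; nra). nra. }
    rewrite E0 in H. pose proof (exp_pos (k * t)). nra.
  - set (a := (c + q) / 2). set (k := - (c - a)).
    assert (Ha : a * a - c * a - K = 0) by (unfold a; nra).
    assert (H : e t * exp (k * t) - e t1 * exp (k * t1) <= 0 * (t - t1)).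
    { apply (slope_le (fun t => e t * exp (k * t)) (fun t => (p t + k * e t) * exp (k * t))); [lra| |].
      - intros u Hu. eapply derive_continuous. apply Hder2. lra.
      - intros u Hu. split; [apply Hder2; lra|].
        assert (H := Hfac a Ha t1 u). rewrite E0, P0 in H.
        assert (H' : (1 * p u + - (c - a) * e u) * exp (- a * u) <= 0).
        { eapply Rle_trans; [apply H; lra|]. right; ring. }
        pose proof (exp_pos (- a * u)). pose proof (exp_pos (k * u)).
        assert (p u + k * e u <= 0) by (unfold k; nra). nra. }
    rewrite E0 in H. pose proof (exp_pos (k * t)). nra.
Qed.

(** * Wave profiles: positivity, monotonicity, bounds on the speed *)

(** The second derivatives that the profile equations prescribe, with the
    delay written as [D]. *)
Definition rate_phi (r c D : R) (phi p psi : R -> R) (t : R) : R :=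
  c * p t - phi t * (1 - r - phi t + r * psi (t - D)).
Definition rate_psi (b c : R) (phi psi q : R -> R) (t : R) : R :=
  c * q t - b * phi t * (1 - psi t).

Lemma reaction_psi_nonneg (b x z : R) :
  0 < b -> 0 <= x <= 1 -> 0 <= z <= 1 -> 0 <= b * x * (1 - z) <= b * x.
Proof. intros Hb Hx Hz. assert (0 <= b * x) by (apply Rmult_le_pos; lra). split; nra. Qed.

Lemma reaction_phi_lower (r x z : R) :
  1 < r -> 0 <= x <= 1 -> 0 <= z <= 1 -> - r * x <= x * (1 - r - x + r * z) <= x * (1 - x).
Proof. intros Hr Hx Hz. assert (0 <= r * z <= r) by nra. split; nra. Qed.

(** Below the threshold [(r - 1) / (2 r)] of [psi] the state [phi = 0] is
    linearly stable. *)
Lemma reaction_phi_neg (r x z : R) :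
  1 < r -> 0 < x -> z <= (r - 1) / (2 * r) -> x * (1 - r - x + r * z) < 0.
Proof.
  intros Hr Hx Hz. apply (Rmult_le_compat_l r) in Hz; [|lra].
  replace (r * ((r - 1) / (2 * r))) with ((r - 1) / 2) in Hz by (field; lra). nra.
Qed.

Definition vanishes_left (f : R -> R) : Prop :=
  forall eps, 0 < eps -> exists x, forall t, t <= x -> f t < eps.
Definition tends_to_one_right (f : R -> R) : Prop :=
  forall eps, 0 < eps -> exists y, forall t, y <= t -> 1 - eps < f t.

Record wave (r b c D : R) (phi p psi q : R -> R) : Prop := {
  wave_phi_jet : forall x y, jet x y phi p (rate_phi r c D phi p psi);
  wave_psi_jet : forall x y, jet x y psi q (rate_psi b c phi psi q);
  wave_phi_bound : forall t, 0 <= phi t <= 1;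
  wave_psi_bound : forall t, 0 <= psi t <= 1;
  wave_phi_left : vanishes_left phi;
  wave_psi_left : vanishes_left psi;
  wave_phi_right : tends_to_one_right phi;
  wave_psi_right : tends_to_one_right psi }.
Arguments wave_phi_jet {r b c D phi p psi q}.
Arguments wave_psi_jet {r b c D phi p psi q}.

Lemma wave_derive {r b c D phi p psi q} : wave r b c D phi p psi q ->
  (forall t, is_derive phi t (p t)) /\ (forall t, is_derive p t (rate_phi r c D phi p psi t)) /\
  (forall t, is_derive psi t (q t)) /\ (forall t, is_derive q t (rate_psi b c phi psi q t)).
Proof.
  intros W.
  assert (H1 := fun t => wave_phi_jet W (t - 1) (t + 1) t ltac:(lra)).
  assert (H2 := fun t => wave_psi_jet W (t - 1) (t + 1) t ltac:(lra)).
  split; [|split; [|split]]; intros t; destruct (H1 t), (H2 t); assumption.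
Qed.

Lemma wave_continuous {r b c D phi p psi q} : wave r b c D phi p psi q ->
  (forall t, continuous phi t) /\ (forall t, continuous psi t).
Proof.
  intros W. destruct (wave_derive W) as [D1 [_ [D3 _]]].
  split; intros t; [exact (derive_continuous _ _ _ (D1 t))|exact (derive_continuous _ _ _ (D3 t))].
Qed.

(** The equilibria 0 and 1 cannot be reached at a finite point: by the strong
    maximum principle a contact would spread along the whole line. *)
Lemma wave_psi_lt_1 {r b c D phi p psi q} :
  0 < b -> wave r b c D phi p psi q -> forall t, psi t < 1.
Proof.
  intros Hb W t. destruct W as [_ J2 B1 B2 _ L2 _ _].
  apply Rnot_le_lt; intros Ht. assert (E : psi t = 1) by (specialize (B2 t); lra).
  destruct (L2 (1/2)) as [x Hx]; [lra|]. specialize (Hx (Rmin x t) (Rmin_l _ _)).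
  pose proof (Rmin_r x t).
  assert (H' : -1 * psi (Rmin x t) + 1 * 1 = 0); [|lra].
  apply (strong_minimum c b t Hb (jet_lin (-1) 1 (J2 (Rmin x t - 1) (t + 1)) (jet_const 1))); try lra.
  - intros u _. unfold rate_psi. specialize (B1 u). specialize (B2 u).
    assert (0 <= b * (1 - phi u) * (1 - psi u)) by (apply Rmult_le_pos; [apply Rmult_le_pos|]; lra). nra.
  - intros u _. specialize (B2 u). lra.
Qed.

Lemma wave_phi_pos {r b c D phi p psi q} :
  1 < r -> wave r b c D phi p psi q -> forall t, 0 < phi t.
Proof.
  intros Hr W t. destruct W as [J1 _ B1 B2 _ _ R1 _].
  apply Rnot_le_lt; intros Ht. assert (E : phi t = 0) by (specialize (B1 t); lra).
  destruct (R1 (1/2)) as [x Hx]; [lra|]. specialize (Hx (Rmax x t) (Rmax_l _ _)).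
  pose proof (Rmax_r x t).
  assert (H' : phi (Rmax x t) = 0); [|lra].
  apply (strong_minimum c r t ltac:(lra) (J1 (t - 1) (Rmax x t + 1))); auto; try lra.
  - intros u _. unfold rate_phi. pose proof (reaction_phi_lower r (phi u) (psi (u - D)) Hr (B1 u) (B2 _)). lra.
  - intros u _. apply B1.
Qed.

(** [q' <= c q], so [q <= 0] at one point would persist to the right, and [psi]
    could not rise to 1. *)
Lemma wave_psi_incr {r b c D phi p psi q} :
  1 < r -> 0 < b -> wave r b c D phi p psi q -> forall t, 0 < q t.
Proof.
  intros Hr Hb W t0.
  assert (P := wave_phi_pos Hr W). assert (Q := wave_psi_lt_1 Hb W).
  destruct (wave_continuous W) as [_ Hc]. destruct (wave_derive W) as [D1 [D2 [D3 D4]]].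
  destruct W as [_ _ B1 B2 _ _ _ R2].
  apply Rnot_le_lt; intros Ht.
  assert (Hneg : forall t, t0 < t -> q t <= 0).
  { intros t Htt. apply (stays_nonpos c t0 t q (rate_psi b c phi psi q)); [lra| |exact Ht].
    intros u _. split; [exact (D4 u)|]. unfold rate_psi.
    pose proof (reaction_psi_nonneg b _ _ Hb (B1 u) (B2 u)). lra. }
  destruct (R2 (1 - psi t0)) as [y Hy]; [specialize (Q t0); lra|].
  specialize (Hy (Rmax y t0) (Rmax_l _ _)). pose proof (Rmax_r y t0).
  assert (H0 : psi (Rmax y t0) - psi t0 <= 0 * (Rmax y t0 - t0)); [|lra].
  apply (slope_le psi q); [lra|auto|]. intros u Hu. split; [exact (D3 u)|apply Hneg; lra].
Qed.

Lemma wave_psi_strict {r b c D phi p psi q} :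
  1 < r -> 0 < b -> wave r b c D phi p psi q -> forall s t, s < t -> psi s < psi t.
Proof.
  intros Hr Hb W s t Hst.
  destruct (wave_derive W) as [_ [_ [D3 _]]].
  destruct (mean_value psi q s t Hst) as [z [_ E]].
  - intros u _. exact (D3 u).
  - intros u _. apply (wave_continuous W).
  - pose proof (wave_psi_incr Hr Hb W z). nra.
Qed.

(** [q - c psi] decreases strictly, as its derivative is [- b phi (1 - psi)].
    If [c <= 0] it is positive, so it stays away from 0 at [- oo], where
    [psi] vanishes: [psi] would have a slope bounded below there. *)
Lemma wave_speed_pos {r b c D phi p psi q} :
  1 < r -> 0 < b -> wave r b c D phi p psi q -> 0 < c.
Proof.
  intros Hr Hb W.
  assert (Qi := wave_psi_incr Hr Hb W). destruct (wave_derive W) as [D1 [D2 [D3 D4]]].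
  destruct W as [_ _ B1 B2 _ L2 _ _].
  apply Rnot_le_lt; intros Hneg.
  set (y0 := q 0 - c * psi 0).
  assert (Hy0 : 0 < y0) by (unfold y0; specialize (Qi 0); specialize (B2 0); nra).
  assert (Hy : forall t, t <= 0 -> y0 <= q t - c * psi t).
  { intros t Ht.
    assert (Hd : forall u, is_derive (fun t => 1 * q t + - c * psi t) u
               (1 * rate_psi b c phi psi q u + - c * q u)).
    { intros u. apply is_derive_lin; [exact (D4 u)|exact (D3 u)]. }
    assert (H : (1 * q 0 + - c * psi 0) - (1 * q t + - c * psi t) <= 0 * (0 - t)); [|unfold y0; lra].
    apply (slope_le (fun t => 1 * q t + - c * psi t)
             (fun u => 1 * rate_psi b c phi psi q u + - c * q u) t 0 0 Ht).
    - intros u _. eapply derive_continuous. apply Hd.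
    - intros u _. split; [apply Hd|]. unfold rate_psi.
      pose proof (reaction_psi_nonneg b _ _ Hb (B1 u) (B2 u)). lra. }
  destruct (L2 (y0 / (2 * (1 - c)))) as [x Hx]; [apply Rdiv_lt_0_compat; lra|].
  pose proof (Rmin_l x 0). pose proof (Rmin_r x 0).
  apply (no_steep_run psi q (Rmin x 0 - 2 / (y0 / 2)) (y0 / 2)); [lra|exact B2|].
  intros t Ht. split; [exact (D3 t)|].
  assert (H1 : psi t < y0 / (2 * (1 - c))) by (apply Hx; lra).
  assert (H2 : y0 <= q t - c * psi t) by (apply Hy; lra).
  apply (Rmult_lt_compat_r (2 * (1 - c))) in H1; [|lra].
  unfold Rdiv in H1. rewrite Rmult_assoc, Rinv_l in H1; [|lra].
  specialize (B2 t). nra.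
Qed.

(** While [psi] is below the threshold, [phi'' - c phi' > 0] where [phi > 0],
    and [exp (c (t - T))] solves [z'' - c z' = 0]: it dominates [phi]. *)
Lemma phi_decay (r c D x T eps : R) (phi p psi : R -> R) :
  1 < r -> 0 <= eps -> x <= T ->
  (forall t, continuous phi t) -> jet x T phi p (rate_phi r c D phi p psi) ->
  (forall t, 0 <= phi t <= 1) ->
  (forall t, t < T -> psi (t - D) <= (r - 1) / (2 * r)) ->
  phi x <= eps ->
  forall t, x <= t <= T -> phi t <= exp (c * (t - T)) + eps.
Proof.
  intros Hr He HxT Hcont J B1 Hth Hx t Ht.
  set (B := exp (- (c * T))).
  assert (HB : forall t, exp (c * (t - T)) = B * exp (c * t)).
  { intros u. unfold B. rewrite <- exp_plus. f_equal. ring. }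
  assert (Bp : 0 < B) by apply exp_pos.
  assert (H : 1 * phi t + - B * exp (c * t) <= eps); [|rewrite HB; lra].
  apply (max_principle eps (jet_lin 1 (- B) J (jet_exp c))); auto.
  - intros u Hu. apply continuous_lin; auto. eapply derive_continuous, is_derive_exp_lin.
  - pose proof (exp_pos (c * x)). nra.
  - rewrite Ropp_mult_distr_l_reverse, <- HB, Rminus_diag, Rmult_0_r, exp_0. specialize (B1 T). lra.
  - intros u Hu Hgt Hp. pose proof (exp_pos (c * u)).
    assert (Hneg := reaction_phi_neg r (phi u) (psi (u - D)) Hr ltac:(nra) (Hth u ltac:(lra))).
    unfold rate_phi. replace (p u) with (B * (c * exp (c * u))) by lra. lra.
Qed.

(** The exponent [c / 2] makes [- (z'' - c z')] a positive multiple
    [c^2 / 4] of the barrier [z], which absorbs the source [b phi]. *)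
Lemma psi_decay (b c x T eps : R) (phi psi q : R -> R) :
  0 < b -> 0 < c -> 0 <= eps -> x <= T ->
  (forall t, continuous psi t) -> jet x T psi q (rate_psi b c phi psi q) ->
  (forall t, 0 <= phi t <= 1) -> (forall t, 0 <= psi t <= 1) ->
  (forall t, x <= t <= T -> phi t <= exp (c * (t - T))) ->
  psi x <= eps ->
  forall t, x <= t <= T -> psi t <= (1 + 4 * b / (c * c)) * exp (c / 2 * (t - T)) + eps.
Proof.
  intros Hb Hc He HxT Hcont J B1 B2 Hphi Hx t Ht.
  set (k := c / 2). set (A := 1 + 4 * b / (c * c)).
  assert (HA : A * (c * c) = c * c + 4 * b) by (unfold A; field; lra).
  assert (HA1 : 1 < A).
  { unfold A. assert (0 < 4 * b / (c * c)); [|lra]. apply Rdiv_lt_0_compat; nra. }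
  set (E := exp (- (k * T))). set (B := A * E).
  assert (HE : forall t, exp (k * (t - T)) = E * exp (k * t)).
  { intros u. unfold E. rewrite <- exp_plus. f_equal. ring. }
  assert (HB : forall t, A * exp (k * (t - T)) = B * exp (k * t)).
  { intros u. rewrite HE. unfold B. ring. }
  assert (Ep : 0 < E) by apply exp_pos.
  assert (Bp : 0 < B) by (unfold B; nra).
  assert (H : 1 * psi t + - B * exp (k * t) <= eps); [|rewrite HB; lra].
  apply (max_principle eps (jet_lin 1 (- B) J (jet_exp k))); auto.
  - intros u Hu. apply continuous_lin; auto. eapply derive_continuous, is_derive_exp_lin.
  - pose proof (exp_pos (k * x)). nra.
  - rewrite Ropp_mult_distr_l_reverse, <- HB, Rminus_diag, Rmult_0_r, exp_0. specialize (B2 T). lra.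
  - intros u Hu Hgt Hp. unfold rate_psi. pose proof (exp_pos (k * u)) as Xp.
    replace (q u) with (B * (k * exp (k * u))) by lra.
    assert (H1 : phi u <= E * exp (k * u)).
    { rewrite <- HE. eapply Rle_trans; [apply Hphi; lra|]. apply exp_le. unfold k; nra. }
    destruct (reaction_psi_nonneg b _ _ Hb (B1 u) (B2 u)) as [_ H3].
    assert (H3' : b * phi u <= b * (E * exp (k * u))) by (apply Rmult_le_compat_l; lra).
    assert (H4 : B * (c * k - k * k) = E * (c * c / 4 + b)).
    { unfold B, k. replace (A * E * (c * (c / 2) - c / 2 * (c / 2))) with (E * (A * (c * c)) / 4) by field.
      rewrite HA. field. }
    assert (H5 : B * (c * k - k * k) * exp (k * u) = E * (c * c / 4 + b) * exp (k * u)) by (rewrite H4; ring).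
    assert (0 < E * exp (k * u)) by nra.
    assert (0 < c * c / 4 * (E * exp (k * u))) by (apply Rmult_lt_0_compat; nra).
    nra.
Qed.

(** Translates of [phi] are compared near [- oo] through [p > 0], which holds as
    long as [psi] stays below the threshold; the exponential bounds are the two
    preceding lemmas with [eps] tending to 0. *)
Lemma wave_decay {r b c D phi p psi q} :
  1 < r -> 0 < b -> 0 <= D -> wave r b c D phi p psi q ->
  exists T, (forall t, t <= T -> 0 < p t) /\
    (forall t, t <= T -> phi t <= exp (c * (t - T))) /\
    (forall t, t <= T -> psi t <= (1 + 4 * b / (c * c)) * exp (c / 2 * (t - T))).
Proof.
  intros Hr Hb HD W.
  assert (P := wave_phi_pos Hr W). assert (Hc := wave_speed_pos Hr Hb W).
  destruct (wave_continuous W) as [C1 C2]. destruct (wave_derive W) as [D1 [D2 [D3 D4]]].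
  destruct W as [J1 J2 B1 B2 L1 L2 _ _].
  destruct (L2 ((r - 1) / (2 * r))) as [T HT]; [apply Rdiv_lt_0_compat; lra|].
  exists T.
  assert (Hth : forall t, t <= T -> psi (t - D) <= (r - 1) / (2 * r)) by (intros t Ht; left; apply HT; lra).
  assert (Hphi : forall t, t <= T -> phi t <= exp (c * (t - T))).
  { intros t Ht. apply Rnot_lt_le; intros Hlt.
    set (eps := (phi t - exp (c * (t - T))) / 2).
    destruct (L1 eps) as [x Hx]; [unfold eps; lra|]. specialize (Hx (Rmin x t) (Rmin_l _ _)).
    pose proof (Rmin_r x t).
    assert (phi t <= exp (c * (t - T)) + eps); [|unfold eps in *; lra].
    apply (phi_decay r c D (Rmin x t) T eps phi p psi); auto; try (unfold eps in *; lra).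
    intros u Hu; apply Hth; lra. }
  split; [|split; [exact Hphi|]].
  - intros t Ht. apply Rnot_le_lt; intros Hp.
    (* [p t <= 0] would make [phi] nonincreasing to the left of [t], hence at least [phi t] there *)
    assert (Hneg : forall s, s < t -> p s <= 0).
    { intros s Hs.
      destruct (mean_value (fun t => p t * exp (- c * t))
         (fun t => (rate_phi r c D phi p psi t + - c * p t) * exp (- c * t)) s t Hs) as [z [Hz E]].
      - intros u _. exact (is_derive_mul_exp p u _ (- c) (D2 u)).
      - intros u _. exact (derive_continuous _ _ _ (is_derive_mul_exp p u _ (- c) (D2 u))).
      - pose proof (exp_pos (- c * z)). pose proof (exp_pos (- c * s)). pose proof (exp_pos (- c * t)).
        assert (Hrn := reaction_phi_neg r (phi z) (psi (z - D)) Hr (P z) (Hth z ltac:(lra))).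
        assert (Hin : 0 < (rate_phi r c D phi p psi z + - c * p z) * exp (- c * z)).
        { apply Rmult_lt_0_compat; [unfold rate_phi; lra|auto]. }
        nra. }
    destruct (L1 (phi t) (P t)) as [x Hx]. specialize (Hx (Rmin x t) (Rmin_l _ _)).
    pose proof (Rmin_r x t).
    assert (phi t - phi (Rmin x t) <= 0 * (t - Rmin x t)); [|lra].
    apply (slope_le phi p); [lra|auto|]. intros u Hu. split; [exact (D1 u)|apply Hneg; lra].
  - intros t Ht. apply Rnot_lt_le; intros Hlt.
    set (eps := (psi t - (1 + 4 * b / (c * c)) * exp (c / 2 * (t - T))) / 2).
    destruct (L2 eps) as [x Hx]; [unfold eps; lra|]. specialize (Hx (Rmin x t) (Rmin_l _ _)).
    pose proof (Rmin_r x t).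
    assert (psi t <= (1 + 4 * b / (c * c)) * exp (c / 2 * (t - T)) + eps); [|unfold eps in *; lra].
    apply (psi_decay b c (Rmin x t) T eps phi psi q); auto; try (unfold eps in *; lra).
    intros u Hu. apply Hphi; lra.
Qed.

(** The reaction rate per unit of [phi] decreases in [phi] and increases in
    [psi]. Hence a nondecreasing [psi] excludes a contact of [phi] with a
    multiple [k >= 1] of its own translate to the left of it, unless both
    [k = 1] and the delayed values of [psi] coincide. *)
Lemma no_contact_with_translate {r c D x y phi p psi} (tau k t : R) :
  1 < r -> 0 < phi t -> 0 < phi (t + tau) -> x < t < y ->
  jet x (y + tau) phi p (rate_phi r c D phi p psi) -> 0 < tau -> 1 <= k ->
  psi (t - D) <= psi (t + tau - D) -> 1 < k \/ psi (t - D) < psi (t + tau - D) ->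
  (forall a, x < a < y -> phi a <= k * phi (a + tau)) -> phi t = k * phi (t + tau) -> False.
Proof.
  intros Hr Pt Pt' Ht J Htau Hk Hpsi Hor Hle E.
  assert (J1 : jet x y phi p (rate_phi r c D phi p psi)) by (intros a Ha; apply J; lra).
  assert (J2 : jet (x + tau) (y + tau) phi p (rate_phi r c D phi p psi)) by (intros a Ha; apply J; lra).
  destruct (touching k t J1 (jet_shift tau J2) Ht Hle E) as [P0 S0].
  unfold rate_phi in S0. rewrite P0 in S0.
  assert (phi t * (1 - r - phi (t + tau) + r * psi (t + tau - D))
          <= phi t * (1 - r - phi t + r * psi (t - D))) by (rewrite E at 1; nra).
  assert (H1 : 1 - r - phi (t + tau) + r * psi (t + tau - D) <= 1 - r - phi t + r * psi (t - D)).
  { apply Rmult_le_reg_l with (phi t); lra. }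
  assert (phi (t + tau) <= phi t) by nra.
  destruct Hor as [Hk1|Hlt]; [|nra].
  assert (phi (t + tau) < phi t) by nra. nra.
Qed.

(** The ratio of [phi] to its translate to the left of it is at most 1 near
    [- oo], where [phi] increases, and has limit 1 at [+ oo]. A value above 1
    would give an interior maximum, hence a contact. *)
Lemma wave_phi_strict {r b c D phi p psi q} :
  1 < r -> 0 < b -> 0 <= D -> wave r b c D phi p psi q ->
  forall s t, s < t -> phi s < phi t.
Proof.
  intros Hr Hb HD W.
  assert (P := wave_phi_pos Hr W). destruct (wave_continuous W) as [C1 _].
  assert (Inc := wave_psi_strict Hr Hb W). destruct (wave_derive W) as [D1 [D2 [D3 D4]]].
  destruct (wave_decay Hr Hb HD W) as [T [HT _]].
  destruct W as [J1 _ B1 _ _ _ R1 _].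
  assert (G : forall tau, 0 < tau -> forall k t, 1 <= k ->
     phi t = k * phi (t + tau) -> (forall a, phi a <= k * phi (a + tau)) -> False).
  { intros tau Htau k t Hk E Hle.
    assert (psi (t - D) < psi (t + tau - D)) by (apply Inc; lra).
    apply (no_contact_with_translate tau k t Hr (P _) (P _)
             (ltac:(lra) : t - 1 < t < t + 1) (J1 (t - 1) (t + 1 + tau))); auto; lra. }
  assert (Hle : forall tau t, 0 < tau -> phi t <= phi (t + tau)).
  { intros tau x0 Htau. apply Rnot_lt_le; intros Hlt.
    set (w := fun t => phi t / phi (t + tau)).
    assert (Hval : forall t, phi t = w t * phi (t + tau)).
    { intros t. unfold w. field. specialize (P (t + tau)); lra. }
    assert (Hw_le : forall t m, phi t <= m * phi (t + tau) -> w t <= m).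
    { intros t m H. apply Rmult_le_reg_r with (phi (t + tau)); [apply P|]. rewrite <- Hval. exact H. }
    set (m := (1 + w x0) / 2).
    assert (Hw : 1 < w x0).
    { apply Rnot_le_lt; intros H. specialize (Hval x0). specialize (P (x0 + tau)). nra. }
    assert (Hm : 1 < m) by (unfold m; lra).
    destruct (R1 (1 - / m)) as [y Hy].
    { assert (/ m < 1); [|lra]. rewrite <- Rinv_1. apply Rinv_lt_contravar; lra. }
    destruct (exists_max_global w (T - tau) y x0 m) as [tm [H2 H3]].
    - intros t. apply (continuous_ratio phi (fun t => phi (t + tau))); [auto|apply continuous_shift; auto|apply P].
    - unfold m; lra.
    - intros t Ht. apply Hw_le. assert (0 * (t + tau - t) <= phi (t + tau) - phi t).
      { apply (slope_ge phi p); [lra|auto|]. intros u Hu. split; [exact (D1 u)|]. left; apply HT; lra. }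
      specialize (P (t + tau)). nra.
    - intros t Ht. apply Hw_le. assert (Hy' : / m < phi (t + tau)) by (specialize (Hy (t + tau) ltac:(lra)); lra).
      apply (Rmult_lt_compat_l m) in Hy'; [|lra]. rewrite Rinv_r in Hy' by lra.
      specialize (B1 t). lra.
    - apply (G tau Htau (w tm) tm); [lra|apply Hval|].
      intros a. rewrite Hval. apply Rmult_le_compat_r; [left; apply P|apply H3]. }
  intros s t Hst. destruct (Rlt_dec (phi s) (phi t)) as [|Hn]; [auto|exfalso].
  assert (E := Hle (t - s) s ltac:(lra)). replace (s + (t - s)) with t in E by ring.
  apply (G (t - s) ltac:(lra) 1 s); [lra| |].
  - replace (s + (t - s)) with t by ring. lra.
  - intros a. rewrite Rmult_1_l. apply Hle; lra.
Qed.

(** A zero of [phi'] would be a minimum of [phi'], so that [phi'' = 0] and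
    [phi''' >= 0] there; differentiating the equation gives
    [phi''' = - r phi psi'(t - D) < 0]. *)
Lemma wave_phi_incr {r b c D phi p psi q} :
  1 < r -> 0 < b -> 0 <= D -> wave r b c D phi p psi q -> forall t, 0 < p t.
Proof.
  intros Hr Hb HD W t.
  assert (P := wave_phi_pos Hr W). assert (Qi := wave_psi_incr Hr Hb W).
  assert (Inc := wave_phi_strict Hr Hb HD W). destruct (wave_derive W) as [D1 [D2 [D3 D4]]].
  assert (Hp : forall t, 0 <= p t).
  { intros a. apply (increasing_derive_nonneg phi a); [|exact (D1 a)].
    intros u v [Huv| ->]; [left; apply Inc; auto|lra]. }
  destruct (Rle_lt_or_eq_dec 0 (p t) (Hp t)) as [|E]; [auto|exfalso].
  set (s := rate_phi r c D phi p psi).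
  set (third := fun t => c * s t - (p t * (1 - r - phi t + r * psi (t - D)) + phi t * (- p t + r * q (t - D)))).
  assert (J : jet (t - 1) (t + 1) p s third).
  { intros u _. split; [exact (D2 u)|]. unfold s at 1, rate_phi.
    assert (E1 : is_derive (fun t => psi (t - D)) u (q (u - D))) by (apply (is_derive_shift psi (- D)), D3).
    assert (E2 : is_derive (fun t => (1 - r) - phi t + r * psi (t - D)) u (- p u + r * q (u - D))).
    { evar_last.
      - apply (is_derive_plus (fun t => (1 - r) - phi t) (fun t => r * psi (t - D))).
        + apply (is_derive_minus (fun _ => 1 - r) phi); [apply is_derive_const|exact (D1 u)].
        + apply is_derive_scal. exact E1.
      - unfold minus, plus, opp, zero; simpl. ring. }
    apply (is_derive_minus (fun t => c * p t)).
    - apply is_derive_scal. exact (D2 u).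
    - apply (is_derive_mult phi (fun t => 1 - r - phi t + r * psi (t - D))); [exact (D1 u)|exact E2|].
      intros a b'; apply Rmult_comm. }
  destruct (interior_min t J ltac:(lra)) as [S0 S1].
  - intros a _. rewrite <- E. auto.
  - unfold third in S1. rewrite S0, <- E in S1. specialize (P t). specialize (Qi (t - D)).
    assert (0 < phi t * (r * q (t - D))) by (apply Rmult_lt_0_compat; [|apply Rmult_lt_0_compat]; lra).
    lra.
Qed.

(** At a nonpositive minimum of [psi - phi], monotonicity of [psi] removes the
    delay, and the two equations then contradict each other since
    [b (1 - psi) > (1 - phi) - r (1 - psi)]. *)
Lemma wave_phi_lt_psi {r b c D phi p psi q} :
  1 < r -> 0 < b -> 0 <= D -> wave r b c D phi p psi q -> forall t, phi t < psi t.
Proof.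
  intros Hr Hb HD W.
  assert (P := wave_phi_pos Hr W). assert (Q := wave_psi_lt_1 Hb W).
  assert (Inc := wave_psi_strict Hr Hb W). destruct (wave_continuous W) as [C1 C2].
  destruct W as [J1 J2 B1 B2 L1 _ _ R2].
  assert (G : forall t, psi t <= phi t -> (forall a, phi a - psi a <= phi t - psi t) -> False).
  { intros t Ht Hmax.
    destruct (interior_min t (jet_lin 1 (-1) (J2 (t - 1) (t + 1)) (J1 (t - 1) (t + 1)))) as [P0 S0]; try lra.
    - intros a _. specialize (Hmax a). lra.
    - assert (psi (t - D) <= psi t).
      { destruct HD as [HD| <-]; [left; apply Inc; lra|]. right; f_equal; ring. }
      unfold rate_phi, rate_psi in S0. specialize (P t). specialize (Q t).
      assert (Hq : q t = p t) by lra. rewrite Hq in S0.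
      assert (b * (1 - psi t) <= 1 - r - phi t + r * psi (t - D)).
      { apply Rmult_le_reg_l with (phi t); lra. }
      nra. }
  intros x0. apply Rnot_le_lt; intros H0.
  destruct (classic (exists a, 0 < phi a - psi a)) as [[a Ha]|Hno].
  - set (m := (phi a - psi a) / 2).
    destruct (L1 m) as [x Hx]; [unfold m; lra|].
    destruct (R2 m) as [y Hy]; [unfold m; lra|].
    destruct (exists_max_global (fun t => 1 * phi t + -1 * psi t) x y a m) as [tm [H2 H3]].
    + intros t; apply continuous_lin; auto.
    + unfold m; lra.
    + intros t Ht. specialize (Hx t Ht). specialize (B2 t). lra.
    + intros t Ht. specialize (Hy t Ht). specialize (B1 t). lra.
    + apply (G tm); [unfold m in *; lra|]. intros u. specialize (H3 u). lra.
  - apply (G x0); [exact H0|]. intros a. apply Rnot_lt_le; intros Ha.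
    apply Hno. exists a. lra.
Qed.

(** The growth rate of [phi] is below 1, so [exp (c t / 2)] is a strict
    supersolution once [c^2 / 4 >= 1]. Because [phi] decays like [exp (c t)],
    the ratio [phi exp (- c t / 2)] would have an interior maximum. *)
Lemma wave_speed_lt_2 {r b c D phi p psi q} :
  1 < r -> 0 < b -> 0 <= D -> wave r b c D phi p psi q -> c < 2.
Proof.
  intros Hr Hb HD W.
  assert (P := wave_phi_pos Hr W). destruct (wave_continuous W) as [C1 _].
  destruct (wave_decay Hr Hb HD W) as [T [_ [HT _]]].
  destruct W as [J1 _ B1 B2 _ _ _ _].
  apply Rnot_le_lt; intros Hc.
  set (w := fun t => phi t * exp (- (c / 2 * t))).
  assert (Hval : forall t, phi t = w t * exp (c / 2 * t)).
  { intros t. unfold w. rewrite Rmult_assoc, exp_neg_cancel. ring. }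
  set (m := w 0 / 2).
  assert (Hm : 0 < m).
  { unfold m, w. specialize (P 0). pose proof (exp_pos (- (c / 2 * 0))). nra. }
  destruct (exp_small_left (c / 2) (m * exp (c * T))) as [x Hx]; [lra| |].
  { pose proof (exp_pos (c * T)). nra. }
  destruct (exp_small_left (c / 2) m) as [y Hy]; [lra|exact Hm|].
  destruct (exists_max_global w (Rmin x T) (- y) 0 m) as [tm [H2 H3]].
  - intros t. apply (continuous_mult phi); [auto|].
    apply (continuous_ext (fun t => exp (- (c / 2) * t))).
    { intros s. f_equal. ring. } eapply derive_continuous, is_derive_exp_lin.
  - unfold m in *; lra.
  - intros t Ht. pose proof (Rmin_l x T). pose proof (Rmin_r x T).
    assert (H1 : phi t <= exp (c * (t - T))) by (apply HT; lra).
    assert (H2 : exp (c / 2 * t) < m * exp (c * T)) by (apply Hx; lra).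
    apply Rmult_le_reg_r with (exp (c / 2 * t)); [apply exp_pos|]. rewrite <- Hval.
    apply Rle_trans with (exp (c / 2 * t) * (exp (c / 2 * t) * exp (- (c * T)))).
    { rewrite <- !exp_plus. eapply Rle_trans; [exact H1|]. apply exp_le. lra. }
    rewrite Rmult_comm. apply Rmult_le_compat_r; [left; apply exp_pos|].
    apply Rle_trans with (m * exp (c * T) * exp (- (c * T))).
    { apply Rmult_le_compat_r; [left; apply exp_pos|lra]. }
    right. rewrite Rmult_assoc, (Rmult_comm (exp (c * T))), exp_neg_cancel. ring.
  - intros t Ht. assert (H1 : exp (c / 2 * - t) < m) by (apply Hy; lra).
    unfold w. replace (- (c / 2 * t)) with (c / 2 * - t) by ring.
    pose proof (exp_pos (c / 2 * - t)). specialize (B1 t). nra.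
  - destruct (touching (w tm) tm (J1 (tm - 1) (tm + 1)) (jet_exp (c / 2))) as [P0 S0]; [lra| |apply Hval|].
    + intros a _. rewrite Hval. apply Rmult_le_compat_r; [left; apply exp_pos|apply H3].
    + assert (Hp : p tm = c / 2 * phi tm) by (rewrite (Hval tm), P0; ring).
      assert (Hs : w tm * (c / 2 * (c / 2 * exp (c / 2 * tm))) = c * c / 4 * phi tm) by (rewrite (Hval tm); field).
      unfold rate_phi in S0. rewrite Hs, Hp in S0.
      specialize (P tm). specialize (B2 (tm - D)).
      assert (c * c / 4 <= 1 - r - phi tm + r * psi (tm - D)).
      { apply Rmult_le_reg_l with (phi tm); lra. }
      nra.
Qed.

(** * Uniqueness of the speed *)

Lemma vanishes_left_shift (f : R -> R) (tau : R) :
  vanishes_left f -> vanishes_left (fun t => f (t + tau)).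
Proof. intros H e He. destruct (H e He) as [x Hx]. exists (x - tau). intros t Ht. apply Hx; lra. Qed.

Lemma tends_to_one_right_shift (f : R -> R) (tau : R) :
  tends_to_one_right f -> tends_to_one_right (fun t => f (t + tau)).
Proof. intros H e He. destruct (H e He) as [x Hx]. exists (x - tau). intros t Ht. apply Hx; lra. Qed.

Lemma rate_phi_shift (r c D tau : R) (phi p psi : R -> R) (t : R) :
  rate_phi r c D (fun t => phi (t + tau)) (fun t => p (t + tau)) (fun t => psi (t + tau)) t =
  rate_phi r c D phi p psi (t + tau).
Proof. unfold rate_phi. replace (t - D + tau) with (t + tau - D) by ring. reflexivity. Qed.

Lemma wave_shift {r b c D phi p psi q} (tau : R) :
  wave r b c D phi p psi q ->
  wave r b c D (fun t => phi (t + tau)) (fun t => p (t + tau))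
    (fun t => psi (t + tau)) (fun t => q (t + tau)).
Proof.
  intros [J1 J2 B1 B2 L1 L2 R1 R2]. constructor.
  - intros x y t Ht. rewrite rate_phi_shift. exact (jet_shift tau (J1 (x + tau) (y + tau)) t Ht).
  - intros x y. exact (jet_shift tau (J2 (x + tau) (y + tau))).
  - auto.
  - auto.
  - apply vanishes_left_shift; auto.
  - apply vanishes_left_shift; auto.
  - apply tends_to_one_right_shift; auto.
  - apply tends_to_one_right_shift; auto.
Qed.

(** Half the product of the stability margins of the two equations at [- oo]
    for the weight [exp (c t / 4)], over the coupling constants. *)
Definition small_left (r b c : R) : R := (r - 1) / 2 * (3 * (c * c) / (32 * b)) / (2 * r).

(** The faster wave [(f2, g2)] is a strict subsolution for the slower speed
    [c]. Near [- oo] the state is only neutrally stable in the direction of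
    [psi]; differences are therefore measured in the weight [exp (kap t)],
    [kap = c / 4], in which both equations are strictly stable and still both
    waves vanish at [- oo]. At a positive maximum of the larger weighted
    component of [(f2 - f, k (g2 - g))] the equation of that component fails:
    in the first because [f <= f2] is small there, in the second by the choice
    of [k]. Smallness is required of the faster wave alone, so that the lemma
    applies to all translates of the slower one. *)
Lemma ordered_left r b c c2 D D2 f p g q f2 p2 g2 q2 N :
  1 < r -> 0 < b -> 0 <= D -> D <= D2 -> c < c2 ->
  wave r b c D f p g q -> wave r b c2 D2 f2 p2 g2 q2 ->
  (forall t, t <= N -> f2 t <= small_left r b c /\ g2 t <= (r - 1) / (2 * r)) ->
  f2 N <= f N -> g2 N <= g N ->
  forall t, t <= N -> f2 t <= f t /\ g2 t <= g t.
Proof.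
  intros Hr Hb HD HDD Hcc W W' Hsm Nf Ng x0 Hx0.
  assert (Hc := wave_speed_pos Hr Hb W). assert (HD2 : 0 <= D2) by lra.
  destruct (wave_decay Hr Hb HD2 W') as [T [_ [HT1 HT2]]].
  assert (Pp := wave_phi_incr Hr Hb HD2 W'). assert (Pq := wave_psi_incr Hr Hb W').
  assert (Inc := wave_psi_strict Hr Hb W'). assert (Pf := wave_phi_pos Hr W).
  destruct (wave_continuous W) as [C1 C2]. destruct (wave_continuous W') as [C3 C4].
  destruct W as [J1 J2 B1 B2 _ _ _ _]. destruct W' as [J3 J4 A1 A2 _ _ _ _].
  set (kap := c / 4). set (k := 3 * (c * c) / (32 * b)).
  assert (Hk : 0 < k) by (unfold k; apply Rdiv_lt_0_compat; nra).
  assert (Hkb : k * (2 * b) = c * kap - kap * kap) by (unfold k, kap; field; lra).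
  set (w := fun t => Rmax ((f2 t - f t) * exp (- (kap * t))) (k * (g2 t - g t) * exp (- (kap * t)))).
  assert (Hwle : forall t m, w t <= m -> f2 t - f t <= m * exp (kap * t) /\ k * (g2 t - g t) <= m * exp (kap * t)).
  { intros t m H.
    assert (G1 := Rmax_l ((f2 t - f t) * exp (- (kap * t))) (k * (g2 t - g t) * exp (- (kap * t)))).
    assert (G2 := Rmax_r ((f2 t - f t) * exp (- (kap * t))) (k * (g2 t - g t) * exp (- (kap * t)))).
    fold (w t) in G1, G2. assert (Ei := exp_neg_cancel (kap * t)). pose proof (exp_pos (kap * t)). split.
    - replace (f2 t - f t) with ((f2 t - f t) * exp (- (kap * t)) * exp (kap * t)) by (rewrite Rmult_assoc, Ei; ring).
      apply Rmult_le_compat_r; lra.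
    - replace (k * (g2 t - g t)) with (k * (g2 t - g t) * exp (- (kap * t)) * exp (kap * t)) by (rewrite Rmult_assoc, Ei; ring).
      apply Rmult_le_compat_r; lra. }
  assert (Hlew : forall t m, f2 t - f t <= m * exp (kap * t) -> k * (g2 t - g t) <= m * exp (kap * t) -> w t <= m).
  { intros t m G1 G2. assert (Ei := exp_neg_cancel (kap * t)). pose proof (exp_pos (- (kap * t))).
    assert (Em : m * exp (kap * t) * exp (- (kap * t)) = m).
    { rewrite Rmult_assoc, (Rmult_comm (exp (kap * t))), Ei. ring. }
    apply Rmax_lub; rewrite <- Em; apply Rmult_le_compat_r; lra. }
  assert (Hpos : w x0 <= 0 -> f2 x0 <= f x0 /\ g2 x0 <= g x0).
  { intros H. apply Hwle in H. rewrite Rmult_0_l in H. split; [lra|].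
    apply Rmult_le_reg_l with k; lra. }
  apply Hpos. clear Hpos. apply Rnot_lt_le; intros Hw.
  set (m := w x0 / 2). assert (Hm : 0 < m) by (unfold m; lra).
  (* far to the left the faster wave is small even relatively to the weight *)
  set (A := 1 + 4 * b / (c2 * c2)).
  assert (HA : 1 < A).
  { unfold A. assert (0 < 4 * b / (c2 * c2)); [|lra]. apply Rdiv_lt_0_compat; nra. }
  set (Q := (1 + k) * A * exp (- (c2 / 2 * T))).
  assert (HQ : 0 < Q).
  { unfold Q. pose proof (exp_pos (- (c2 / 2 * T))). repeat apply Rmult_lt_0_compat; lra. }
  destruct (exp_small_left (c2 / 2 - kap) (m / Q)) as [x1 Hx1].
  { unfold kap; lra. } { apply Rdiv_lt_0_compat; lra. }
  set (x := Rmin x1 (Rmin T (N - 1))).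
  assert (Hxx : x <= x1 /\ x <= T /\ x <= N - 1).
  { unfold x. pose proof (Rmin_l x1 (Rmin T (N - 1))). pose proof (Rmin_r x1 (Rmin T (N - 1))).
    pose proof (Rmin_l T (N - 1)). pose proof (Rmin_r T (N - 1)). lra. }
  assert (Hfar : forall t, t <= x -> w t <= m).
  { intros t Ht.
    assert (He : exp ((c2 / 2 - kap) * t) < m / Q) by (apply Hx1; lra).
    set (X := exp (c2 / 2 * (t - T))).
    assert (HX : 0 < X) by apply exp_pos.
    assert (H1 : f2 t <= A * X).
    { assert (exp (c2 * (t - T)) <= X) by (apply exp_le; nra). specialize (HT1 t). nra. }
    assert (H2 : g2 t <= A * X) by (apply HT2; lra).
    assert (Hmax : (1 + k) * (A * X) <= m * exp (kap * t)).
    { assert (EX : X = exp (- (c2 / 2 * T)) * (exp ((c2 / 2 - kap) * t) * exp (kap * t))).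
      { unfold X. rewrite <- !exp_plus. f_equal. ring. }
      replace ((1 + k) * (A * X)) with (Q * exp ((c2 / 2 - kap) * t) * exp (kap * t)) by (rewrite EX; unfold Q; ring).
      apply Rmult_le_compat_r; [left; apply exp_pos|].
      apply Rle_trans with (Q * (m / Q)); [apply Rmult_le_compat_l; lra|right; field; lra]. }
    specialize (B1 t). specialize (B2 t). assert (0 < A * X) by nra.
    apply Hlew; [nra|]. assert (k * (g2 t - g t) <= k * (A * X)) by (apply Rmult_le_compat_l; lra). nra. }
  assert (HwN : w N <= 0).
  { apply Hlew; rewrite Rmult_0_l; [lra|]. nra. }
  assert (Hx0x : x <= x0).
  { apply Rnot_lt_le; intros H. assert (w x0 <= m) by (apply Hfar; lra). unfold m in *; lra. }
  destruct (exists_max_interval w x N x0 m) as [tm [H1 [H2 H3]]];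
    [|lra|unfold m in *; lra|apply Hfar; lra|lra|].
  { intros t _.
    assert (Ce : continuous (fun t => exp (- (kap * t))) t).
    { apply (continuous_ext (fun t => exp (- kap * t))).
      { intros s. f_equal. ring. } eapply derive_continuous, is_derive_exp_lin. }
    apply continuous_Rmax.
    - apply (continuous_mult (fun t => f2 t - f t)); [apply (continuous_minus f2 f); auto|exact Ce].
    - apply (continuous_mult (fun t => k * (g2 t - g t))); [|exact Ce].
      apply (continuous_cmul k (fun t => g2 t - g t)), (continuous_minus g2 g); auto. }
  set (S := w tm) in *. assert (HS : 0 < S) by lra.
  assert (Hall : forall t, t <= N -> f2 t - f t <= S * exp (kap * t) /\ k * (g2 t - g t) <= S * exp (kap * t)).
  { intros t Ht. apply Hwle.
    destruct (Rle_dec t x); [specialize (Hfar t); lra|apply H3; lra]. }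
  assert (Ei := exp_neg_cancel (kap * tm)).
  set (X := S * exp (kap * tm)).
  assert (HX : 0 < X) by (unfold X; pose proof (exp_pos (kap * tm)); nra).
  destruct (Rle_dec ((f2 tm - f tm) * exp (- (kap * tm))) (k * (g2 tm - g tm) * exp (- (kap * tm)))) as [Hc1|Hc1].
  - (* the maximum is attained by the second component *)
    assert (EX : k * (g2 tm - g tm) = X).
    { unfold X, S, w. rewrite Rmax_right by exact Hc1. rewrite Rmult_assoc, Ei. ring. }
    assert (EX' : g2 tm - g tm = X / k) by (rewrite <- EX; field; lra).
    destruct (touching (S / k) tm (jet_lin 1 (-1) (J4 (tm - 1) N) (J2 (tm - 1) N)) (jet_exp kap)) as [P0 S0]; [lra| | |].
    + intros a Ha. destruct (Hall a) as [_ Ha2]; [lra|]. apply Rmult_le_reg_l with k; auto.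
      replace (k * (S / k * exp (kap * a))) with (S * exp (kap * a)) by (field; lra). lra.
    + unfold X in EX'. replace (S / k * exp (kap * tm)) with (S * exp (kap * tm) / k) by (field; lra). lra.
    + replace (S / k * (kap * exp (kap * tm))) with (kap * (X / k)) in P0 by (unfold X; field; lra).
      replace (S / k * (kap * (kap * exp (kap * tm)))) with (kap * kap * (X / k)) in S0 by (unfold X; field; lra).
      unfold rate_psi in S0.
      destruct (Hall tm) as [Hf _]; [lra|]. fold X in Hf.
      assert (HXk : 0 < X / k) by (apply Rdiv_lt_0_compat; lra).
      assert (E1 : (c * kap - kap * kap) * (X / k) = 2 * b * X) by (rewrite <- Hkb; field; lra).
      assert (E2 : (c2 - c) * q2 tm >= 0) by (specialize (Pq tm); nra).
      assert (E3 : c * (q2 tm - q tm) = c * kap * (X / k)) by (replace (q2 tm - q tm) with (kap * (X / k)) by lra; ring).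
      assert (E5 : 2 * X <= f2 tm * (1 - g2 tm) - f tm * (1 - g tm)).
      { apply Rmult_le_reg_l with b; [auto|]. nra. }
      assert (E6 : f2 tm * (1 - g2 tm) - f tm * (1 - g tm) = (f2 tm - f tm) * (1 - g2 tm) - f tm * (X / k)).
      { rewrite <- EX'. ring. }
      specialize (Pf tm). specialize (A2 tm).
      assert (0 < f tm * (X / k)) by (apply Rmult_lt_0_compat; auto).
      assert ((f2 tm - f tm) * (1 - g2 tm) <= X * 1).
      { apply Rle_trans with (X * (1 - g2 tm)); [apply Rmult_le_compat_r; lra|apply Rmult_le_compat_l; lra]. }
      lra.
  - (* the maximum is attained by the first component *)
    assert (EX : f2 tm - f tm = X).
    { unfold X, S, w. rewrite Rmax_left by lra. rewrite Rmult_assoc, Ei. ring. }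
    destruct (touching S tm (jet_lin 1 (-1) (J3 (tm - 1) N) (J1 (tm - 1) N)) (jet_exp kap)) as [P0 S0]; [lra| |fold X; lra|].
    + intros a Ha. destruct (Hall a) as [Ha2 _]; lra.
    + replace (S * (kap * exp (kap * tm))) with (kap * X) in P0 by (unfold X; ring).
      replace (S * (kap * (kap * exp (kap * tm)))) with (kap * kap * X) in S0 by (unfold X; ring).
      unfold rate_phi in S0.
      destruct (Hall (tm - D)) as [_ Hg]; [lra|].
      assert (HgX : k * (g2 (tm - D) - g (tm - D)) <= X).
      { eapply Rle_trans; [exact Hg|]. unfold X. apply Rmult_le_compat_l; [lra|].
        apply exp_le. unfold kap; nra. }
      assert (Hdel : g2 (tm - D2) <= g2 (tm - D)).
      { destruct HDD as [H| ->]; [left; apply Inc; lra|lra]. }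
      destruct (Hsm tm) as [Hs1 _]; [lra|]. destruct (Hsm (tm - D)) as [_ Hs2]; [lra|].
      assert (Hs3 : r * g2 (tm - D) <= (r - 1) / 2).
      { apply (Rmult_le_compat_l r) in Hs2; [|lra].
        replace (r * ((r - 1) / (2 * r))) with ((r - 1) / 2) in Hs2 by (field; lra). exact Hs2. }
      specialize (Pf tm). specialize (A1 tm).
      assert (E1 : c * (p2 tm - p tm) = c * kap * X) by (replace (p2 tm - p tm) with (kap * X) by lra; ring).
      assert (E2 : (c2 - c) * p2 tm >= 0) by (specialize (Pp tm); nra).
      assert (E3 : f2 tm * (r * g2 (tm - D2)) <= f2 tm * (r * g2 (tm - D))).
      { apply Rmult_le_compat_l; [lra|]. apply Rmult_le_compat_l; lra. }
      assert (E4 : f tm * (g2 (tm - D) - g (tm - D)) * k <= small_left r b c * X).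
      { apply Rle_trans with (f tm * X).
        - rewrite Rmult_assoc. apply Rmult_le_compat_l; lra.
        - apply Rmult_le_compat_r; lra. }
      assert (E5 : r * (f tm * (g2 (tm - D) - g (tm - D))) <= (r - 1) / 4 * X).
      { apply Rmult_le_reg_l with k; auto.
        apply Rle_trans with (r * (small_left r b c * X)).
        - replace (k * (r * (f tm * (g2 (tm - D) - g (tm - D))))) with (r * (f tm * (g2 (tm - D) - g (tm - D)) * k)) by ring.
          apply Rmult_le_compat_l; lra.
        - right. unfold small_left. fold k. field. lra. }
      assert (E6 : (f2 tm - f tm) * (1 - r - f tm - f2 tm + r * g2 (tm - D)) <= X * (- ((r - 1) / 2))).
      { rewrite EX. apply Rmult_le_compat_l; lra. }
      assert (E7 : 0 < (c * kap - kap * kap) * X) by (rewrite <- Hkb; apply Rmult_lt_0_compat; nra).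
      nra.
Qed.

(** Near [+ oo] the first component is compared through the ratio [f2 / f],
    for which the decreasing growth rate yields a contact inequality without
    linearisation; the ratio 3r between the two components then contradicts
    each of the two contact inequalities. *)
Lemma ordered_right r b c c2 D D2 f p g q f2 p2 g2 q2 N :
  1 < r -> 0 < b -> 0 <= D -> D <= D2 -> c < c2 ->
  wave r b c D f p g q -> wave r b c2 D2 f2 p2 g2 q2 ->
  (forall t, N <= t -> 1 / 2 <= f t /\ 1 - g2 t <= 1 / (4 * r)) ->
  f2 N <= f N ->
  (forall t, N - D <= t <= N -> g2 t <= g t) ->
  forall t, N <= t -> f2 t <= f t /\ g2 t <= g t.
Proof.
  intros Hr Hb HD HDD Hcc W W' Hsm Nf Ng x0 Hx0.
  assert (HD2 : 0 <= D2) by lra.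
  assert (Pp := wave_phi_incr Hr Hb HD2 W'). assert (Pq := wave_psi_incr Hr Hb W').
  assert (Inc := wave_psi_strict Hr Hb W').
  destruct (wave_continuous W) as [C1 C2]. destruct (wave_continuous W') as [C3 C4].
  assert (Pf := wave_phi_pos Hr W). assert (Pf2 := wave_phi_pos Hr W').
  destruct W as [J1 J2 B1 B2 _ _ R1 R2]. destruct W' as [J3 J4 A1 A2 _ _ _ _].
  set (k := 3 * r). assert (Hk : 0 < k) by (unfold k; lra).
  set (w := fun t => Rmax (f2 t / f t - 1) (k * (g2 t - g t))).
  assert (Hle : forall s t, w t <= s <-> f2 t <= (1 + s) * f t /\ k * (g2 t - g t) <= s).
  { intros s t. specialize (Pf t).
    assert (E : f2 t = (f2 t / f t) * f t) by (field; lra).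
    split.
    - intros H.
      assert (H1 := Rmax_l (f2 t / f t - 1) (k * (g2 t - g t))).
      assert (H2 := Rmax_r (f2 t / f t - 1) (k * (g2 t - g t))).
      fold (w t) in H1, H2. split; [|lra]. rewrite E. apply Rmult_le_compat_r; lra.
    - intros [H1 H2]. apply Rmax_lub; [|exact H2].
      assert (f2 t / f t <= 1 + s); [|lra]. apply Rmult_le_reg_r with (f t); lra. }
  assert (Hpos : w x0 <= 0 -> f2 x0 <= f x0 /\ g2 x0 <= g x0).
  { intros H. apply Hle in H. split; [lra|]. apply Rmult_le_reg_l with k; lra. }
  apply Hpos. clear Hpos. apply Rnot_lt_le; intros Hw.
  set (m := w x0 / 2). assert (Hm : 0 < m) by (unfold m; lra).
  destruct (R1 (m / (1 + m))) as [y1 Hy1]; [apply Rdiv_lt_0_compat; lra|].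
  destruct (R2 (m / k)) as [y2 Hy2]; [apply Rdiv_lt_0_compat; lra|].
  set (y := Rmax (Rmax y1 y2) x0).
  assert (Hy : y1 <= y /\ y2 <= y /\ x0 <= y).
  { unfold y. pose proof (Rmax_l (Rmax y1 y2) x0). pose proof (Rmax_r (Rmax y1 y2) x0).
    pose proof (Rmax_l y1 y2). pose proof (Rmax_r y1 y2). lra. }
  assert (Hfar : forall t, y <= t -> w t <= m).
  { intros t Ht. apply Hle. specialize (A1 t). specialize (A2 t). split.
    - assert (1 - m / (1 + m) < f t) by (apply Hy1; lra).
      assert ((1 + m) * (1 - m / (1 + m)) = 1) by (field; lra). nra.
    - assert (1 - m / k < g t) by (apply Hy2; lra).
      assert (k * (m / k) = m) by (field; lra). nra. }
  destruct (exists_max_interval w N y x0 m) as [tm [H1 [H2 H3]]]; [|lra|unfold m in *; lra| |apply Hfar; lra|].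
  { intros t _. apply continuous_Rmax.
    - apply (continuous_minus (fun t => f2 t / f t) (fun _ => 1)); [|apply continuous_const].
      apply continuous_ratio; auto.
    - apply (continuous_cmul k (fun t => g2 t - g t)), (continuous_minus g2 g); auto. }
  { apply Hle. specialize (Ng N). specialize (Pf N). split; nra. }
  assert (HS : 0 < w tm) by lra. remember (w tm) as S eqn:ES.
  assert (Hall : forall t, N <= t -> f2 t <= (1 + S) * f t /\ k * (g2 t - g t) <= S).
  { intros t Ht. apply Hle.
    destruct (Rle_dec y t); [specialize (Hfar t); lra|apply H3; lra]. }
  destruct (Hsm tm) as [Hf Hg]; [lra|].
  destruct (Rle_dec (f2 tm / f tm - 1) (k * (g2 tm - g tm))) as [Hc1|Hc1].
  - assert (EX : k * (g2 tm - g tm) = S) by (rewrite ES; unfold w; rewrite Rmax_right; auto).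
    assert (EX' : g2 tm - g tm = S / k) by (rewrite <- EX; field; lra).
    destruct (touching (S / k) tm (jet_lin 1 (-1) (J4 N (tm + 1)) (J2 N (tm + 1))) (jet_const 1)) as [P0 S0]; [lra| |lra|].
    + intros a Ha. destruct (Hall a) as [_ Ha2]; [lra|]. apply Rmult_le_reg_l with k; auto.
      replace (k * (S / k * 1)) with S by (field; lra). lra.
    + destruct (Hall tm) as [Hf2 _]; [lra|]. unfold rate_psi in S0.
      assert (E2 : (c2 - c) * q2 tm >= 0) by (specialize (Pq tm); nra).
      assert (Eq : q tm = q2 tm) by lra. rewrite Eq in S0.
      assert (E5 : 0 <= f2 tm * (1 - g2 tm) - f tm * (1 - g tm)) by nra.
      assert (E6 : f2 tm * (1 - g2 tm) - f tm * (1 - g tm) = (f2 tm - f tm) * (1 - g2 tm) - f tm * (S / k)).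
      { rewrite <- EX'. ring. }
      specialize (A2 tm).
      assert (E7 : (f2 tm - f tm) * (1 - g2 tm) <= S * f tm * (1 / (4 * r))).
      { apply Rle_trans with (S * f tm * (1 - g2 tm)); [apply Rmult_le_compat_r; lra|apply Rmult_le_compat_l; nra]. }
      assert (E8 : f tm * (S / k) - S * f tm * (1 / (4 * r)) = S * f tm * (1 / (12 * r))) by (unfold k; field; lra).
      assert (0 < S * f tm * (1 / (12 * r))).
      { apply Rmult_lt_0_compat; [nra|]. apply Rdiv_lt_0_compat; lra. }
      lra.
  - assert (EX : f2 tm = (1 + S) * f tm).
    { rewrite ES; unfold w; rewrite Rmax_left by lra. specialize (Pf tm). field. lra. }
    destruct (touching (1 + S) tm (J3 N (tm + 1)) (J1 N (tm + 1))) as [P0 S0]; [lra| |exact EX|].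
    + intros a Ha. apply Hall; lra.
    + unfold rate_phi in S0.
      assert (HgX : k * (g2 (tm - D) - g (tm - D)) <= S).
      { destruct (Rle_dec N (tm - D)); [apply Hall; auto|]. specialize (Ng (tm - D)). nra. }
      assert (Hdel : g2 (tm - D2) <= g2 (tm - D)).
      { destruct HDD as [H| ->]; [left; apply Inc; lra|lra]. }
      specialize (Pf2 tm).
      assert (E2 : (c2 - c) * p2 tm >= 0) by (specialize (Pp tm); nra).
      assert (E3 : f2 tm * (1 - r - f tm + r * g (tm - D)) <= f2 tm * (1 - r - f2 tm + r * g2 (tm - D2))).
      { rewrite EX at 1. nra. }
      apply Rmult_le_reg_l in E3; auto.
      unfold k in HgX.
      assert (r * g2 (tm - D2) <= r * g2 (tm - D)) by (apply Rmult_le_compat_l; lra).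
      nra.
Qed.

(** Sliding: the translates of the slower wave that dominate the faster one
    form a half-line of shifts bounded below. At the least such shift the
    domination is strict everywhere, as a contact is incompatible with
    [c < c2]; on a compact interval it therefore survives a slightly smaller
    shift, and outside of it by the two preceding lemmas. *)
Lemma wave_speed_unique r b c c2 D D2 f p g q f2 p2 g2 q2 :
  1 < r -> 0 < b -> 0 <= D -> D <= D2 -> c < c2 ->
  wave r b c D f p g q -> wave r b c2 D2 f2 p2 g2 q2 -> False.
Proof.
  intros Hr Hb HD HDD Hcc W W'.
  assert (HD2 : 0 <= D2) by lra.
  assert (Hc := wave_speed_pos Hr Hb W).
  assert (Pp := wave_phi_incr Hr Hb HD2 W'). assert (Pq := wave_psi_incr Hr Hb W').
  assert (Pf2 := wave_phi_pos Hr W').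
  assert (If := wave_phi_strict Hr Hb HD W). assert (Ig := wave_psi_strict Hr Hb W).
  assert (If2 := wave_phi_strict Hr Hb HD2 W'). assert (Ig2 := wave_psi_strict Hr Hb W').
  destruct (wave_continuous W) as [C1 C2]. destruct (wave_continuous W') as [C3 C4].
  assert (Lt1 := wave_psi_lt_1 Hb W').
  pose proof W as [J1 J2 B1 B2 L1 _ R1 R2]. pose proof W' as [J3 J4 A1 A2 M1 M2 S1 S2].
  set (dom := fun tau => forall t, f2 t <= f (t + tau) /\ g2 t <= g (t + tau)).
  assert (Hup : forall s t, dom s -> s < t -> dom t).
  { intros s t Hs Hst u. destruct (Hs u) as [H1 H2].
    assert (f (u + s) < f (u + t)) by (apply If; lra).
    assert (g (u + s) < g (u + t)) by (apply Ig; lra). lra. }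
  assert (HN : exists N1, D <= 2 * N1 /\ 0 <= N1 /\
     (forall t, t <= - N1 -> f2 t <= small_left r b c /\ g2 t <= (r - 1) / (2 * r)) /\
     (forall t, N1 <= t -> 1 - g2 t <= 1 / (4 * r))).
  { destruct (M1 (small_left r b c)) as [x1 Hx1].
    { unfold small_left. repeat apply Rdiv_lt_0_compat; try lra.
      apply Rmult_lt_0_compat; [lra|]. apply Rdiv_lt_0_compat; nra. }
    destruct (M2 ((r - 1) / (2 * r))) as [x2 Hx2]; [apply Rdiv_lt_0_compat; lra|].
    destruct (S2 (1 / (4 * r))) as [y Hy]; [apply Rdiv_lt_0_compat; lra|].
    exists (Rabs x1 + Rabs x2 + Rabs y + D).
    pose proof (Rle_abs (- x1)). pose proof (Rle_abs (- x2)). rewrite !Rabs_Ropp in *.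
    pose proof (Rle_abs y). pose proof (Rabs_pos x1). pose proof (Rabs_pos x2). pose proof (Rabs_pos y).
    repeat split; try lra.
    - left; apply Hx1; lra.
    - left; apply Hx2; lra.
    - intros t Ht. specialize (Hy t). lra. }
  destruct HN as [N1 [HN1 [HN0 [HNl HNr]]]].
  (* ordering on a long enough interval propagates to the whole line *)
  assert (Hext : forall tau N, N1 <= N -> (forall t, N <= t -> 1 / 2 <= f (t + tau)) ->
     (forall t, - N <= t <= N -> f2 t <= f (t + tau) /\ g2 t <= g (t + tau)) -> dom tau).
  { intros tau N HN Hhalf Hmid t.
    assert (Ws := wave_shift tau W).
    destruct (Rle_dec t (- N)) as [H|H]; [|destruct (Rle_dec N t) as [H'|H']].
    - apply (ordered_left r b c c2 D D2 _ _ _ _ f2 p2 g2 q2 (- N) Hr Hb HD HDD Hcc Ws W'); auto.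
      + intros u Hu. apply HNl; lra.
      + apply Hmid; lra.
      + apply Hmid; lra.
    - apply (ordered_right r b c c2 D D2 _ _ _ _ f2 p2 g2 q2 N Hr Hb HD HDD Hcc Ws W'); auto.
      + intros u Hu. split; [apply Hhalf; auto|apply HNr; lra].
      + apply Hmid; lra.
      + intros u Hu. apply Hmid; lra.
    - apply Hmid; lra. }
  assert (Hex : exists tau, dom tau).
  { destruct (R1 (1 / 2)) as [y Hy]; [lra|].
    set (N := N1 + Rabs y). assert (HNy : N1 <= N /\ y <= N).
    { unfold N. pose proof (Rle_abs y). pose proof (Rabs_pos y). lra. }
    destruct (R1 (1 - f2 N)) as [y1 Hy1].
    { specialize (If2 N (N + 1)). specialize (A1 (N + 1)). lra. }
    destruct (R2 (1 - g2 N)) as [y2 Hy2]; [specialize (Lt1 N); lra|].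
    set (tau := N + Rabs y1 + Rabs y2).
    assert (Htau : 0 <= tau /\ y1 <= - N + tau /\ y2 <= - N + tau).
    { unfold tau. pose proof (Rle_abs y1). pose proof (Rle_abs y2).
      pose proof (Rabs_pos y1). pose proof (Rabs_pos y2). lra. }
    exists tau. apply (Hext tau N); [lra| |].
    - intros t Ht. specialize (Hy (t + tau)). lra.
    - intros t Ht. specialize (Hy1 (t + tau)). specialize (Hy2 (t + tau)).
      assert (f2 t <= f2 N) by (destruct (Req_dec t N) as [->|]; [lra|left; apply If2; lra]).
      assert (g2 t <= g2 N) by (destruct (Req_dec t N) as [->|]; [lra|left; apply Ig2; lra]).
      lra. }
  destruct Hex as [hi Hhi].
  destruct (L1 (f2 0) (Pf2 0)) as [lo Hlo].
  destruct (greatest_lower_bound dom lo hi Hhi) as [tau [Hinf1 Hinf2]].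
  { intros t Ht. apply Rnot_lt_le; intros Hlt. destruct (Ht 0) as [H _].
    specialize (Hlo (0 + t)). lra. }
  assert (Hgt : forall t, tau < t -> dom t).
  { intros t Ht. destruct (Hinf2 t Ht) as [s [Hs1 Hs2]]. apply (Hup s); auto. }
  assert (Hdom : dom tau).
  { intros t. split; [apply (le_of_right_limit f)|apply (le_of_right_limit g)]; auto; intros y Hy;
      replace y with (t + (y - t)) by ring; apply Hgt; lra. }
  assert (Hsf : forall t, f2 t < f (t + tau)).
  { intros t. destruct (Hdom t) as [[H|H] _]; [auto|exfalso].
    assert (Hdel : g2 (t - D2) <= g (t + tau - D)).
    { assert (g2 (t - D2) <= g2 (t - D)) by (destruct HDD as [HDl| ->]; [left; apply Ig2; lra|lra]).
      destruct (Hdom (t - D)) as [_ H']. replace (t + tau - D) with (t - D + tau) by ring. lra. }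
    destruct (touching 1 t (J3 (t - 1) (t + 1)) (jet_shift tau (J1 (t - 1 + tau) (t + 1 + tau)))) as [P0 S0]; [lra| |lra|].
    - intros a _. rewrite Rmult_1_l. apply Hdom.
    - unfold rate_phi in S0. rewrite <- H in S0. replace (p (t + tau)) with (p2 t) in S0 by lra.
      specialize (Pf2 t). specialize (Pp t).
      assert (f2 t * (r * g2 (t - D2)) <= f2 t * (r * g (t + tau - D))).
      { apply Rmult_le_compat_l; [lra|]. apply Rmult_le_compat_l; lra. }
      nra. }
  assert (Hsg : forall t, g2 t < g (t + tau)).
  { intros t. destruct (Hdom t) as [_ [H|H]]; [auto|exfalso].
    destruct (touching 1 t (J4 (t - 1) (t + 1)) (jet_shift tau (J2 (t - 1 + tau) (t + 1 + tau)))) as [P0 S0]; [lra| |lra|].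
    - intros a _. rewrite Rmult_1_l. apply Hdom.
    - unfold rate_psi in S0. rewrite <- H in S0. replace (q (t + tau)) with (q2 t) in S0 by lra.
      specialize (Hsf t). specialize (Lt1 t). specialize (Pq t).
      assert (b * (1 - g2 t) * f2 t <= b * (1 - g2 t) * f (t + tau)).
      { apply Rmult_le_compat_l; [apply Rmult_le_pos|]; lra. }
      nra. }
  destruct (R1 (1 / 2)) as [y Hy]; [lra|].
  set (N := N1 + Rabs (y - tau + 1)).
  assert (HNy : N1 <= N /\ y - tau + 1 <= N).
  { unfold N. pose proof (Rle_abs (y - tau + 1)). pose proof (Rabs_pos (y - tau + 1)). lra. }
  destruct (slide_compact f f2 (- N) N tau) as [d1 [Hd1 Hs1]]; auto; [lra|].
  destruct (slide_compact g g2 (- N) N tau) as [d2 [Hd2 Hs2]]; auto; [lra|].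
  set (d := Rmin d1 d2).
  assert (Hd : 0 < d <= 1 /\ d <= d1 /\ d <= d2).
  { unfold d. pose proof (Rmin_l d1 d2). pose proof (Rmin_r d1 d2).
    split; [split; [apply Rmin_glb_lt|]|]; lra. }
  assert (Hnew : dom (tau - d)).
  { apply (Hext (tau - d) N); [lra| |].
    - intros t Ht. specialize (Hy (t + (tau - d))). lra.
    - intros t Ht. replace (t + (tau - d)) with (t + tau - d) by ring.
      split; [apply Hs1|apply Hs2]; lra. }
  apply Hinf1 in Hnew. lra.
Qed.

(** * Limits along an ultrafilter *)

(** A free ultrafilter on the indices gives every bounded sequence of reals a
    limit that is additive, multiplicative and monotone. A bounded sequence of
    functions so converges pointwise at once, without extraction of
    subsequences. *)
Record free_ultrafilter (U : (nat -> Prop) -> Prop) : Prop := {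
  ultra_imp : forall P Q, U P -> (forall n, P n -> Q n) -> U Q;
  ultra_and : forall P Q, U P -> U Q -> U (fun n => P n /\ Q n);
  ultra_proper : ~ U (fun _ => False);
  ultra_or : forall P, U P \/ U (fun n => ~ P n);
  ultra_tail : forall N, U (fun n => (N <= n)%nat) }.

Lemma free_ultrafilter_exists : exists U, free_ultrafilter U.
Proof.
  set (F := fun P : nat -> Prop => exists N, forall n, (N <= n)%nat -> P n).
  assert (HF : filter.ProperFilter F).
  { apply filter.Build_ProperFilter.
    - intros [N HN]. exact (HN N (le_n N)).
    - constructor.
      + exists 0%nat. intros n _. exact I.
      + intros P Q [N HN] [M HM]. exists (N + M)%nat. intros n Hn.
        split; [apply HN|apply HM]; lia.
      + intros P Q HPQ [N HN]. exists N. intros n Hn. apply HPQ. auto. }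
  destruct (filter.ultraFilterLemma HF) as [U [HU HFU]].
  assert (HP := filter.ultra_proper (UltraFilter := HU)).
  assert (HS := filter.filter_filter (ProperFilter := HP)).
  exists U. constructor.
  - intros P Q HPU HPQ. exact (filter.filterS (Filter := HS) HPQ HPU).
  - intros P Q H1 H2. exact (filter.filterI (Filter := HS) H1 H2).
  - exact (filter.filter_not_empty U).
  - intros P. exact (filter.in_ultra_setVsetC P HU).
  - intros N. apply HFU. exists N. auto.
Qed.

Definition ultra : (nat -> Prop) -> Prop :=
  proj1_sig (constructive_indefinite_description _ free_ultrafilter_exists).

Lemma ultra_free : free_ultrafilter ultra.
Proof. unfold ultra. destruct constructive_indefinite_description; auto. Qed.

Lemma ultra_mono (P Q : nat -> Prop) : ultra P -> (forall n, P n -> Q n) -> ultra Q.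
Proof. apply (ultra_imp _ ultra_free). Qed.
Lemma ultra_mono2 (P Q S : nat -> Prop) :
  ultra P -> ultra Q -> (forall n, P n -> Q n -> S n) -> ultra S.
Proof.
  intros HP HQ H. apply (ultra_mono (fun n => P n /\ Q n)).
  - apply (ultra_and _ ultra_free); auto.
  - intros n [H1 H2]; auto.
Qed.
Lemma ultra_ge (N : nat) : ultra (fun n => (N <= n)%nat).
Proof. apply (ultra_tail _ ultra_free). Qed.
Lemma ultra_all (P : nat -> Prop) : (forall n, P n) -> ultra P.
Proof. intros H. apply (ultra_mono _ _ (ultra_ge 0)). auto. Qed.
Lemma ultra_const (P : Prop) : ultra (fun _ => P) -> P.
Proof.
  intros H. apply NNPP; intros HP. apply (ultra_proper _ ultra_free).
  apply (ultra_mono _ _ H). auto.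
Qed.
Lemma ultra_not (P : nat -> Prop) : ~ ultra P -> ultra (fun n => ~ P n).
Proof. intros H. destruct (ultra_or _ ultra_free P); tauto. Qed.

Definition ulim (x : nat -> R) (l : R) : Prop :=
  forall eps, 0 < eps -> ultra (fun n => Rabs (x n - l) < eps).

Lemma ulim_exists (x : nat -> R) (M : R) :
  ultra (fun n => Rabs (x n) <= M) -> exists l, ulim x l.
Proof.
  intros HM.
  destruct (completeness (fun y => ultra (fun n => y <= x n))) as [l [H1 H2]].
  - exists M. intros y Hy. apply ultra_const.
    apply (ultra_mono2 _ _ _ HM Hy). intros n A1 A2. apply Rabs_le_between in A1. lra.
  - exists (- M). apply (ultra_mono _ _ HM). intros n A1. apply Rabs_le_between in A1. lra.
  - exists l. intros eps He.
    assert (Hlo : ultra (fun n => l - eps < x n)).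
    { apply NNPP; intros Hno. assert (l <= l - eps); [|lra].
      apply H2. intros y Hy. apply Rnot_lt_le; intros Hlt. apply Hno.
      apply (ultra_mono _ _ Hy). intros n Hn. lra. }
    assert (Hhi : ultra (fun n => ~ (l + eps <= x n))).
    { apply ultra_not. intros H. apply H1 in H. lra. }
    apply (ultra_mono2 _ _ _ Hlo Hhi). intros n A1 A2. apply Rabs_def1; lra.
Qed.

Definition ultralimit (x : nat -> R) : R := epsilon (inhabits 0) (ulim x).

Lemma ultralimit_spec (x : nat -> R) (M : R) :
  ultra (fun n => Rabs (x n) <= M) -> ulim x (ultralimit x).
Proof. intros H. exact (epsilon_spec (inhabits 0) (ulim x) (ulim_exists x M H)). Qed.

Lemma ultralimit_unit (x : nat -> R) :
  ultra (fun n => 0 <= x n <= 1) -> ulim x (ultralimit x).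
Proof.
  intros H. apply (ultralimit_spec x 1). apply (ultra_mono _ _ H). intros n Hn. apply Rabs_le; lra.
Qed.

Lemma ulim_ext (x y : nat -> R) (l : R) :
  ultra (fun n => x n = y n) -> ulim x l -> ulim y l.
Proof.
  intros He Hx eps Heps. apply (ultra_mono2 _ _ _ He (Hx eps Heps)).
  intros n -> H; auto.
Qed.

Lemma ulim_const (a : R) : ulim (fun _ => a) a.
Proof.
  intros eps He. apply ultra_all. intros _. rewrite Rminus_diag, Rabs_R0. auto.
Qed.

Lemma ulim_le (x y : nat -> R) (a b : R) :
  ulim x a -> ulim y b -> ultra (fun n => x n <= y n) -> a <= b.
Proof.
  intros Hx Hy H. apply Rnot_lt_le; intros Hlt. apply ultra_const.
  assert (He : 0 < (a - b) / 2) by lra.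
  apply (ultra_mono2 _ _ _ (ultra_and _ ultra_free _ _ (Hx _ He) (Hy _ He)) H).
  intros n [A1 A2] A3. apply Rabs_def2 in A1. apply Rabs_def2 in A2. lra.
Qed.

Lemma ulim_unique (x : nat -> R) (a b : R) : ulim x a -> ulim x b -> a = b.
Proof.
  intros Ha Hb. apply Rle_antisym.
  - apply (ulim_le x x); auto. apply ultra_all; intros; lra.
  - apply (ulim_le x x); auto. apply ultra_all; intros; lra.
Qed.

Lemma ulim_bounds (x : nat -> R) (l a b : R) :
  ulim x l -> ultra (fun n => a <= x n <= b) -> a <= l <= b.
Proof.
  intros Hx H. split.
  - apply (ulim_le (fun _ => a) x); [apply ulim_const|auto|]. apply (ultra_mono _ _ H); intros; lra.
  - apply (ulim_le x (fun _ => b)); [auto|apply ulim_const|]. apply (ultra_mono _ _ H); intros; lra.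
Qed.

Lemma ulim_plus (x y : nat -> R) (a b : R) :
  ulim x a -> ulim y b -> ulim (fun n => x n + y n) (a + b).
Proof.
  intros Hx Hy eps He. assert (He2 : 0 < eps / 2) by lra.
  apply (ultra_mono2 _ _ _ (Hx _ He2) (Hy _ He2)).
  intros n A1 A2. apply Rabs_def2 in A1. apply Rabs_def2 in A2. apply Rabs_def1; lra.
Qed.

Lemma ulim_mult (x y : nat -> R) (a b : R) :
  ulim x a -> ulim y b -> ulim (fun n => x n * y n) (a * b).
Proof.
  intros Hx Hy eps He.
  set (K := Rabs a + Rabs b + 1).
  pose proof (Rabs_pos a). pose proof (Rabs_pos b).
  set (d := Rmin 1 (eps / (2 * K))).
  assert (HK : 0 < K) by (unfold K; lra).
  assert (Hd : 0 < d) by (unfold d; apply Rmin_glb_lt; [lra|apply Rdiv_lt_0_compat; lra]).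
  assert (Hd1 : d <= 1) by apply Rmin_l.
  assert (Hd2 : d * K < eps).
  { assert (d <= eps / (2 * K)) by apply Rmin_r.
    assert (eps / (2 * K) * K = eps / 2) by (field; lra). nra. }
  apply (ultra_mono2 _ _ _ (Hx _ Hd) (Hy _ Hd)). intros n A1 A2.
  replace (x n * y n - a * b) with ((x n - a) * (y n - b) + (a * (y n - b) + (x n - a) * b)) by ring.
  eapply Rle_lt_trans; [apply Rabs_triang|].
  eapply Rle_lt_trans; [apply Rplus_le_compat_l, Rabs_triang|].
  rewrite !Rabs_mult.
  assert (Rabs (x n - a) * Rabs (y n - b) <= d * 1).
  { apply Rmult_le_compat; try apply Rabs_pos; lra. }
  assert (Rabs a * Rabs (y n - b) <= Rabs a * d) by (apply Rmult_le_compat_l; lra).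
  assert (Rabs (x n - a) * Rabs b <= d * Rabs b) by (apply Rmult_le_compat_r; lra).
  unfold K in Hd2. lra.
Qed.

Lemma ulim_opp (x : nat -> R) (a : R) : ulim x a -> ulim (fun n => - x n) (- a).
Proof.
  intros Hx eps He. apply (ultra_mono _ _ (Hx eps He)). intros n H.
  replace (- x n - - a) with (- (x n - a)) by ring. rewrite Rabs_Ropp; auto.
Qed.

Lemma ulim_minus (x y : nat -> R) (a b : R) :
  ulim x a -> ulim y b -> ulim (fun n => x n - y n) (a - b).
Proof. intros Hx Hy. apply ulim_plus; [auto|apply ulim_opp; auto]. Qed.

Lemma ulim_scal (x : nat -> R) (a k : R) : ulim x a -> ulim (fun n => k * x n) (k * a).
Proof. intros Hx. apply (ulim_mult (fun _ => k)); [apply ulim_const|auto]. Qed.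

Lemma ulim_abs_le (x y : nat -> R) (a b : R) :
  ulim x a -> ulim y b -> ultra (fun n => Rabs (x n) <= y n) -> Rabs a <= b.
Proof.
  intros Hx Hy H. apply Rabs_le. split.
  - apply (ulim_le (fun n => - y n) x); [apply ulim_opp; auto|auto|].
    apply (ultra_mono _ _ H). intros n A. apply Rabs_le_between in A; lra.
  - apply (ulim_le x y); auto. apply (ultra_mono _ _ H). intros n A. apply Rabs_le_between in A; lra.
Qed.

Lemma ulim_squeeze (x y : nat -> R) (a : R) :
  ulim y 0 -> ultra (fun n => Rabs (x n - a) <= y n) -> ulim x a.
Proof.
  intros Hy H eps He. apply (ultra_mono2 _ _ _ (Hy eps He) H). intros n A1 A2.
  apply Rabs_def2 in A1. lra.
Qed.

Lemma ulim_inv_nat : ulim (fun n => / (INR n + 1)) 0.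
Proof.
  intros eps He. destruct (archimed_cor1 eps He) as [N [HN1 HN2]].
  apply (ultra_mono _ _ (ultra_ge N)). intros n Hn. rewrite Rminus_0_r.
  apply le_INR in Hn. apply lt_INR in HN2. simpl in HN2.
  rewrite Rabs_pos_eq; [|left; apply Rinv_0_lt_compat; lra].
  eapply Rle_lt_trans; [|exact HN1]. apply Rinv_le_contravar; lra.
Qed.

Lemma lipschitz_of_derive (u p : R -> R) (x y M : R) :
  (forall t, x < t < y -> is_derive u t (p t) /\ Rabs (p t) <= M) ->
  forall s t, x < s < y -> x < t < y -> Rabs (u s - u t) <= M * Rabs (s - t).
Proof.
  intros H.
  assert (G : forall s t, x < s < y -> x < t < y -> s < t -> Rabs (u s - u t) <= M * Rabs (s - t)).
  { intros s t Hs Ht Hst.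
    destruct (mean_value u p s t Hst) as [z [Hz E]].
    - intros a Ha; apply H; lra.
    - intros a Ha. eapply derive_continuous. apply H; lra.
    - rewrite Rabs_minus_sym, E, Rabs_mult, (Rabs_minus_sym s t).
      apply Rmult_le_compat_r; [apply Rabs_pos|apply H; lra]. }
  intros s t Hs Ht. destruct (Rtotal_order s t) as [Hst|[->|Hst]].
  - auto.
  - rewrite !Rminus_diag, Rabs_R0. lra.
  - rewrite Rabs_minus_sym, (Rabs_minus_sym s t). auto.
Qed.

Lemma taylor_of_lipschitz (u p : R -> R) (x y K : R) :
  0 <= K ->
  (forall t, x < t < y -> is_derive u t (p t)) ->
  (forall s t, x < s < y -> x < t < y -> Rabs (p s - p t) <= K * Rabs (s - t)) ->
  forall s t, x < s < y -> x < t < y ->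
    Rabs (u s - u t - p t * (s - t)) <= K * Rabs (s - t) * Rabs (s - t).
Proof.
  intros HK Hd Hp s t Hs Ht.
  assert (G : exists z, x < z < y /\ Rabs (z - t) <= Rabs (s - t) /\ u s - u t = p z * (s - t)).
  { destruct (Rtotal_order s t) as [Hst|[->|Hst]].
    - destruct (mean_value u p s t Hst) as [z [Hz E]].
      + intros a Ha; apply Hd; lra.
      + intros a Ha. eapply derive_continuous. apply Hd; lra.
      + exists z. split; [lra|]. split; [|lra].
        rewrite !Rabs_left1; lra.
    - exists t. split; [lra|]. split; [lra|ring].
    - destruct (mean_value u p t s Hst) as [z [Hz E]].
      + intros a Ha; apply Hd; lra.
      + intros a Ha. eapply derive_continuous. apply Hd; lra.
      + exists z. split; [lra|]. split; [|lra].
        rewrite !Rabs_pos_eq; lra. }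
  destruct G as [z [Hz [Hzt E]]]. rewrite E.
  replace (p z * (s - t) - p t * (s - t)) with ((p z - p t) * (s - t)) by ring.
  rewrite Rabs_mult. apply Rmult_le_compat_r; [apply Rabs_pos|].
  eapply Rle_trans; [apply Hp; auto|]. apply Rmult_le_compat_l; auto.
Qed.

(** Quadratic remainder bounds are stable under pointwise limits; this is how
    derivatives pass to ultralimits. *)
Lemma derive_of_taylor (u : R -> R) (x y t l K : R) :
  x < t < y -> 0 <= K ->
  (forall s, x < s < y -> Rabs (u s - u t - l * (s - t)) <= K * Rabs (s - t) * Rabs (s - t)) ->
  is_derive u t l.
Proof.
  intros Ht HK H. apply is_derive_Reals. intros eps He.
  set (d := Rmin (Rmin (t - x) (y - t)) (eps / (K + 1))).
  assert (Hd : 0 < d).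
  { unfold d. repeat apply Rmin_glb_lt; try lra. apply Rdiv_lt_0_compat; lra. }
  assert (Hd1 : d <= t - x) by (unfold d; eapply Rle_trans; [apply Rmin_l|apply Rmin_l]).
  assert (Hd2 : d <= y - t) by (unfold d; eapply Rle_trans; [apply Rmin_l|apply Rmin_r]).
  assert (Hd3 : d <= eps / (K + 1)) by (unfold d; apply Rmin_r).
  exists (mkposreal d Hd). intros h Hh0 Hh. simpl in Hh.
  assert (Hs : x < t + h < y) by (apply Rabs_def2 in Hh; lra).
  specialize (H (t + h) Hs). replace (t + h - t) with h in H by ring.
  replace ((u (t + h) - u t) / h - l) with ((u (t + h) - u t - l * h) * / h) by (field; auto).
  rewrite Rabs_mult, Rabs_inv.
  assert (Hpos : 0 < Rabs h) by (apply Rabs_pos_lt; auto).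
  apply Rle_lt_trans with (K * Rabs h).
  - apply Rmult_le_reg_r with (Rabs h); auto. rewrite Rmult_assoc, Rinv_l; lra.
  - assert (Rabs h < eps / (K + 1)) by lra.
    assert (eps / (K + 1) * (K + 1) = eps) by (field; lra). nra.
Qed.

Lemma ultralimit_jet (x y : R) (u p F : nat -> R -> R) (c : nat -> R)
    (u' p' F' : R -> R) (c' C M B L : R) :
  0 <= C -> 0 <= M -> 0 <= B -> 0 <= L ->
  ultra (fun n => Rabs (c n) <= C /\ jet x y (u n) (p n) (fun t => c n * p n t - F n t) /\
    (forall t, x < t < y -> Rabs (p n t) <= M /\ Rabs (F n t) <= B) /\
    (forall s t, Rabs (F n s - F n t) <= L * Rabs (s - t))) ->
  (forall t, x < t < y -> ulim (fun n => u n t) (u' t) /\ ulim (fun n => p n t) (p' t) /\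
     ulim (fun n => F n t) (F' t)) ->
  ulim c c' ->
  jet x y u' p' (fun t => c' * p' t - F' t).
Proof.
  intros HC HM HB HL Hn Hl Hcl t Ht.
  set (K1 := C * M + B). set (K2 := C * K1 + L).
  assert (HK1 : 0 <= K1) by (unfold K1; nra).
  assert (HK2 : 0 <= K2) by (unfold K2; nra).
  assert (T1 : ultra (fun n => forall s, x < s < y ->
     Rabs (u n s - u n t - p n t * (s - t)) <= K1 * Rabs (s - t) * Rabs (s - t) /\
     Rabs (p n s - p n t - (c n * p n t - F n t) * (s - t)) <= K2 * Rabs (s - t) * Rabs (s - t))).
  { apply (ultra_mono _ _ Hn). intros n [Hc [J [HMB HF]]] s Hs.
    assert (Lp : forall s t, x < s < y -> x < t < y -> Rabs (p n s - p n t) <= K1 * Rabs (s - t)).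
    { apply (lipschitz_of_derive (p n) (fun t => c n * p n t - F n t)).
      intros a Ha. destruct (J a Ha) as [_ D2]. destruct (HMB a Ha) as [D3 D4]. split; [exact D2|].
      unfold Rminus. eapply Rle_trans; [apply Rabs_triang|]. rewrite Rabs_Ropp, Rabs_mult.
      unfold K1. apply Rplus_le_compat; [|auto].
      apply Rmult_le_compat; auto; apply Rabs_pos. }
    split.
    - apply (taylor_of_lipschitz (u n) (p n) x y K1); auto. intros a Ha; destruct (J a Ha); auto.
    - apply (taylor_of_lipschitz (p n) (fun t => c n * p n t - F n t) x y K2); auto.
      + intros a Ha; destruct (J a Ha); auto.
      + intros a e Ha He.
        replace (c n * p n a - F n a - (c n * p n e - F n e))
          with (c n * (p n a - p n e) + - (F n a - F n e)) by ring.
        eapply Rle_trans; [apply Rabs_triang|]. rewrite Rabs_Ropp, Rabs_mult.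
        specialize (Lp a e Ha He). specialize (HF a e).
        assert (Rabs (c n) * Rabs (p n a - p n e) <= C * (K1 * Rabs (a - e))).
        { apply Rmult_le_compat; auto; apply Rabs_pos. }
        unfold K2. lra. }
  destruct (Hl t Ht) as [U1 [U2 U3]].
  assert (Hst : forall s, ulim (fun _ => s - t) (s - t)) by (intros; apply ulim_const).
  split.
  - apply (derive_of_taylor u' x y t (p' t) K1 Ht HK1). intros s Hs.
    destruct (Hl s Hs) as [V1 _].
    apply (ulim_abs_le (fun n => u n s - u n t - p n t * (s - t)) (fun _ => K1 * Rabs (s - t) * Rabs (s - t))).
    + repeat apply ulim_minus; auto. apply (ulim_mult _ (fun _ => s - t)); auto.
    + apply ulim_const.
    + apply (ultra_mono _ _ T1). intros n H. apply H; auto.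
  - apply (derive_of_taylor p' x y t _ K2 Ht HK2). intros s Hs.
    destruct (Hl s Hs) as [_ [V2 _]].
    apply (ulim_abs_le (fun n => p n s - p n t - (c n * p n t - F n t) * (s - t))
       (fun _ => K2 * Rabs (s - t) * Rabs (s - t))).
    + apply ulim_minus; [apply ulim_minus; auto|].
      apply (ulim_mult _ (fun _ => s - t)); [|auto].
      apply ulim_minus; [apply ulim_mult; auto|auto].
    + apply ulim_const.
    + apply (ultra_mono _ _ T1). intros n H. apply H; auto.
Qed.

(** Interpolation: [u] has slope at most 1 somewhere on an interval of length
    1, and [p - c u] varies by at most [C] on it. The bound does not depend on
    the interval. *)
Lemma derivative_bound (c C x y : R) (u p F : R -> R) :
  0 <= c -> 1 <= y - x -> (forall t, continuous u t) -> (forall t, 0 <= u t <= 1) ->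
  jet x y u p (fun t => c * p t - F t) -> (forall t, x < t < y -> Rabs (F t) <= C) ->
  forall t, x < t < y -> Rabs (p t) <= 1 + c + C.
Proof.
  intros Hc Hxy Hcont Hu J HF t Ht.
  (* a subinterval of length 1 containing [t] *)
  set (a := Rmax x (Rmin t (y - 1))).
  assert (Ha : x <= a /\ a + 1 <= y /\ a <= t <= a + 1).
  { unfold a, Rmax, Rmin. destruct (Rle_dec t (y - 1)); destruct (Rle_dec x _); lra. }
  destruct (mean_value u p a (a + 1)) as [z [Hz E]]; [lra| |auto|].
  - intros s Hs. destruct (J s); [lra|auto].
  - assert (Hpz : Rabs (p z) <= 1).
    { pose proof (Hu a). pose proof (Hu (a + 1)). apply Rabs_le. lra. }
    assert (L : Rabs ((1 * p t + - c * u t) - (1 * p z + - c * u z)) <= C * Rabs (t - z)).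
    { apply (lipschitz_of_derive (fun t => 1 * p t + - c * u t)
               (fun t => 1 * (c * p t - F t) + - c * p t) x y); try lra.
      intros s Hs. destruct (J s Hs) as [D1 D2]. split; [apply is_derive_lin; auto|].
      replace (1 * (c * p s - F s) + - c * p s) with (- F s) by ring. rewrite Rabs_Ropp; auto. }
    assert (Rabs (t - z) <= 1) by (apply Rabs_le; lra).
    assert (0 <= C) by (specialize (HF t Ht); pose proof (Rabs_pos (F t)); lra).
    pose proof (Hu t). pose proof (Hu z).
    apply Rabs_le_between in L. apply Rabs_le_between in Hpz.
    assert (C * Rabs (t - z) <= C * 1) by (apply Rmult_le_compat_l; auto).
    apply Rabs_le. nra.
Qed.

Lemma ulim_monotone_shift (x : nat -> R) (l : R) :
  (forall n, x n <= x (S n)) -> ulim x l -> ulim (fun n => x (S n)) l.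
Proof.
  intros Hm Hl.
  assert (Hmn : forall n k, x n <= x (n + k)%nat).
  { intros n k. induction k; [rewrite Nat.add_0_r; lra|]. rewrite Nat.add_succ_r. specialize (Hm (n + k)%nat). lra. }
  assert (Hup : forall n, x n <= l).
  { intros n. apply (ulim_le (fun _ => x n) x); [apply ulim_const|auto|].
    apply (ultra_mono _ _ (ultra_ge n)). intros m Hnm. replace m with (n + (m - n))%nat by lia. auto. }
  intros eps He.
  apply (ultra_mono _ _ (Hl eps He)). intros n H.
  pose proof (Hup (S n)). specialize (Hm n). apply Rabs_def2 in H. apply Rabs_def1; lra.
Qed.

Lemma lip_continuous (M : R) (u : R -> R) :
  0 <= M -> (forall s t, Rabs (u s - u t) <= M * Rabs (s - t)) -> forall t, continuous u t.
Proof.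
  intros HM Hu t. apply continuity_pt_filterlim. intros eps He.
  exists (eps / (M + 1)). split; [apply Rdiv_lt_0_compat; lra|].
  intros s [_ Hs]. simpl in *. unfold R_dist in *.
  eapply Rle_lt_trans; [apply Hu|].
  assert (eps / (M + 1) * (M + 1) = eps) by (field; lra).
  pose proof (Rabs_pos (s - t)). nra.
Qed.

(** * The problem truncated to [(- a, a)]: existence *)

Definition clamp (a t : R) : R := Rmax (- a) (Rmin a t).

Lemma clamp_inside a t : - a <= t <= a -> clamp a t = t.
Proof. intros H. unfold clamp. rewrite Rmin_right, Rmax_right; lra. Qed.
Lemma clamp_left a t : 0 <= a -> t <= - a -> clamp a t = - a.
Proof. intros Ha H. unfold clamp. rewrite Rmin_right, Rmax_left; lra. Qed.
Lemma clamp_right a t : 0 <= a -> a <= t -> clamp a t = a.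
Proof. intros Ha H. unfold clamp. rewrite Rmin_left, Rmax_right; lra. Qed.
Lemma clamp_range a t : 0 <= a -> - a <= clamp a t <= a.
Proof. intros Ha. unfold clamp, Rmax, Rmin. destruct (Rle_dec a t); destruct (Rle_dec (- a) _); lra. Qed.
Lemma clamp_contract a s t : 0 <= a -> s <= t -> 0 <= clamp a t - clamp a s <= t - s.
Proof.
  intros Ha H. unfold clamp, Rmax, Rmin.
  destruct (Rle_dec a t); destruct (Rle_dec a s); repeat destruct (Rle_dec (- a) _); lra.
Qed.
Lemma clamp_continuous a t : 0 <= a -> continuous (clamp a) t.
Proof.
  intros Ha. apply continuity_pt_filterlim. intros eps He. exists eps. split; [lra|].
  intros s [_ Hs]. simpl in *. unfold R_dist in *.
  destruct (Rle_dec s t) as [H|H].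
  - pose proof (clamp_contract a s t Ha H). apply Rabs_def2 in Hs. apply Rabs_def1; lra.
  - pose proof (clamp_contract a t s Ha ltac:(lra)). apply Rabs_def2 in Hs. apply Rabs_def1; lra.
Qed.

(** [u'' - c u' - K u = - f] on [(- a, a)], continued by its boundary values. *)
Record bvp_solution (c K a : R) (f u p : R -> R) : Prop := {
  bvp_cont : forall t, continuous u t;
  bvp_left : forall t, t <= - a -> u t = 0;
  bvp_right : forall t, a <= t -> u t = 1;
  bvp_jet : jet (- a) a u p (fun t => c * p t - (f t - K * u t)) }.

(** Variation of constants over the two roots [al < be] of [z^2 - c z - K]. *)
Lemma bvp_exists (c K a : R) (f : R -> R) :
  0 < K -> 0 < a -> (forall t, continuous f t) -> exists u p, bvp_solution c K a f u p.
Proof.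
  intros HK Ha Hf.
  set (q := sqrt (c * c + 4 * K)).
  assert (Hq : q * q = c * c + 4 * K) by (apply sqrt_sqrt; nra).
  assert (Hq0 : 0 < q) by (apply sqrt_lt_R0; nra).
  set (al := (c - q) / 2). set (be := (c + q) / 2).
  assert (Hal : al * al = c * al + K) by (unfold al; nra).
  assert (Hbe : be * be = c * be + K) by (unfold be; nra).
  set (I := fun g t => RInt (fun s => exp (- g * s) * f s) (- a) t).
  assert (HI : forall g t, is_derive (I g) t (exp (- g * t) * f t)).
  { intros g t.
    assert (Hc : forall s, continuous (fun s => exp (- g * s) * f s) s).
    { intros s. apply (continuous_mult (fun s => exp (- g * s)) f); [|auto].
      eapply derive_continuous, is_derive_exp_lin. }
    apply (is_derive_RInt (fun s => exp (- g * s) * f s) (I g) (- a) t); [|apply Hc].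
    apply filter_forall. intros s. apply (RInt_correct (fun s => exp (- g * s) * f s)).
    apply (ex_RInt_continuous (fun s => exp (- g * s) * f s)). intros; apply Hc. }
  (* [G g k1 k2] solves the first-order equation [G' = g G + k1 f] *)
  set (G := fun g k1 k2 t => (k1 * I g t + k2 * 1) * exp (g * t)).
  assert (HG : forall g k1 k2 t, is_derive (G g k1 k2) t (g * G g k1 k2 t + k1 * f t)).
  { intros g k1 k2 t. evar_last.
    - apply (is_derive_mul_exp (fun t => k1 * I g t + k2 * 1)).
      apply (is_derive_lin (I g) (fun _ => 1)); [apply HI|apply @is_derive_const].
    - unfold zero; simpl. unfold G.
      assert (E : exp (- g * t) * exp (g * t) = 1).
      { rewrite <- exp_plus. replace (- g * t + g * t) with 0 by ring. apply exp_0. }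
      replace (k1 * f t) with (k1 * f t * (exp (- g * t) * exp (g * t))) by (rewrite E; ring). ring. }
  assert (HGa : forall g k1 k2, G g k1 k2 (- a) = k2 * exp (g * (- a))).
  { intros g k1 k2. unfold G, I. rewrite (RInt_point (- a)). unfold zero; simpl. ring. }
  set (u0 := fun A t => G be (- / q) (A * exp (be * a)) t + G al (/ q) (- A * exp (al * a)) t).
  set (p0 := fun A t => be * G be (- / q) (A * exp (be * a)) t + al * G al (/ q) (- A * exp (al * a)) t).
  assert (Hu0 : forall A t, is_derive (u0 A) t (p0 A t)).
  { intros A t. unfold u0, p0. evar_last.
    - apply (is_derive_plus (G be (- / q) (A * exp (be * a))) (G al (/ q) (- A * exp (al * a)))); apply HG.
    - unfold plus; simpl. ring. }
  assert (Hp0 : forall A t, is_derive (p0 A) t (c * p0 A t - (f t - K * u0 A t))).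
  { intros A t. unfold p0 at 1. evar_last.
    - apply (is_derive_lin (G be (- / q) (A * exp (be * a))) (G al (/ q) (- A * exp (al * a)))); apply HG.
    - unfold p0, u0.
      set (x := G be (- / q) (A * exp (be * a)) t). set (z := G al (/ q) (- A * exp (al * a)) t).
      replace (be * (be * x + - / q * f t)) with (be * be * x - be * / q * f t) by ring.
      replace (al * (al * z + / q * f t)) with (al * al * z + al * / q * f t) by ring.
      rewrite Hal, Hbe. unfold be, al. field. lra. }
  assert (HAex : exists A, u0 A a = 1).
  { set (d := exp (be * a) * exp (be * a) - exp (al * a) * exp (al * a)).
    assert (Hd : 0 < d).
    { unfold d. assert (exp (al * a) < exp (be * a)).
      { apply exp_increasing. apply Rmult_lt_compat_r; unfold al, be; lra. }
      pose proof (exp_pos (al * a)). nra. }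
    set (y := - / q * I be a * exp (be * a) + / q * I al a * exp (al * a)).
    exists ((1 - y) / d).
    assert (E : u0 ((1 - y) / d) a = y + (1 - y) / d * d).
    { unfold u0, G, y, d. ring. }
    rewrite E. field. lra. }
  destruct HAex as [A HA].
  assert (Hl : u0 A (- a) = 0).
  { unfold u0. rewrite !HGa. rewrite !Rmult_assoc, <- !exp_plus.
    replace (be * a + be * - a) with 0 by ring. replace (al * a + al * - a) with 0 by ring.
    rewrite exp_0. ring. }
  exists (fun t => u0 A (clamp a t)), (p0 A).
  constructor.
  - intros t. apply (continuous_comp (clamp a) (u0 A)); [apply clamp_continuous; lra|].
    eapply derive_continuous. apply Hu0.
  - intros t Ht. rewrite clamp_left by lra. exact Hl.
  - intros t Ht. rewrite clamp_right by lra. exact HA.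
  - intros t Ht. rewrite clamp_inside by lra. split; [|apply Hp0].
    apply (is_derive_ext_open (u0 A) _ (- a) a); [auto| |apply Hu0].
    intros s Hs. rewrite clamp_inside; auto; lra.
Qed.

Lemma bvp_le (c K a : R) (f1 f2 u1 u2 p1 p2 : R -> R) :
  0 < K -> bvp_solution c K a f1 u1 p1 -> bvp_solution c K a f2 u2 p2 ->
  (forall t, f1 t <= f2 t) -> forall t, u1 t <= u2 t.
Proof.
  intros HK [C1 L1 R1 J1] [C2 L2 R2 J2] Hf t.
  destruct (Rle_dec t (- a)); [rewrite L1, L2; lra|].
  destruct (Rle_dec a t); [rewrite R1, R2; lra|].
  assert (H : 1 * u1 t + -1 * u2 t <= 0); [|lra].
  apply (max_principle 0 (jet_lin 1 (-1) J1 J2)); try lra.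
  - intros s _. apply continuous_lin; auto.
  - rewrite L1, L2; lra.
  - rewrite R1, R2; lra.
  - intros s Hs Hpos Hp. specialize (Hf s). assert (p1 s = p2 s) as -> by lra. nra.
Qed.

Lemma bvp_range (c K a : R) (f u p : R -> R) :
  0 < K -> bvp_solution c K a f u p ->
  (forall t, 0 <= f t <= K) -> forall t, 0 <= u t <= 1.
Proof.
  intros HK [C1 L1 R1 J1] Hf t.
  destruct (Rle_dec t (- a)); [rewrite L1; lra|].
  destruct (Rle_dec a t); [rewrite R1; lra|].
  split.
  - assert (H : -1 * u t + 0 * 1 <= 0); [|lra].
    apply (max_principle 0 (jet_lin (-1) 0 J1 (jet_const 1))); try lra.
    + intros s _. apply (continuous_lin u (fun _ => 1)); auto. apply continuous_const.
    + rewrite L1; lra.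
    + rewrite R1; lra.
    + intros s Hs Hpos Hp. specialize (Hf s). replace (p s) with 0 by lra. nra.
  - apply (max_principle 1 J1); try lra.
    + intros s _. auto.
    + rewrite L1; lra.
    + rewrite R1; lra.
    + intros s Hs Hpos Hp. specialize (Hf s). rewrite Hp. nra.
Qed.

Lemma clamped_lipschitz (c C a : R) (u p F : R -> R) :
  0 <= c -> 1 <= a ->
  (forall t, continuous u t) -> (forall t, 0 <= u t <= 1) ->
  (forall t, t <= - a -> u t = 0) -> (forall t, a <= t -> u t = 1) ->
  jet (- a) a u p (fun t => c * p t - F t) -> (forall t, - a < t < a -> Rabs (F t) <= C) ->
  (forall t, - a < t < a -> Rabs (p t) <= 1 + c + C) /\
  (forall s t, Rabs (u s - u t) <= (1 + c + C) * Rabs (s - t)).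
Proof.
  intros Hc Ha Hcont Hb Hl Hr J HF.
  assert (Hp : forall t, - a < t < a -> Rabs (p t) <= 1 + c + C).
  { apply (derivative_bound c C (- a) a u p F); auto; lra. }
  split; [exact Hp|].
  assert (HM : 0 <= 1 + c + C) by (specialize (Hp 0 ltac:(lra)); pose proof (Rabs_pos (p 0)); lra).
  assert (Hcl : forall t, u t = u (clamp a t)).
  { intros t. destruct (Rle_dec t (- a)); [rewrite clamp_left, !Hl; lra|].
    destruct (Rle_dec a t); [rewrite clamp_right, !Hr; lra|]. rewrite clamp_inside; lra. }
  assert (G : forall s t, s <= t -> Rabs (u s - u t) <= (1 + c + C) * (t - s)).
  { intros s t Hst. rewrite (Hcl s), (Hcl t).
    pose proof (clamp_contract a s t ltac:(lra) Hst).
    pose proof (clamp_range a s ltac:(lra)). pose proof (clamp_range a t ltac:(lra)).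
    apply Rle_trans with ((1 + c + C) * (clamp a t - clamp a s)); [|apply Rmult_le_compat_l; lra].
    destruct (Rle_lt_or_eq_dec (clamp a s) (clamp a t)) as [Hlt| ->]; [lra| |rewrite !Rminus_diag, Rabs_R0; lra].
    destruct (mean_value u p _ _ Hlt) as [z [Hz E]]; [|auto|].
    - intros z Hz. destruct (J z); [lra|auto].
    - rewrite Rabs_minus_sym, E, Rabs_mult, (Rabs_pos_eq (clamp a t - clamp a s)) by lra.
      apply Rmult_le_compat_r; [lra|apply Hp; lra]. }
  intros s t. destruct (Rle_dec s t) as [H|H].
  - rewrite (Rabs_minus_sym s t), (Rabs_pos_eq (t - s)) by lra. auto.
  - rewrite (Rabs_pos_eq (s - t)) by lra. rewrite Rabs_minus_sym. apply G; lra.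
Qed.

Lemma bvp_lipschitz (c K a : R) (f u p : R -> R) :
  0 <= c -> 0 < K -> 1 <= a -> bvp_solution c K a f u p -> (forall t, 0 <= f t <= K) ->
  (forall t, - a < t < a -> Rabs (p t) <= 1 + c + K) /\
  (forall s t, Rabs (u s - u t) <= (1 + c + K) * Rabs (s - t)).
Proof.
  intros Hc HK Ha S Hf. assert (Hu := bvp_range c K a f u p HK S Hf). destruct S as [C1 L1 R1 J1].
  apply (clamped_lipschitz c K a u p (fun t => f t - K * u t)); auto.
  intros t _. specialize (Hf t). specialize (Hu t). apply Rabs_le. nra.
Qed.

Lemma bvp_limit (c K a L : R) (f u p : nat -> R -> R) (f' u' : R -> R) :
  0 <= c -> 0 < K -> 1 <= a -> 0 <= L ->
  (forall n, bvp_solution c K a (f n) (u n) (p n)) ->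
  (forall n t, 0 <= f n t <= K) ->
  (forall n s t, Rabs (f n s - f n t) <= L * Rabs (s - t)) ->
  (forall t, ulim (fun n => f n t) (f' t)) -> (forall t, ulim (fun n => u n t) (u' t)) ->
  exists p', bvp_solution c K a f' u' p'.
Proof.
  intros Hc HK Ha HL S Hf Hlip Lf Lu.
  set (M := 1 + c + K). assert (HM : 0 <= M) by (unfold M; lra).
  assert (Hb := fun n => bvp_lipschitz c K a (f n) (u n) (p n) Hc HK Ha (S n) (Hf n)).
  assert (Hu := fun n => bvp_range c K a (f n) (u n) (p n) HK (S n) (Hf n)).
  exists (fun t => ultralimit (fun n => p n t)). constructor.
  - apply (lip_continuous M); [auto|]. intros s t.
    apply (ulim_abs_le (fun n => u n s - u n t) (fun _ => M * Rabs (s - t))).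
    + apply ulim_minus; auto.
    + apply ulim_const.
    + apply ultra_all. intros n. apply Hb.
  - intros t Ht. apply (ulim_unique (fun n => u n t)); auto. apply (ulim_ext (fun _ => 0)); [|apply ulim_const].
    apply ultra_all. intros n. symmetry. apply (bvp_left _ _ _ _ _ _ (S n)); auto.
  - intros t Ht. apply (ulim_unique (fun n => u n t)); auto. apply (ulim_ext (fun _ => 1)); [|apply ulim_const].
    apply ultra_all. intros n. symmetry. apply (bvp_right _ _ _ _ _ _ (S n)); auto.
  - apply (ultralimit_jet (- a) a u p (fun n t => f n t - K * u n t) (fun _ => c)
      u' (fun t => ultralimit (fun n => p n t)) (fun t => f' t - K * u' t) c c M K (L + K * M)); auto; try nra.
    + apply ultra_all. intros n. split; [rewrite Rabs_pos_eq; lra|]. split; [apply (bvp_jet _ _ _ _ _ _ (S n))|].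
      destruct (Hb n) as [Hb1 Hb2]. split.
      * intros t Ht. split; [apply Hb1; auto|]. specialize (Hf n t). specialize (Hu n t). apply Rabs_le. nra.
      * intros s t. replace (f n s - K * u n s - (f n t - K * u n t))
          with ((f n s - f n t) + - (K * (u n s - u n t))) by ring.
        eapply Rle_trans; [apply Rabs_triang|]. rewrite Rabs_Ropp, Rabs_mult, (Rabs_pos_eq K) by lra.
        specialize (Hlip n s t). specialize (Hb2 s t). fold M in Hb2. nra.
    + intros t Ht. split; [auto|]. split; [|apply ulim_minus; [auto|apply ulim_scal; auto]].
      apply (ultralimit_spec _ M). apply ultra_all. intros n. apply Hb; auto.
    + apply ulim_const.
Qed.

Lemma react_phi_bound (r x z : R) :
  1 < r -> 0 <= x <= 1 -> 0 <= z <= 1 -> Rabs (x * (1 - r - x + r * z)) <= r.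
Proof. intros Hr Hx Hz. apply Rabs_le. assert (0 <= r * z <= r) by nra. split; nra. Qed.

Lemma react_psi_bound (b x z : R) :
  0 < b -> 0 <= x <= 1 -> 0 <= z <= 1 -> Rabs (b * x * (1 - z)) <= b.
Proof.
  intros Hb Hx Hz. assert (0 <= x * (1 - z) <= 1) by nra.
  replace (b * x * (1 - z)) with (b * (x * (1 - z))) by ring. apply Rabs_le. split; nra.
Qed.

Lemma react_phi_lip (r x1 x2 z1 z2 d : R) :
  1 < r -> 0 <= x1 <= 1 -> 0 <= x2 <= 1 -> 0 <= z1 <= 1 -> 0 <= z2 <= 1 ->
  Rabs (x1 - x2) <= d -> Rabs (z1 - z2) <= d ->
  Rabs (x1 * (1 - r - x1 + r * z1) - x2 * (1 - r - x2 + r * z2)) <= (2 * r + 1) * d.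
Proof.
  intros Hr Hx1 Hx2 Hz1 Hz2 Hx Hz.
  replace (x1 * (1 - r - x1 + r * z1) - x2 * (1 - r - x2 + r * z2))
    with ((x1 - x2) * (1 - r - x1 - x2 + r * z1) + r * x2 * (z1 - z2)) by ring.
  eapply Rle_trans; [apply Rabs_triang|]. rewrite !Rabs_mult.
  assert (A1 : Rabs (1 - r - x1 - x2 + r * z1) <= r + 1) by (apply Rabs_le; nra).
  assert (A2 : Rabs r * Rabs x2 <= r) by (rewrite !Rabs_pos_eq by lra; nra).
  assert (B1 : Rabs (x1 - x2) * Rabs (1 - r - x1 - x2 + r * z1) <= d * (r + 1)).
  { apply Rmult_le_compat; auto; apply Rabs_pos. }
  assert (B2 : Rabs r * Rabs x2 * Rabs (z1 - z2) <= r * d).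
  { apply Rmult_le_compat; auto; [|apply Rabs_pos]. apply Rmult_le_pos; apply Rabs_pos. }
  lra.
Qed.

Lemma react_psi_lip (b x1 x2 z1 z2 d : R) :
  0 < b -> 0 <= x1 <= 1 -> 0 <= x2 <= 1 -> 0 <= z1 <= 1 -> 0 <= z2 <= 1 ->
  Rabs (x1 - x2) <= d -> Rabs (z1 - z2) <= d ->
  Rabs (b * x1 * (1 - z1) - b * x2 * (1 - z2)) <= 2 * b * d.
Proof.
  intros Hb Hx1 Hx2 Hz1 Hz2 Hx Hz.
  replace (b * x1 * (1 - z1) - b * x2 * (1 - z2))
    with (b * ((x1 - x2) * (1 - z1) + - (x2 * (z1 - z2)))) by ring.
  rewrite Rabs_mult, (Rabs_pos_eq b) by lra.
  assert (Rabs ((x1 - x2) * (1 - z1) + - (x2 * (z1 - z2))) <= 2 * d); [|nra].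
  eapply Rle_trans; [apply Rabs_triang|]. rewrite Rabs_Ropp, !Rabs_mult.
  assert (Rabs (1 - z1) <= 1) by (apply Rabs_le; lra).
  assert (Rabs x2 <= 1) by (apply Rabs_le; lra).
  assert (Rabs (x1 - x2) * Rabs (1 - z1) <= d * 1) by (apply Rmult_le_compat; auto; apply Rabs_pos).
  assert (Rabs x2 * Rabs (z1 - z2) <= 1 * d) by (apply Rmult_le_compat; auto; apply Rabs_pos).
  lra.
Qed.

(** The waves are limits of these solutions as [a] grows. The speed is not
    determined by the problem: there is one solution for every [c >= 0], and [c]
    is chosen so that [psi 0] has a prescribed value. *)
Record truncated (r b c D a : R) (phi p psi q : R -> R) : Prop := {
  tr_phi_jet : jet (- a) a phi p (rate_phi r c D phi p psi);
  tr_psi_jet : jet (- a) a psi q (rate_psi b c phi psi q);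
  tr_phi_cont : forall t, continuous phi t;
  tr_psi_cont : forall t, continuous psi t;
  tr_phi_bound : forall t, 0 <= phi t <= 1;
  tr_psi_bound : forall t, 0 <= psi t <= 1;
  tr_left : forall t, t <= - a -> phi t = 0 /\ psi t = 0;
  tr_right : forall t, a <= t -> phi t = 1 /\ psi t = 1 }.
Arguments tr_phi_cont {r b c D a phi p psi q}.
Arguments tr_phi_bound {r b c D a phi p psi q}.
Arguments tr_psi_bound {r b c D a phi p psi q}.
Arguments tr_left {r b c D a phi p psi q}.
Arguments tr_right {r b c D a phi p psi q}.

Definition bvp (c K a : R) (f : R -> R) : (R -> R) * (R -> R) :=
  epsilon (inhabits (f, f)) (fun up => bvp_solution c K a f (fst up) (snd up)).

Lemma bvp_spec (c K a : R) (f : R -> R) :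
  0 < K -> 0 < a -> (forall t, continuous f t) ->
  bvp_solution c K a f (fst (bvp c K a f)) (snd (bvp c K a f)).
Proof.
  intros HK Ha Hf.
  apply (epsilon_spec (inhabits (f, f)) (fun up => bvp_solution c K a f (fst up) (snd up))).
  destruct (bvp_exists c K a f HK Ha Hf) as [u [p H]]. exists (u, p). exact H.
Qed.

(** The reaction terms plus [K] times the unknown: this makes them
    nondecreasing in both components, so that the iteration from (0, 0) is
    monotone. *)
Definition src_phi (r b D : R) (phi psi : R -> R) (t : R) : R :=
  (1 + r + b) * phi t + phi t * (1 - r - phi t + r * psi (t - D)).
Definition src_psi (r b : R) (phi psi : R -> R) (t : R) : R :=
  (1 + r + b) * psi t + b * phi t * (1 - psi t).

Fixpoint iterate (r b c D a : R) (n : nat) : ((R -> R) * (R -> R)) * ((R -> R) * (R -> R)) :=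
  match n with
  | O => ((fun _ => 0, fun _ => 0), (fun _ => 0, fun _ => 0))
  | S n =>
      let it := iterate r b c D a n in
      (bvp c (1 + r + b) a (src_phi r b D (fst (fst it)) (fst (snd it))),
       bvp c (1 + r + b) a (src_psi r b (fst (fst it)) (fst (snd it))))
  end.

Lemma src_mono (r b D : R) (f1 f2 g1 g2 : R -> R) :
  1 < r -> 0 < b ->
  (forall t, 0 <= f1 t <= 1 /\ 0 <= g1 t <= 1) -> (forall t, 0 <= f2 t <= 1 /\ 0 <= g2 t <= 1) ->
  (forall t, f1 t <= f2 t /\ g1 t <= g2 t) ->
  forall t, src_phi r b D f1 g1 t <= src_phi r b D f2 g2 t /\ src_psi r b f1 g1 t <= src_psi r b f2 g2 t.
Proof.
  intros Hr Hb B1 B2 H t. unfold src_phi, src_psi.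
  destruct (B1 t) as [X1 Z1]. destruct (B2 t) as [X2 Z2]. destruct (H t) as [HX HZ].
  destruct (B1 (t - D)) as [_ Y1]. destruct (B2 (t - D)) as [_ Y2]. destruct (H (t - D)) as [_ HY].
  set (x1 := f1 t) in *. set (x2 := f2 t) in *. set (z1 := g1 t) in *. set (z2 := g2 t) in *.
  set (y1 := g1 (t - D)) in *. set (y2 := g2 (t - D)) in *. split.
  - assert (E : (1 + r + b) * x2 + x2 * (1 - r - x2 + r * y2) - ((1 + r + b) * x1 + x1 * (1 - r - x1 + r * y1))
       = (x2 - x1) * (2 + b - x1 - x2 + r * y1) + r * x2 * (y2 - y1)) by ring.
    assert (0 <= (x2 - x1) * (2 + b - x1 - x2 + r * y1)).
    { apply Rmult_le_pos; [lra|]. assert (0 <= r * y1) by nra. lra. }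
    assert (0 <= r * x2 * (y2 - y1)) by (apply Rmult_le_pos; [apply Rmult_le_pos|]; lra).
    lra.
  - assert (E : (1 + r + b) * z2 + b * x2 * (1 - z2) - ((1 + r + b) * z1 + b * x1 * (1 - z1))
       = (z2 - z1) * (1 + r + b * (1 - x1)) + b * (x2 - x1) * (1 - z2)) by ring.
    assert (0 <= (z2 - z1) * (1 + r + b * (1 - x1))) by (apply Rmult_le_pos; nra).
    assert (0 <= b * (x2 - x1) * (1 - z2)) by (apply Rmult_le_pos; [apply Rmult_le_pos|]; lra).
    lra.
Qed.

Lemma src_range (r b D : R) (f g : R -> R) :
  1 < r -> 0 < b -> (forall t, 0 <= f t <= 1 /\ 0 <= g t <= 1) ->
  forall t, 0 <= src_phi r b D f g t <= 1 + r + b /\ 0 <= src_psi r b f g t <= 1 + r + b.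
Proof.
  intros Hr Hb B1 t.
  assert (Z : forall t : R, 0 <= 0 <= 1 /\ 0 <= 0 <= 1) by (intros; lra).
  assert (O : forall t : R, 0 <= 1 <= 1 /\ 0 <= 1 <= 1) by (intros; lra).
  destruct (src_mono r b D (fun _ => 0) f (fun _ => 0) g Hr Hb Z B1) with (t := t) as [L1 L2].
  { intros s. specialize (B1 s). lra. }
  destruct (src_mono r b D f (fun _ => 1) g (fun _ => 1) Hr Hb B1 O) with (t := t) as [U1 U2].
  { intros s. specialize (B1 s). lra. }
  unfold src_phi, src_psi in *. lra.
Qed.

Lemma src_continuous (r b D : R) (f g : R -> R) :
  (forall t, continuous f t) -> (forall t, continuous g t) ->
  forall t, continuous (src_phi r b D f g) t /\ continuous (src_psi r b f g) t.
Proof.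
  intros Hf Hg t.
  assert (HgD : continuous (fun t => g (t - D)) t) by (apply (continuous_shift g (- D)); auto).
  unfold src_phi, src_psi. split.
  - apply (continuous_plus (fun t => (1 + r + b) * f t)).
    + apply continuous_cmul; auto.
    + apply (continuous_mult f); [auto|].
      apply (continuous_plus (fun t => 1 - r - f t) (fun t => r * g (t - D))).
      * apply (continuous_minus (fun _ => 1 - r) f); [apply continuous_const|auto].
      * apply continuous_cmul; auto.
  - apply (continuous_plus (fun t => (1 + r + b) * g t)).
    + apply continuous_cmul; auto.
    + apply (continuous_mult (fun t => b * f t) (fun t => 1 - g t)).
      * apply continuous_cmul; auto.
      * apply (continuous_minus (fun _ => 1) g); [apply continuous_const|auto].
Qed.

Lemma src_lipschitz (r b D M : R) (f g : R -> R) :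
  1 < r -> 0 < b -> (forall t, 0 <= f t <= 1 /\ 0 <= g t <= 1) ->
  (forall s t, Rabs (f s - f t) <= M * Rabs (s - t) /\ Rabs (g s - g t) <= M * Rabs (s - t)) ->
  forall s t,
    Rabs (src_phi r b D f g s - src_phi r b D f g t) <= (2 + 3 * r + 3 * b) * M * Rabs (s - t) /\
    Rabs (src_psi r b f g s - src_psi r b f g t) <= (2 + 3 * r + 3 * b) * M * Rabs (s - t).
Proof.
  intros Hr Hb B HL s t. destruct (HL s t) as [A1 A2]. destruct (HL (s - D) (t - D)) as [_ A3].
  replace (s - D - (t - D)) with (s - t) in A3 by ring.
  set (K := 1 + r + b). set (d := M * Rabs (s - t)) in *.
  assert (Hd : 0 <= d) by (pose proof (Rabs_pos (f s - f t)); lra).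
  unfold src_phi, src_psi. fold K. rewrite (Rmult_assoc _ M). fold d. split.
  - replace (K * f s + f s * (1 - r - f s + r * g (s - D)) - (K * f t + f t * (1 - r - f t + r * g (t - D)))) with
      (K * (f s - f t) + (f s * (1 - r - f s + r * g (s - D)) - f t * (1 - r - f t + r * g (t - D)))) by ring.
    eapply Rle_trans; [apply Rabs_triang|]. rewrite Rabs_mult, (Rabs_pos_eq K) by (unfold K; lra).
    assert (G1 := react_phi_lip r (f s) (f t) (g (s - D)) (g (t - D)) d Hr
      (proj1 (B s)) (proj1 (B t)) (proj2 (B _)) (proj2 (B _)) A1 A3).
    assert (K * Rabs (f s - f t) <= K * d) by (apply Rmult_le_compat_l; [unfold K; lra|auto]).
    unfold K in *. nra.
  - replace (K * g s + b * f s * (1 - g s) - (K * g t + b * f t * (1 - g t))) with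
      (K * (g s - g t) + (b * f s * (1 - g s) - b * f t * (1 - g t))) by ring.
    eapply Rle_trans; [apply Rabs_triang|]. rewrite Rabs_mult, (Rabs_pos_eq K) by (unfold K; lra).
    assert (G1 := react_psi_lip b (f s) (f t) (g s) (g t) d Hb
      (proj1 (B s)) (proj1 (B t)) (proj2 (B _)) (proj2 (B _)) A1 A2).
    assert (K * Rabs (g s - g t) <= K * d) by (apply Rmult_le_compat_l; [unfold K; lra|auto]).
    unfold K in *. nra.
Qed.

Lemma truncated_exists (r b c D a : R) :
  1 < r -> 0 < b -> 0 <= c -> 1 <= a -> exists phi p psi q, truncated r b c D a phi p psi q.
Proof.
  intros Hr Hb Hc Ha.
  set (K := 1 + r + b). assert (HK : 0 < K) by (unfold K; lra).
  set (f := fun n => fst (fst (iterate r b c D a n))).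
  set (pf := fun n => snd (fst (iterate r b c D a n))).
  set (g := fun n => fst (snd (iterate r b c D a n))).
  set (pg := fun n => snd (snd (iterate r b c D a n))).
  assert (Hinv : forall n, (forall t, continuous (f n) t) /\ (forall t, continuous (g n) t) /\
     (forall t, 0 <= f n t <= 1 /\ 0 <= g n t <= 1)).
  { intros n. induction n as [|n [If [Ig Ib]]].
    - split; [|split]; intros t; [apply continuous_const|apply continuous_const|]. unfold f, g; simpl; lra.
    - assert (Hrg := src_range r b D (f n) (g n) Hr Hb Ib).
      assert (Hct := src_continuous r b D (f n) (g n) If Ig).
      assert (S1 := bvp_spec c K a _ HK ltac:(lra) (fun t => proj1 (Hct t))).
      assert (S2 := bvp_spec c K a _ HK ltac:(lra) (fun t => proj2 (Hct t))).
      split; [exact (bvp_cont _ _ _ _ _ _ S1)|]. split; [exact (bvp_cont _ _ _ _ _ _ S2)|].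
      intros t. split.
      + exact (bvp_range c K a _ _ _ HK S1 (fun s => proj1 (Hrg s)) t).
      + exact (bvp_range c K a _ _ _ HK S2 (fun s => proj2 (Hrg s)) t). }
  assert (HS : forall n, bvp_solution c K a (src_phi r b D (f n) (g n)) (f (S n)) (pf (S n)) /\
    bvp_solution c K a (src_psi r b (f n) (g n)) (g (S n)) (pg (S n))).
  { intros n. destruct (Hinv n) as [If [Ig _]].
    assert (Hct := src_continuous r b D (f n) (g n) If Ig). split.
    - exact (bvp_spec c K a _ HK ltac:(lra) (fun t => proj1 (Hct t))).
    - exact (bvp_spec c K a _ HK ltac:(lra) (fun t => proj2 (Hct t))). }
  assert (Hrg : forall n t, 0 <= src_phi r b D (f n) (g n) t <= K /\ 0 <= src_psi r b (f n) (g n) t <= K).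
  { intros n. destruct (Hinv n) as [_ [_ B]]. apply src_range; auto. }
  assert (Hmono : forall n t, f n t <= f (S n) t /\ g n t <= g (S n) t).
  { intros n. induction n as [|n IH].
    - intros t. destruct (Hinv 1%nat) as [_ [_ H]]. specialize (H t). unfold f at 1, g at 1; simpl. lra.
    - destruct (Hinv n) as [_ [_ B0]]. destruct (Hinv (S n)) as [_ [_ B1]].
      assert (Hs := src_mono r b D (f n) (f (S n)) (g n) (g (S n)) Hr Hb B0 B1 IH).
      destruct (HS n) as [S1 S2]. destruct (HS (S n)) as [T1 T2].
      intros t. split.
      + exact (bvp_le c K a _ _ _ _ _ _ HK S1 T1 (fun s => proj1 (Hs s)) t).
      + exact (bvp_le c K a _ _ _ _ _ _ HK S2 T2 (fun s => proj2 (Hs s)) t). }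
  set (M := 1 + c + K). assert (HM : 0 <= M) by (unfold M; lra).
  assert (HL : forall n s t, Rabs (f n s - f n t) <= M * Rabs (s - t) /\ Rabs (g n s - g n t) <= M * Rabs (s - t)).
  { intros [|n] s t.
    - unfold f, g; simpl. rewrite Rminus_diag, Rabs_R0.
      assert (0 <= M * Rabs (s - t)) by (apply Rmult_le_pos; [auto|apply Rabs_pos]). lra.
    - destruct (HS n) as [S1 S2]. split.
      + apply (bvp_lipschitz c K a _ _ _ Hc HK Ha S1 (fun t => proj1 (Hrg n t))).
      + apply (bvp_lipschitz c K a _ _ _ Hc HK Ha S2 (fun t => proj2 (Hrg n t))). }
  set (phi := fun t => ultralimit (fun n => f n t)).
  set (psi := fun t => ultralimit (fun n => g n t)).
  assert (Lphi : forall t, ulim (fun n => f n t) (phi t)).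
  { intros t. apply ultralimit_unit, ultra_all. intros n. apply Hinv. }
  assert (Lpsi : forall t, ulim (fun n => g n t) (psi t)).
  { intros t. apply ultralimit_unit, ultra_all. intros n. apply Hinv. }
  assert (Bphi : forall t, 0 <= phi t <= 1).
  { intros t. apply (ulim_bounds _ _ _ _ (Lphi t)), ultra_all. intros n. apply Hinv. }
  assert (Bpsi : forall t, 0 <= psi t <= 1).
  { intros t. apply (ulim_bounds _ _ _ _ (Lpsi t)), ultra_all. intros n. apply Hinv. }
  assert (HLs : forall n s t,
    Rabs (src_phi r b D (f n) (g n) s - src_phi r b D (f n) (g n) t) <= (2 + 3 * r + 3 * b) * M * Rabs (s - t) /\
    Rabs (src_psi r b (f n) (g n) s - src_psi r b (f n) (g n) t) <= (2 + 3 * r + 3 * b) * M * Rabs (s - t)).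
  { intros n. destruct (Hinv n) as [_ [_ B]]. apply src_lipschitz; auto. }
  assert (HLpos : 0 <= (2 + 3 * r + 3 * b) * M) by (apply Rmult_le_pos; lra).
  (* the monotone iterates and their successors have the same limit *)
  destruct (bvp_limit c K a _ (fun n => src_phi r b D (f n) (g n)) (fun n => f (S n)) (fun n => pf (S n))
    (src_phi r b D phi psi) phi Hc HK Ha HLpos (fun n => proj1 (HS n)) (fun n t => proj1 (Hrg n t))
    (fun n s t => proj1 (HLs n s t))) as [p [P1 P2 P3 P4]].
  { intros t. apply ulim_plus; [apply ulim_scal; auto|]. apply ulim_mult; [auto|].
    apply ulim_plus; [|apply ulim_scal; auto]. apply ulim_minus; [apply ulim_const|auto]. }
  { intros t. apply (ulim_monotone_shift (fun n => f n t)); auto. intros n; apply Hmono. }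
  destruct (bvp_limit c K a _ (fun n => src_psi r b (f n) (g n)) (fun n => g (S n)) (fun n => pg (S n))
    (src_psi r b phi psi) psi Hc HK Ha HLpos (fun n => proj2 (HS n)) (fun n t => proj2 (Hrg n t))
    (fun n s t => proj2 (HLs n s t))) as [q [Q1 Q2 Q3 Q4]].
  { intros t. apply ulim_plus; [apply ulim_scal; auto|]. apply ulim_mult; [apply ulim_scal; auto|].
    apply ulim_minus; [apply ulim_const|auto]. }
  { intros t. apply (ulim_monotone_shift (fun n => g n t)); auto. intros n; apply Hmono. }
  exists phi, p, psi, q. constructor; auto.
  - intros t Ht. replace (rate_phi r c D phi p psi t) with (c * p t - (src_phi r b D phi psi t - K * phi t));
      [exact (P4 t Ht)|unfold rate_phi, src_phi, K; ring].
  - intros t Ht. replace (rate_psi b c phi psi q t) with (c * q t - (src_psi r b phi psi t - K * psi t));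
      [exact (Q4 t Ht)|unfold rate_psi, src_psi, K; ring].
Qed.

(** * The truncated problem: monotonicity, uniqueness, compactness *)

Lemma continuous_eq_ends (u : R -> R) (x y k : R) :
  x < y -> (forall t, continuous u t) -> (forall t, x < t < y -> u t = k) -> u x = k /\ u y = k.
Proof.
  intros Hxy Hc H.
  assert (G : forall z, x <= z <= y -> u z = k).
  { intros z Hz. apply NNPP; intros Hne.
    assert (Hcz := Hc z). apply continuity_pt_filterlim in Hcz.
    destruct (Hcz (Rabs (u z - k))) as [d [Hd0 Hd]]; [apply Rabs_pos_lt; lra|].
    assert (Hs : exists s, x < s < y /\ s <> z /\ Rabs (s - z) < d).
    { set (e := Rmin (d / 2) ((y - x) / 4)).
      assert (He : 0 < e) by (unfold e; apply Rmin_glb_lt; lra).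
      assert (He1 : e <= d / 2) by apply Rmin_l. assert (He2 : e <= (y - x) / 4) by apply Rmin_r.
      destruct (Rle_dec z ((x + y) / 2)).
      - exists (z + e). repeat split; try lra. replace (z + e - z) with e by ring. rewrite Rabs_pos_eq; lra.
      - exists (z - e). repeat split; try lra. replace (z - e - z) with (- e) by ring. rewrite Rabs_Ropp, Rabs_pos_eq; lra. }
    destruct Hs as [s [H1 [H2 H3]]].
    assert (Ha : Rabs (u s - u z) < Rabs (u z - k)).
    { apply Hd. split; [split; [exact I|auto]|exact H3]. }
    rewrite (H s H1), Rabs_minus_sym in Ha. lra. }
  split; apply G; lra.
Qed.

Lemma truncated_pos {r b c D a phi p psi q} :
  1 < r -> 0 < b -> 0 < a -> truncated r b c D a phi p psi q ->
  forall t, - a < t -> 0 < phi t /\ 0 < psi t.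
Proof.
  intros Hr Hb Ha [J1 J2 C1 C2 B1 B2 _ R1] t Ht.
  destruct (Rle_dec a t) as [H|H]; [destruct (R1 t H); lra|].
  destruct (R1 a ltac:(lra)) as [Ra1 Ra2].
  split; apply Rnot_le_lt; intros Hle.
  - assert (E : phi t = 0) by (specialize (B1 t); lra).
    destruct (continuous_eq_ends phi (- a) a 0) as [_ E2]; [lra|auto| |lra].
    apply (strong_minimum c r t ltac:(lra) J1); auto; try lra.
    + intros u _. unfold rate_phi. pose proof (reaction_phi_lower r (phi u) (psi (u - D)) Hr (B1 u) (B2 _)). lra.
    + intros u _; apply B1.
  - assert (E : psi t = 0) by (specialize (B2 t); lra).
    destruct (continuous_eq_ends psi (- a) a 0) as [_ E2]; [lra|auto| |lra].
    apply (strong_minimum c b t Hb J2); auto; try lra.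
    + intros u _. unfold rate_psi. specialize (B2 u).
      pose proof (reaction_psi_nonneg b (phi u) (psi u) Hb (B1 u) B2). nra.
    + intros u _; apply B2.
Qed.

Lemma truncated_psi_lt_1 {r b c D a phi p psi q} :
  0 < b -> 0 < a -> truncated r b c D a phi p psi q -> forall t, t < a -> psi t < 1.
Proof.
  intros Hb Ha [_ J2 _ C2 B1 B2 L1 _] t Ht.
  destruct (Rle_dec t (- a)) as [H|H]; [destruct (L1 t H); lra|].
  destruct (L1 (- a) ltac:(lra)) as [_ La2].
  apply Rnot_le_lt; intros Hle.
  assert (E : psi t = 1) by (specialize (B2 t); lra).
  destruct (continuous_eq_ends psi (- a) a 1) as [E2 _]; [lra|auto| |lra].
  intros u Hu. assert (H0 : -1 * psi u + 1 * 1 = 0); [|lra].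
  apply (strong_minimum c b t Hb (jet_lin (-1) 1 J2 (jet_const 1))); try lra.
  - intros v _. unfold rate_psi. specialize (B1 v). specialize (B2 v).
    assert (0 <= b * (1 - phi v) * (1 - psi v)) by (apply Rmult_le_pos; [apply Rmult_le_pos|]; lra). nra.
  - intros v _. specialize (B2 v). lra.
Qed.

Lemma truncated_psi_mono {r b c D a phi p psi q} :
  0 < b -> 0 < a -> truncated r b c D a phi p psi q -> forall s t, s <= t -> psi s <= psi t.
Proof.
  intros Hb Ha T. assert (Q := truncated_psi_lt_1 Hb Ha T).
  destruct T as [_ J2 _ C2 B1 B2 L1 R1].
  assert (D3 : forall t, - a < t < a -> is_derive psi t (q t)) by (intros t Ht; destruct (J2 t Ht); auto).
  assert (D4 : forall t, - a < t < a -> is_derive q t (rate_psi b c phi psi q t)) by (intros t Ht; destruct (J2 t Ht); auto).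
  assert (Hq : forall t, - a < t < a -> 0 <= q t).
  { intros t0 Ht0. apply Rnot_lt_le; intros Hneg.
    assert (Hn : forall t, t0 < t < a -> q t <= 0).
    { intros t Htt. apply (stays_nonpos c t0 t q (rate_psi b c phi psi q)); [lra| |lra].
      intros u Hu. split; [apply D4; lra|]. unfold rate_psi.
      pose proof (reaction_psi_nonneg b _ _ Hb (B1 u) (B2 u)). lra. }
    assert (H0 : psi a - psi t0 <= 0 * (a - t0)).
    { apply (slope_le psi q); [lra|auto|]. intros u Hu. split; [apply D3; lra|apply Hn; lra]. }
    destruct (R1 a ltac:(lra)). specialize (Q t0). lra. }
  intros s t Hst.
  destruct (Rle_dec s (- a)) as [H1|H1]; [destruct (L1 s H1); specialize (B2 t); lra|].
  destruct (Rle_dec a t) as [H2|H2]; [destruct (R1 t H2); specialize (B2 s); lra|].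
  assert (0 * (t - s) <= psi t - psi s); [|lra].
  apply (slope_ge psi q); auto. intros u Hu. split; [apply D3; lra|apply Hq; lra].
Qed.

Lemma truncated_phi_mono {r b c D a phi p psi q} :
  1 < r -> 0 < b -> 0 < a -> truncated r b c D a phi p psi q -> forall s t, s <= t -> phi s <= phi t.
Proof.
  intros Hr Hb Ha T.
  assert (Pos := truncated_pos Hr Hb Ha T). assert (Inc := truncated_psi_mono Hb Ha T).
  destruct T as [J1 _ C1 _ B1 _ L1 R1].
  assert (Hle : forall tau t, 0 < tau -> phi t <= phi (t + tau)).
  { intros tau x0 Htau. apply Rnot_lt_le; intros Hlt.
    destruct (Rle_dec x0 (- a)) as [H1|H1]; [destruct (L1 x0 H1); specialize (B1 (x0 + tau)); lra|].
    destruct (Rle_dec a (x0 + tau)) as [H2|H2]; [destruct (R1 _ H2); specialize (B1 x0); lra|].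
    assert (P : forall t, - a <= t -> 0 < phi (t + tau)) by (intros t Ht; apply Pos; lra).
    set (w := fun t => phi t / phi (t + tau)).
    assert (Hval : forall t, - a <= t -> phi t = w t * phi (t + tau)).
    { intros t Ht. unfold w. field. specialize (P t Ht); lra. }
    set (m := (1 + w x0) / 2).
    assert (Hw : 1 < w x0).
    { apply Rnot_le_lt; intros H. specialize (Hval x0 ltac:(lra)). specialize (P x0 ltac:(lra)). nra. }
    destruct (exists_max_interval w (- a) (a - tau) x0 m) as [tm [M1 [M2 M3]]].
    - intros t Ht. apply (continuous_ratio phi (fun t => phi (t + tau))); [auto|apply continuous_shift; auto|].
      apply P; lra.
    - lra.
    - unfold m; lra.
    - unfold w. destruct (L1 (- a) ltac:(lra)) as [-> _]. unfold m, Rdiv. lra.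
    - unfold w. replace (a - tau + tau) with a by ring. destruct (R1 a ltac:(lra)) as [-> _].
      specialize (B1 (a - tau)). unfold m; lra.
    - assert (Jx : jet (- a) (a - tau + tau) phi p (rate_phi r c D phi p psi)) by (intros u Hu; apply J1; lra).
      apply (no_contact_with_translate tau (w tm) tm Hr (proj1 (Pos tm ltac:(lra))) (P tm ltac:(lra)) M1 Jx Htau).
      + unfold m in M2; lra.
      + apply Inc; lra.
      + left; unfold m in M2; lra.
      + intros u Hu. rewrite (Hval u) by lra. apply Rmult_le_compat_r; [left; apply P; lra|apply M3; lra].
      + apply Hval; lra. }
  intros s t [Hst|Hst]; [|rewrite Hst; lra]. specialize (Hle (t - s) s).
  replace (s + (t - s)) with t in Hle by ring. apply Hle; lra.
Qed.

Lemma truncated_phi_lt_1 {r b c D a phi p psi q} :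
  1 < r -> 0 < b -> 0 < a -> 0 <= D -> truncated r b c D a phi p psi q -> forall t, t < a -> phi t < 1.
Proof.
  intros Hr Hb Ha HD T t Ht. assert (Q := truncated_psi_lt_1 Hb Ha T).
  destruct T as [J1 _ _ _ B1 _ L1 _].
  destruct (Rle_dec t (- a)) as [H|H]; [destruct (L1 t H); lra|].
  apply Rnot_le_lt; intros Hle.
  assert (E : phi t = 1) by (specialize (B1 t); lra).
  destruct (touching 1 t J1 (jet_const 1)) as [P0 S0]; try lra.
  - intros u Hu. specialize (B1 u); lra.
  - unfold rate_phi in S0. rewrite P0, E in S0. specialize (Q (t - D)). nra.
Qed.

(** Sliding the second solution to the right of the first. The translate
    [tau > 0] solves the same equations on the smaller interval
    [(- a, a - tau)], so by the strong maximum principle a contact there would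
    reach [- a], where the translate is positive and the first solution is 0. *)
Lemma truncated_le r b c D a f1 p1 g1 q1 f2 p2 g2 q2 :
  1 < r -> 0 < b -> 0 < a -> 0 <= D ->
  truncated r b c D a f1 p1 g1 q1 -> truncated r b c D a f2 p2 g2 q2 ->
  forall t, f1 t <= f2 t /\ g1 t <= g2 t.
Proof.
  intros Hr Hb Ha HD T T'.
  assert (Pos := truncated_pos Hr Hb Ha T').
  assert (F1 := truncated_phi_lt_1 Hr Hb Ha HD T). assert (G1 := truncated_psi_lt_1 Hb Ha T).
  assert (If := truncated_phi_mono Hr Hb Ha T'). assert (Ig := truncated_psi_mono Hb Ha T').
  destruct T as [J1 J2 C1 C2 B1 B2 L1 R1]. destruct T' as [J3 J4 D1 D2 E1 E2 _ S1].
  set (dom := fun tau => 0 <= tau /\ forall t, f1 t <= f2 (t + tau) /\ g1 t <= g2 (t + tau)).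
  assert (Hup : forall s t, dom s -> s < t -> dom t).
  { intros s t [Hs0 Hs] Hst. split; [lra|]. intros u. destruct (Hs u) as [H1 H2].
    assert (f2 (u + s) <= f2 (u + t)) by (apply If; lra).
    assert (g2 (u + s) <= g2 (u + t)) by (apply Ig; lra). lra. }
  assert (Hhi : dom (2 * a)).
  { split; [lra|]. intros t. destruct (Rle_dec t (- a)) as [H|H].
    - destruct (L1 t H) as [-> ->]. split; [apply E1|apply E2].
    - destruct (S1 (t + 2 * a)) as [-> ->]; [lra|]. split; [apply B1|apply B2]. }
  destruct (greatest_lower_bound dom 0 (2 * a) Hhi) as [tau [Hinf1 Hinf2]].
  { intros t [Ht _]; exact Ht. }
  assert (Hgt : forall t, tau < t -> dom t).
  { intros t Ht. destruct (Hinf2 t Ht) as [s [Hs1 Hs2]]. apply (Hup s); auto. }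
  assert (Hdom : forall t, f1 t <= f2 (t + tau) /\ g1 t <= g2 (t + tau)).
  { intros t. split; [apply (le_of_right_limit f2)|apply (le_of_right_limit g2)]; auto; intros y Hy;
      replace y with (t + (y - t)) by ring; apply Hgt; lra. }
  assert (Htau : 0 <= tau).
  { apply Rnot_lt_le; intros H. destruct (Hinf2 (tau / 2)) as [s [[Hs _] Hs2]]; lra. }
  assert (Ht2 : tau <= 2 * a) by (apply Hinf1; auto).
  destruct Htau as [Htau|Htau].
  2: { intros t. specialize (Hdom t). rewrite <- Htau, Rplus_0_r in Hdom. exact Hdom. }
  exfalso.
  destruct (L1 (- a) ltac:(lra)) as [L1f L1g].
  destruct (Pos (- a + tau) ltac:(lra)) as [Pf Pg].
  (* where both profiles solve the system, contact would propagate to - a *)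
  assert (Hsf : forall t, - a < t < a - tau -> f1 t < f2 (t + tau)).
  { intros t Ht. destruct (Hdom t) as [[H|H] _]; [auto|exfalso].
    destruct (continuous_eq_ends (fun t => 1 * f2 (t + tau) + -1 * f1 t) (- a) (a - tau) 0) as [E0 _]; try lra.
    { intros u. apply (continuous_lin (fun t => f2 (t + tau)) f1); auto. apply continuous_shift; auto. }
    assert (Ja : jet (- a) (a - tau) f1 p1 (rate_phi r c D f1 p1 g1)) by (intros u Hu; apply J1; lra).
    assert (Jb : jet (- a + tau) (a - tau + tau) f2 p2 (rate_phi r c D f2 p2 g2)) by (intros u Hu; apply J3; lra).
    apply (strong_minimum c (r + 1) t ltac:(lra) (jet_lin 1 (-1) (jet_shift tau Jb) Ja)); try lra.
    - intros u Hu. destruct (Hdom u) as [H1 _]. destruct (Hdom (u - D)) as [_ H2].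
      replace (u - D + tau) with (u + tau - D) in H2 by ring.
      pose proof (B1 u). pose proof (E1 (u + tau)). pose proof (B2 (u - D)).
      set (e := f2 (u + tau) - f1 u) in *.
      assert (0 <= e) by (unfold e; lra).
      assert (A1 : e * (r - 1 + f1 u + f2 (u + tau) - r * g1 (u - D)) <= e * (r + 1)).
      { apply Rmult_le_compat_l; [auto|]. assert (0 <= r * g1 (u - D)) by nra. lra. }
      assert (A2 : 0 <= r * f2 (u + tau) * (g2 (u + tau - D) - g1 (u - D))).
      { apply Rmult_le_pos; [apply Rmult_le_pos|]; lra. }
      unfold rate_phi. unfold e in A1. nra.
    - intros u Hu. destruct (Hdom u) as [H1 _]. lra. }
  assert (Hsg : forall t, - a < t < a - tau -> g1 t < g2 (t + tau)).
  { intros t Ht. destruct (Hdom t) as [_ [H|H]]; [auto|exfalso].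
    destruct (continuous_eq_ends (fun t => 1 * g2 (t + tau) + -1 * g1 t) (- a) (a - tau) 0) as [E0 _]; try lra.
    { intros u. apply (continuous_lin (fun t => g2 (t + tau)) g1); auto. apply continuous_shift; auto. }
    assert (Ja : jet (- a) (a - tau) g1 q1 (rate_psi b c f1 g1 q1)) by (intros u Hu; apply J2; lra).
    assert (Jb : jet (- a + tau) (a - tau + tau) g2 q2 (rate_psi b c f2 g2 q2)) by (intros u Hu; apply J4; lra).
    apply (strong_minimum c b t ltac:(lra) (jet_lin 1 (-1) (jet_shift tau Jb) Ja)); try lra.
    - intros u Hu. destruct (Hdom u) as [H1 H2].
      pose proof (B2 u). pose proof (E1 (u + tau)).
      set (d := g2 (u + tau) - g1 u) in *.
      assert (0 <= d) by (unfold d; lra).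
      assert (A1 : b * (f2 (u + tau) * d) <= b * (1 * d)).
      { apply Rmult_le_compat_l; [lra|]. apply Rmult_le_compat_r; lra. }
      assert (A2 : 0 <= b * (f2 (u + tau) - f1 u) * (1 - g1 u)).
      { apply Rmult_le_pos; [apply Rmult_le_pos|]; lra. }
      unfold rate_psi. unfold d in A1. nra.
    - intros u Hu. destruct (Hdom u) as [_ H1]. lra. }
  assert (Hs : forall t, - a <= t <= a - tau / 2 -> f1 t < f2 (t + tau) /\ g1 t < g2 (t + tau)).
  { intros t Ht. destruct (Req_dec t (- a)) as [->|Hne]; [lra|].
    destruct (Rle_dec (a - tau) t) as [H|H].
    - destruct (S1 (t + tau)) as [-> ->]; [lra|]. split; [apply F1|apply G1]; lra.
    - split; [apply Hsf|apply Hsg]; lra. }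
  destruct (slide_compact f2 f1 (- a) (a - tau / 2) tau) as [d1 [Hd1 Hs1]]; auto; [lra|intros; apply Hs; auto|].
  destruct (slide_compact g2 g1 (- a) (a - tau / 2) tau) as [d2 [Hd2 Hs2]]; auto; [lra|intros; apply Hs; auto|].
  set (d := Rmin (tau / 2) (Rmin d1 d2)).
  assert (Hd : 0 < d /\ d <= tau / 2 /\ d <= d1 /\ d <= d2).
  { unfold d. pose proof (Rmin_l d1 d2). pose proof (Rmin_r d1 d2).
    pose proof (Rmin_l (tau / 2) (Rmin d1 d2)). pose proof (Rmin_r (tau / 2) (Rmin d1 d2)).
    split; [repeat apply Rmin_glb_lt|]; lra. }
  assert (Hnew : dom (tau - d)).
  { split; [lra|]. intros t. destruct (Rle_dec t (- a)) as [H|H].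
    - destruct (L1 t H) as [-> ->]. split; [apply E1|apply E2].
    - destruct (Rle_dec t (a - tau / 2)) as [H'|H'].
      + replace (t + (tau - d)) with (t + tau - d) by ring. split; [apply Hs1|apply Hs2]; lra.
      + destruct (S1 (t + (tau - d))) as [-> ->]; [lra|]. split; [apply B1|apply B2]. }
  apply Hinf1 in Hnew. lra.
Qed.

(** The equations hold on [(x, y)], while the Lipschitz bounds are global, since
    the delayed argument may leave this interval. The class is closed under
    ultralimits. *)
Record lip_system (r b c D M x y : R) (phi p psi q : R -> R) : Prop := {
  ls_phi_jet : jet x y phi p (rate_phi r c D phi p psi);
  ls_psi_jet : jet x y psi q (rate_psi b c phi psi q);
  ls_slopes : forall t, x < t < y -> Rabs (p t) <= M /\ Rabs (q t) <= M;
  ls_phi_bound : forall t, 0 <= phi t <= 1;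
  ls_psi_bound : forall t, 0 <= psi t <= 1;
  ls_phi_lip : forall s t, Rabs (phi s - phi t) <= M * Rabs (s - t);
  ls_psi_lip : forall s t, Rabs (psi s - psi t) <= M * Rabs (s - t) }.
Arguments ls_phi_jet {r b c D M x y phi p psi q}.
Arguments ls_psi_jet {r b c D M x y phi p psi q}.
Arguments ls_phi_bound {r b c D M x y phi p psi q}.
Arguments ls_psi_bound {r b c D M x y phi p psi q}.
Arguments ls_phi_lip {r b c D M x y phi p psi q}.
Arguments ls_psi_lip {r b c D M x y phi p psi q}.

Lemma truncated_lip {r b c D a phi p psi q} :
  1 < r -> 0 < b -> 0 <= c <= 3 + b -> 1 <= a -> truncated r b c D a phi p psi q ->
  lip_system r b c D (4 + r + 2 * b) (- a) a phi p psi q.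
Proof.
  intros Hr Hb Hc Ha [J1 J2 C1 C2 B1 B2 L1 R1].
  destruct (clamped_lipschitz c r a phi p (fun t => phi t * (1 - r - phi t + r * psi (t - D)))) as [P1 Q1]; auto.
  { lra. } { intros t Ht; apply L1; auto. } { intros t Ht; apply R1; auto. }
  { intros t _. apply react_phi_bound; auto. }
  destruct (clamped_lipschitz c b a psi q (fun t => b * phi t * (1 - psi t))) as [P2 Q2]; auto.
  { lra. } { intros t Ht; apply L1; auto. } { intros t Ht; apply R1; auto. }
  { intros t _. apply react_psi_bound; auto. }
  constructor; auto.
  - intros t Ht. specialize (P1 t Ht). specialize (P2 t Ht). lra.
  - intros s t. eapply Rle_trans; [apply Q1|]. apply Rmult_le_compat_r; [apply Rabs_pos|lra].
  - intros s t. eapply Rle_trans; [apply Q2|]. apply Rmult_le_compat_r; [apply Rabs_pos|lra].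
Qed.

Lemma lip_system_shift {r b c D M x y phi p psi q} (tau : R) :
  lip_system r b c D M (x + tau) (y + tau) phi p psi q ->
  lip_system r b c D M x y (fun t => phi (t + tau)) (fun t => p (t + tau))
    (fun t => psi (t + tau)) (fun t => q (t + tau)).
Proof.
  intros [J1 J2 W5 B1 B2 L1 L2]. constructor.
  - intros t Ht. rewrite rate_phi_shift. exact (jet_shift tau J1 t Ht).
  - exact (jet_shift tau J2).
  - intros t Ht; apply W5; lra.
  - auto.
  - auto.
  - intros s t. replace (s - t) with (s + tau - (t + tau)) by ring. apply L1.
  - intros s t. replace (s - t) with (s + tau - (t + tau)) by ring. apply L2.
Qed.

Lemma lip_system_restrict {r b c D M x y phi p psi q} (x' y' : R) :
  x <= x' -> y' <= y -> lip_system r b c D M x y phi p psi q -> lip_system r b c D M x' y' phi p psi q.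
Proof.
  intros Hx Hy [J1 J2 W5 B1 B2 L1 L2].
  constructor; auto; [apply (jet_weaken Hx Hy J1)|apply (jet_weaken Hx Hy J2)|].
  intros t Ht; apply W5; lra.
Qed.

(** The reaction terms are Lipschitz with a constant depending on [M] only, so
    the second derivatives are equicontinuous and [ultralimit_jet] applies.
    The Lipschitz bound on [psi] also absorbs the variation of the delay. *)
Lemma lip_system_ultralimit (r b M x y C c' D' : R) (c D : nat -> R) (phi p psi q : nat -> R -> R) :
  1 < r -> 0 < b -> 0 <= M -> 0 <= C ->
  ultra (fun n => Rabs (c n) <= C /\ lip_system r b (c n) (D n) M x y (phi n) (p n) (psi n) (q n)) ->
  ulim c c' -> ulim D D' ->
  lip_system r b c' D' M x y (fun t => ultralimit (fun n => phi n t)) (fun t => ultralimit (fun n => p n t))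
    (fun t => ultralimit (fun n => psi n t)) (fun t => ultralimit (fun n => q n t)).
Proof.
  intros Hr Hb HM HC HU Hc HD.
  set (f := fun t => ultralimit (fun n => phi n t)). set (g := fun t => ultralimit (fun n => psi n t)).
  set (pf := fun t => ultralimit (fun n => p n t)). set (pg := fun t => ultralimit (fun n => q n t)).
  assert (Bn : forall t, ultra (fun n => 0 <= phi n t <= 1) /\ ultra (fun n => 0 <= psi n t <= 1)).
  { intros t. split; apply (ultra_mono _ _ HU); intros n [_ W]; apply W. }
  assert (Lf : forall t, ulim (fun n => phi n t) (f t)) by (intros t; apply ultralimit_unit, Bn).
  assert (Lg : forall t, ulim (fun n => psi n t) (g t)) by (intros t; apply ultralimit_unit, Bn).
  assert (Mn : forall t, x < t < y -> ultra (fun n => Rabs (p n t) <= M) /\ ultra (fun n => Rabs (q n t) <= M)).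
  { intros t Ht. split; apply (ultra_mono _ _ HU); intros n [_ W]; apply W; exact Ht. }
  assert (Lp : forall t, x < t < y -> ulim (fun n => p n t) (pf t)).
  { intros t Ht. apply (ultralimit_spec _ M), Mn, Ht. }
  assert (Lq : forall t, x < t < y -> ulim (fun n => q n t) (pg t)).
  { intros t Ht. apply (ultralimit_spec _ M), Mn, Ht. }
  assert (Labs : forall (v : nat -> R) l, ulim v l -> ulim (fun n => Rabs (v n - l)) 0).
  { intros v l Hv eps He. apply (ultra_mono _ _ (Hv eps He)). intros n H.
    rewrite Rminus_0_r, Rabs_Rabsolu. exact H. }
  assert (LgD : forall t, ulim (fun n => psi n (t - D n)) (g (t - D'))).
  { intros t. apply (ulim_squeeze _ (fun n => M * Rabs (D n - D') + Rabs (psi n (t - D') - g (t - D')))).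
    - replace 0 with (M * 0 + 0) by ring. apply ulim_plus; [apply ulim_scal|]; apply Labs; auto.
    - apply (ultra_mono _ _ HU). intros n [_ W].
      replace (psi n (t - D n) - g (t - D')) with
        ((psi n (t - D n) - psi n (t - D')) + (psi n (t - D') - g (t - D'))) by ring.
      eapply Rle_trans; [apply Rabs_triang|]. apply Rplus_le_compat_r.
      eapply Rle_trans; [apply (ls_psi_lip W)|]. right.
      replace (t - D n - (t - D')) with (- (D n - D')) by ring. rewrite Rabs_Ropp. reflexivity. }
  constructor.
  - apply (ultralimit_jet x y phi p (fun n t => phi n t * (1 - r - phi n t + r * psi n (t - D n))) c
      f pf (fun t => f t * (1 - r - f t + r * g (t - D'))) c' C M r ((2 * r + 1) * M)); auto; try nra.
    + apply (ultra_mono _ _ HU). intros n [Hcn [J1 J2 W5 B1 B2 L1 L2]].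
      split; [exact Hcn|]. split; [exact J1|]. split.
      * intros t Ht. split; [apply W5; auto|apply react_phi_bound; auto].
      * intros s t. rewrite Rmult_assoc. apply react_phi_lip; auto.
        replace (s - t) with (s - D n - (t - D n)) by ring. apply L2.
    + intros t Ht. split; [auto|]. split; [auto|]. apply ulim_mult; [auto|].
      apply ulim_plus; [|apply ulim_scal; auto]. apply ulim_minus; [apply ulim_const|auto].
  - apply (ultralimit_jet x y psi q (fun n t => b * phi n t * (1 - psi n t)) c
      g pg (fun t => b * f t * (1 - g t)) c' C M b (2 * b * M)); auto; try nra.
    + apply (ultra_mono _ _ HU). intros n [Hcn [J1 J2 W5 B1 B2 L1 L2]].
      split; [exact Hcn|]. split; [exact J2|]. split.
      * intros t Ht. split; [apply W5; auto|apply react_psi_bound; auto].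
      * intros s t. replace (2 * b * M * Rabs (s - t)) with (2 * b * (M * Rabs (s - t))) by ring.
        apply react_psi_lip; auto.
    + intros t Ht. split; [auto|]. split; [auto|]. apply ulim_mult; [apply ulim_scal; auto|].
      apply ulim_minus; [apply ulim_const|auto].
  - intros t Ht. split.
    + apply (ulim_abs_le (fun n => p n t) (fun _ => M)); [auto|apply ulim_const|apply Mn, Ht].
    + apply (ulim_abs_le (fun n => q n t) (fun _ => M)); [auto|apply ulim_const|apply Mn, Ht].
  - intros t. apply (ulim_bounds _ _ _ _ (Lf t)), Bn.
  - intros t. apply (ulim_bounds _ _ _ _ (Lg t)), Bn.
  - intros s t. apply (ulim_abs_le (fun n => phi n s - phi n t) (fun _ => M * Rabs (s - t))).
    + apply ulim_minus; auto.
    + apply ulim_const.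
    + apply (ultra_mono _ _ HU). intros n [_ W]. apply (ls_phi_lip W).
  - intros s t. apply (ulim_abs_le (fun n => psi n s - psi n t) (fun _ => M * Rabs (s - t))).
    + apply ulim_minus; auto.
    + apply ulim_const.
    + apply (ultra_mono _ _ HU). intros n [_ W]. apply (ls_psi_lip W).
Qed.

(** * Existence of a wave *)

(** For [c = 0] the second component is concave, so it lies above its chord. *)
Lemma truncated_speed_zero {r b D a phi p psi q} :
  1 < r -> 0 < b -> 0 < a -> truncated r b 0 D a phi p psi q -> 1 / 2 <= psi 0.
Proof.
  intros Hr Hb Ha T.
  assert (Pos := truncated_pos Hr Hb Ha T). assert (Q := truncated_psi_lt_1 Hb Ha T).
  destruct T as [_ J2 _ C2 _ _ L1 R1].
  destruct (L1 (- a) ltac:(lra)) as [_ La]. destruct (R1 a ltac:(lra)) as [_ Ra].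
  assert (Jl : jet (- a) a (fun t => / (2 * a) * t + / 2 * 1) (fun _ => / (2 * a) * 1 + / 2 * 0) (fun _ => 0)).
  { intros s _. split; [|apply @is_derive_const].
    apply (is_derive_lin (fun t => t) (fun _ => 1)); [exact (is_derive_id s)|apply @is_derive_const]. }
  assert (H : 1 * (/ (2 * a) * 0 + / 2 * 1) + -1 * psi 0 <= 0); [|lra].
  apply (max_principle 0 (jet_lin 1 (-1) Jl J2)); try lra.
  - intros t _. apply (continuous_lin (fun t => / (2 * a) * t + / 2 * 1) psi); auto.
    apply (continuous_lin (fun t => t) (fun _ => 1)); [apply continuous_id|apply continuous_const].
  - rewrite La. replace (/ (2 * a) * - a) with (- / 2) by (field; lra). lra.
  - rewrite Ra. replace (/ (2 * a) * a) with (/ 2) by (field; lra). lra.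
  - intros t Ht _ _. unfold rate_psi. destruct (Pos t) as [P1 _]; [lra|]. specialize (Q t).
    assert (0 < b * phi t * (1 - psi t)) by (apply Rmult_lt_0_compat; [apply Rmult_lt_0_compat|]; lra).
    lra.
Qed.

(** For [c = 3 + b] the exponential [exp (t - a)] is a strict supersolution of
    both equations; the two ratios to it are bounded one after the other. *)
Lemma truncated_speed_large {r b D a phi p psi q} :
  1 < r -> 0 < b -> 0 < a -> truncated r b (3 + b) D a phi p psi q -> psi 0 <= exp (- a).
Proof.
  intros Hr Hb Ha [J1 J2 C1 C2 B1 B2 L1 R1].
  destruct (L1 (- a) ltac:(lra)) as [La1 La2]. destruct (R1 a ltac:(lra)) as [Ra1 Ra2].
  assert (Ce : forall u t, continuous u t -> continuous (fun t => u t * exp (-1 * t)) t).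
  { intros u t Hu. apply (continuous_mult u); [exact Hu|]. eapply derive_continuous, is_derive_exp_lin. }
  assert (Hphi : forall t, - a <= t <= a -> phi t * exp (-1 * t) <= exp (- a)).
  { apply (max_principle (exp (- a)) (jet_mul_exp (-1) J1)).
    - intros t _. apply Ce; auto.
    - rewrite La1, Rmult_0_l. left; apply exp_pos.
    - rewrite Ra1, Rmult_1_l. apply exp_le. lra.
    - intros t Ht Hpos Hd. unfold rate_phi. pose proof (exp_pos (-1 * t)). pose proof (exp_pos (- a)).
      assert (Hphi : 0 < phi t) by nra.
      assert (E : p t = phi t) by (apply Rmult_integral in Hd; destruct Hd; lra).
      apply Rmult_lt_0_compat; [|auto]. rewrite E.
      pose proof (reaction_phi_lower r (phi t) (psi (t - D)) Hr (B1 t) (B2 _)). nra. }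
  assert (Hpsi : psi 0 * exp (-1 * 0) <= exp (- a)).
  { apply (max_principle (exp (- a)) (jet_mul_exp (-1) J2)); try lra.
    - intros t _. apply Ce; auto.
    - rewrite La2, Rmult_0_l. left; apply exp_pos.
    - rewrite Ra2, Rmult_1_l. apply exp_le. lra.
    - intros t Ht Hpos Hd. unfold rate_psi. pose proof (exp_pos (-1 * t)). pose proof (exp_pos (- a)).
      assert (Hp0 : 0 < psi t) by nra.
      assert (E : q t = psi t) by (apply Rmult_integral in Hd; destruct Hd; lra).
      assert (Hlt : phi t < psi t).
      { apply Rmult_lt_reg_r with (exp (-1 * t)); [auto|]. specialize (Hphi t). lra. }
      apply Rmult_lt_0_compat; [|auto]. rewrite E.
      pose proof (reaction_psi_nonneg b (phi t) (psi t) Hb (B1 t) (B2 t)). nra. }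
  rewrite Rmult_0_r, exp_0, Rmult_1_r in Hpsi. exact Hpsi.
Qed.

Lemma sequence_choice {X : Type} (P : nat -> X -> Prop) :
  (forall n, exists x, P n x) -> exists f : nat -> X, forall n, P n (f n).
Proof.
  intros H. exists (fun n => proj1_sig (constructive_indefinite_description _ (H n))).
  intros n. destruct constructive_indefinite_description; auto.
Qed.

Definition profiles : Type := ((R -> R) * (R -> R)) * ((R -> R) * (R -> R)).

Definition truncated_profiles (r b h a c : R) (w : profiles) : Prop :=
  truncated r b c (c * h) a (fst (fst w)) (snd (fst w)) (fst (snd w)) (snd (snd w)).

(** Continuous dependence on [c]. *)
Lemma truncated_limit r b h a (c : nat -> R) (w : nat -> profiles) (c' : R) :
  1 < r -> 0 < b -> 1 <= a ->
  (forall n, 0 <= c n <= 3 + b /\ truncated_profiles r b h a (c n) (w n)) ->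
  ulim c c' ->
  exists w', truncated_profiles r b h a c' w' /\
    ulim (fun n => fst (snd (w n)) 0) (fst (snd w') 0).
Proof.
  intros Hr Hb Ha Hn Hc.
  set (M := 4 + r + 2 * b). assert (HM : 0 <= M) by (unfold M; lra).
  assert (HD : ulim (fun n => c n * h) (c' * h)) by (apply ulim_mult; [auto|apply ulim_const]).
  assert (HU : ultra (fun n => Rabs (c n) <= 3 + b /\
     lip_system r b (c n) (c n * h) M (- a) a (fst (fst (w n))) (snd (fst (w n))) (fst (snd (w n))) (snd (snd (w n))))).
  { apply ultra_all. intros n. destruct (Hn n) as [Hcn Tn]. split; [rewrite Rabs_pos_eq; lra|].
    apply truncated_lip; auto. }
  assert (L := lip_system_ultralimit r b M (- a) a (3 + b) c' (c' * h) c (fun n => c n * h)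
    (fun n => fst (fst (w n))) (fun n => snd (fst (w n))) (fun n => fst (snd (w n))) (fun n => snd (snd (w n)))
    Hr Hb HM ltac:(lra) HU Hc HD).
  assert (T := fun n => proj2 (Hn n)).
  assert (Lf : forall t, ulim (fun n => fst (fst (w n)) t) (ultralimit (fun n => fst (fst (w n)) t))).
  { intros t. apply ultralimit_unit, ultra_all. intros n. apply (tr_phi_bound (T n)). }
  assert (Lg : forall t, ulim (fun n => fst (snd (w n)) t) (ultralimit (fun n => fst (snd (w n)) t))).
  { intros t. apply ultralimit_unit, ultra_all. intros n. apply (tr_psi_bound (T n)). }
  assert (Leq : forall (v : nat -> R) l k, ulim v l -> (forall n, v n = k) -> l = k).
  { intros v l k Hv Hk. apply (ulim_unique v); [auto|]. apply (ulim_ext (fun _ => k)); [|apply ulim_const].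
    apply ultra_all. intros n. symmetry. apply Hk. }
  exists ((fun t => ultralimit (fun n => fst (fst (w n)) t), fun t => ultralimit (fun n => snd (fst (w n)) t)),
          (fun t => ultralimit (fun n => fst (snd (w n)) t), fun t => ultralimit (fun n => snd (snd (w n)) t))).
  split; [|apply Lg]. destruct L as [J1 J2 _ B1 B2 L1 L2].
  constructor; simpl; auto.
  - apply (lip_continuous M); auto.
  - apply (lip_continuous M); auto.
  - intros t Ht. split; [apply (Leq _ _ _ (Lf t))|apply (Leq _ _ _ (Lg t))]; intros n; apply (tr_left (T n)); auto.
  - intros t Ht. split; [apply (Leq _ _ _ (Lf t))|apply (Leq _ _ _ (Lg t))]; intros n; apply (tr_right (T n)); auto.
Qed.

(** Continuity method for the speed. Solutions depend on [c] continuously, by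
    compactness and uniqueness: at the supremum of the speeds with
    [psi 0 >= (r - 1) / (2 r)], the limits from inside and from outside this
    set are the same solution. *)
Lemma truncated_level r b h a :
  1 < r -> 0 < b -> 0 <= h -> 1 <= a -> exp (- a) < (r - 1) / (2 * r) ->
  exists c w, 0 <= c <= 3 + b /\ truncated_profiles r b h a c w /\ fst (snd w) 0 = (r - 1) / (2 * r).
Proof.
  intros Hr Hb Hh Ha Hexp. set (th := (r - 1) / (2 * r)) in *.
  assert (Ha0 : 0 < a) by lra.
  assert (Hth : th < 1 / 2).
  { unfold th. apply Rmult_lt_reg_r with (2 * r); [lra|]. unfold Rdiv. rewrite Rmult_assoc, Rinv_l; lra. }
  assert (Hex : forall c, 0 <= c -> exists w, truncated_profiles r b h a c w).
  { intros c Hc. destruct (truncated_exists r b c (c * h) a Hr Hb Hc Ha) as [f [p [g [q T]]]].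
    exists ((f, p), (g, q)). exact T. }
  set (S := fun c => 0 <= c <= 3 + b /\ exists w, truncated_profiles r b h a c w /\ th <= fst (snd w) 0).
  assert (S0 : S 0).
  { split; [lra|]. destruct (Hex 0) as [w Hw]; [lra|]. exists w. split; [auto|].
    pose proof (truncated_speed_zero Hr Hb Ha0 Hw). lra. }
  assert (Slarge : ~ S (3 + b)).
  { intros [_ [w [Hw Hle]]]. pose proof (truncated_speed_large Hr Hb Ha0 Hw). lra. }
  destruct (completeness S) as [c' [Hub Hlub]].
  { exists (3 + b). intros c [Hc _]; lra. } { exists 0; exact S0. }
  assert (Hc0 : 0 <= c') by (apply Hub; exact S0).
  assert (Hc1 : c' <= 3 + b) by (apply Hlub; intros c [Hc _]; lra).
  assert (Hinv : forall n, 0 < / (INR n + 1)).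
  { intros n. apply Rinv_0_lt_compat. pose proof (pos_INR n). lra. }
  (* speeds in [S] converging to [c'] *)
  assert (HA : exists w, truncated_profiles r b h a c' w /\ th <= fst (snd w) 0).
  { destruct (sequence_choice (fun n (x : R * profiles) => c' - / (INR n + 1) < fst x <= c' /\ 0 <= fst x <= 3 + b /\
       truncated_profiles r b h a (fst x) (snd x) /\ th <= fst (snd (snd x)) 0)) as [x Hx].
    { intros n. apply NNPP; intros Hno. assert (c' <= c' - / (INR n + 1)); [|specialize (Hinv n); lra].
      apply Hlub. intros c Hc. apply Rnot_lt_le; intros Hlt. assert (c <= c') by (apply Hub; auto).
      destruct Hc as [Hc [w [Hw1 Hw2]]]. apply Hno. exists (c, w). simpl.
      split; [lra|]. split; [lra|]. split; [exact Hw1|exact Hw2]. }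
    destruct (truncated_limit r b h a (fun n => fst (x n)) (fun n => snd (x n)) c') as [w [Hw1 Hw2]]; auto.
    - intros n. split; apply Hx.
    - apply (ulim_squeeze _ _ _ ulim_inv_nat). apply ultra_all. intros n. destruct (Hx n) as [H _].
      apply Rabs_le; lra.
    - exists w. split; [auto|]. apply (ulim_le (fun _ => th) (fun n => fst (snd (snd (x n))) 0)); [apply ulim_const|auto|].
      apply ultra_all. intros n. apply Hx. }
  assert (Hc2 : c' < 3 + b).
  { destruct Hc1 as [H|H]; [auto|]. exfalso. apply Slarge. rewrite <- H. split; [lra|exact HA]. }
  (* speeds outside [S] converging to [c'] *)
  assert (HB : exists w, truncated_profiles r b h a c' w /\ fst (snd w) 0 <= th).
  { set (cn := fun n => c' + (3 + b - c') * / (INR n + 1)).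
    assert (Hcn : forall n, c' < cn n <= 3 + b).
    { intros n. unfold cn. specialize (Hinv n). assert (/ (INR n + 1) <= 1).
      { rewrite <- Rinv_1. apply Rinv_le_contravar; [lra|]. pose proof (pos_INR n). lra. }
      nra. }
    destruct (sequence_choice (fun n (w : profiles) => truncated_profiles r b h a (cn n) w /\ fst (snd w) 0 <= th)) as [w Hw].
    { intros n. specialize (Hcn n). destruct (Hex (cn n)) as [w Hw]; [lra|]. exists w. split; [auto|].
      apply Rnot_lt_le; intros Hlt. assert (cn n <= c'); [|lra]. apply Hub. split; [lra|]. exists w. split; [auto|lra]. }
    destruct (truncated_limit r b h a cn w c') as [w' [Hw1 Hw2]]; auto.
    - intros n. specialize (Hcn n). split; [lra|apply Hw].
    - assert (E : ulim cn (c' + (3 + b - c') * 0)).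
      { apply ulim_plus; [apply ulim_const|]. apply ulim_scal. apply ulim_inv_nat. }
      rewrite Rmult_0_r, Rplus_0_r in E. exact E.
    - exists w'. split; [auto|]. apply (ulim_le (fun n => fst (snd (w n)) 0) (fun _ => th)); [auto|apply ulim_const|].
      apply ultra_all. intros n. apply Hw. }
  destruct HA as [w1 [T1 H1]]. destruct HB as [w2 [T2 H2]].
  exists c', w1. split; [lra|]. split; [auto|]. fold th.
  assert (HD : 0 <= c' * h) by (apply Rmult_le_pos; auto).
  destruct (truncated_le r b c' (c' * h) a _ _ _ _ _ _ _ _ Hr Hb Ha0 HD T1 T2 0) as [_ Hle].
  lra.
Qed.

(** A concave nondecreasing function that is bounded on a left half-line is
    constant there. *)
Lemma concave_left (u p s : R -> R) (y : R) :
  (forall x, jet x y u p s) ->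
  (forall t, t < y -> s t <= 0) -> (forall t, t < y -> 0 <= p t) -> (forall t, 0 <= u t <= 1) ->
  forall t, t < y -> p t = 0 /\ s t = 0.
Proof.
  intros J Hs Hp Hu.
  assert (D1 : forall t, t < y -> is_derive u t (p t)) by (intros t Ht; destruct (J (t - 1) t); [lra|auto]).
  assert (D2 : forall t, t < y -> is_derive p t (s t)) by (intros t Ht; destruct (J (t - 1) t); [lra|auto]).
  assert (H0 : forall t, t < y -> p t = 0).
  { intros t Ht. apply Rle_antisym; [|auto]. apply Rnot_lt_le; intros Hpos.
    apply (no_steep_run u p (t - 2 / p t) (p t) Hpos Hu). intros z Hz. split; [apply D1; lra|].
    assert (p t - p z <= 0 * (t - z)); [|lra].
    apply (slope_le p s); [lra| |].
    - intros v Hv. eapply derive_continuous. apply D2; lra.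
    - intros v Hv. split; [apply D2; lra|apply Hs; lra]. }
  intros t Ht. split; [auto|].
  assert (Hz : is_derive p t 0).
  { apply (is_derive_ext_open (fun _ => 0) p (t - 1) y); [lra| |apply @is_derive_const].
    intros v Hv. symmetry. apply H0; lra. }
  rewrite <- (is_derive_unique _ _ _ (D2 t Ht)). apply is_derive_unique. exact Hz.
Qed.

Lemma derive_zero_const (u p : R -> R) (y : R) :
  (forall t, t < y -> is_derive u t (p t)) -> (forall t, t < y -> p t = 0) ->
  forall s t, s < y -> t < y -> u s = u t.
Proof.
  intros Hd Hz.
  assert (G : forall s t, s < t -> t < y -> u s = u t).
  { intros s t Hst Ht. destruct (mean_value u p s t Hst) as [z [Hzz E]].
    - intros v Hv. apply Hd; lra.
    - intros v Hv. eapply derive_continuous. apply Hd; lra.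
    - rewrite Hz in E by lra. lra. }
  intros s t Hs Ht. destruct (Rtotal_order s t) as [H|[->|H]]; [auto|auto|]. symmetry. auto.
Qed.

Lemma monotone_limit (u : R -> R) :
  (forall s t, s <= t -> u s <= u t) -> (forall t, 0 <= u t <= 1) ->
  exists L, (forall t, u t <= L) /\ (forall eps, 0 < eps -> exists y, forall t, y <= t -> L - eps < u t).
Proof.
  intros Hm Hb.
  destruct (completeness (fun x => exists t, x = u t)) as [L [H1 H2]].
  - exists 1. intros x [t ->]. apply Hb.
  - exists (u 0), 0. reflexivity.
  - exists L. split; [intros t; apply H1; exists t; auto|].
    intros eps He. apply NNPP; intros Hno.
    assert (L <= L - eps); [|lra]. apply H2. intros x [t ->]. apply Rnot_lt_le; intros Hlt.
    apply Hno. exists t. intros s Hs. apply Rlt_le_trans with (u t); auto.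
Qed.

Lemma ulim_translates (u : R -> R) (L t : R) :
  (forall t, u t <= L) -> (forall eps, 0 < eps -> exists y, forall t, y <= t -> L - eps < u t) ->
  ulim (fun n => u (t + INR n)) L.
Proof.
  intros H1 H2 eps He. destruct (H2 eps He) as [y Hy].
  destruct (INR_unbounded (Rabs (y - t))) as [N HN].
  apply (ultra_mono _ _ (ultra_ge N)). intros n Hn. apply le_INR in Hn.
  pose proof (Rle_abs (y - t)). specialize (Hy (t + INR n) ltac:(lra)). specialize (H1 (t + INR n)).
  apply Rabs_def1; lra.
Qed.

(** The translates by [n] of a monotone solution converge to a constant
    solution of the same system. *)
Lemma constant_equilibrium r b c D M phi p psi q L K :
  1 < r -> 0 < b -> 0 <= M -> 0 <= c ->
  (forall x y, lip_system r b c D M x y phi p psi q) ->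
  (forall t, ulim (fun n => phi (t + INR n)) L) -> (forall t, ulim (fun n => psi (t + INR n)) K) ->
  L * (1 - r - L + r * K) = 0 /\ b * L * (1 - K) = 0.
Proof.
  intros Hr Hb HM Hc HS HL HK.
  set (f := fun t => ultralimit (fun n => phi (t + INR n))).
  set (g := fun t => ultralimit (fun n => psi (t + INR n))).
  set (pf := fun t => ultralimit (fun n => p (t + INR n))).
  set (pg := fun t => ultralimit (fun n => q (t + INR n))).
  assert (W : lip_system r b c D M (-1) 1 f pf g pg).
  { apply (lip_system_ultralimit r b M (-1) 1 c c D (fun _ => c) (fun _ => D)
     (fun n t => phi (t + INR n)) (fun n t => p (t + INR n)) (fun n t => psi (t + INR n)) (fun n t => q (t + INR n)));
     auto; try apply ulim_const.
    apply ultra_all. intros n. split; [rewrite Rabs_pos_eq; lra|]. apply lip_system_shift, HS. }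
  assert (Ef : forall t, f t = L).
  { intros t. apply (ulim_unique (fun n => phi (t + INR n))); [|auto].
    apply ultralimit_unit, ultra_all. intros n. apply (ls_phi_bound (HS 0 0)). }
  assert (Eg : forall t, g t = K).
  { intros t. apply (ulim_unique (fun n => psi (t + INR n))); [|auto].
    apply ultralimit_unit, ultra_all. intros n. apply (ls_psi_bound (HS 0 0)). }
  assert (Z : forall (u v s : R -> R) (k : R), jet (-1) 1 u v s -> (forall t, u t = k) -> v 0 = 0 /\ s 0 = 0).
  { intros u v s k J Hk.
    assert (Hv : forall t, -1 < t < 1 -> v t = 0).
    { intros t Ht. destruct (J t Ht) as [D1 _]. rewrite <- (is_derive_unique _ _ _ D1).
      rewrite (Derive_ext u (fun _ => k)); [apply Derive_const|auto]. }
    split; [apply Hv; lra|]. destruct (J 0) as [_ D2]; [lra|].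
    rewrite <- (is_derive_unique _ _ _ D2). apply is_derive_unique.
    apply (is_derive_ext_open (fun _ => 0) v (-1) 1); [lra| |apply @is_derive_const].
    intros t Ht. symmetry. auto. }
  destruct (Z _ _ _ L (ls_phi_jet W) Ef) as [Z1 Z3]. destruct (Z _ _ _ K (ls_psi_jet W) Eg) as [Z2 Z4].
  unfold rate_phi in Z3. unfold rate_psi in Z4. rewrite Ef, Eg, Z1 in Z3. rewrite Ef, Eg, Z2 in Z4. lra.
Qed.

Lemma truncated_decay {r b c D a phi p psi q} :
  1 < r -> 0 < b -> 0 < c -> 0 < a -> 0 <= D ->
  truncated r b c D a phi p psi q -> psi 0 = (r - 1) / (2 * r) ->
  forall t, t <= 0 -> phi t <= exp (c * t) /\ psi t <= (1 + 4 * b / (c * c)) * exp (c / 2 * t).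
Proof.
  intros Hr Hb Hc Ha HD T Hth. assert (Mono := truncated_psi_mono Hb Ha T).
  destruct T as [J1 J2 C1 C2 B1 B2 L1 _].
  destruct (L1 (- a) ltac:(lra)) as [La1 La2].
  assert (Hphi : forall t, - a <= t <= 0 -> phi t <= exp (c * (t - 0))).
  { intros t Ht. assert (phi t <= exp (c * (t - 0)) + 0); [|lra].
    apply (phi_decay r c D (- a) 0 0 phi p psi); auto; try lra.
    - intros s Hs. apply J1; lra.
    - intros s Hs. rewrite <- Hth. apply Mono; lra. }
  intros t Ht. destruct (Rle_dec t (- a)) as [H|H].
  - destruct (L1 t H) as [-> ->]. pose proof (exp_pos (c * t)). pose proof (exp_pos (c / 2 * t)).
    assert (0 < 4 * b / (c * c)) by (apply Rdiv_lt_0_compat; nra). split; [lra|]. nra.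
  - split.
    + specialize (Hphi t). rewrite Rminus_0_r in Hphi. apply Hphi; lra.
    + assert (psi t <= (1 + 4 * b / (c * c)) * exp (c / 2 * (t - 0)) + 0); [|rewrite Rminus_0_r in *; lra].
      apply (psi_decay b c (- a) 0 0 phi psi q); auto; try lra.
      intros s Hs. apply J2; lra.
Qed.

Lemma intermediate_value (u : R -> R) (x y k : R) :
  x < y -> (forall t, continuous u t) -> u x < k < u y -> exists z, x < z < y /\ u z = k.
Proof.
  intros Hxy Hc Hk.
  destruct (IVT (fun t => u t - k) x y) as [z [Hz E]]; try lra.
  - intros t. apply (continuity_pt_minus u (fun _ => k)); [apply continuity_pt_filterlim, Hc|].
    apply continuity_pt_const. intros s s'; reflexivity.
  - exists z. assert (z <> x) by (intros ->; lra). assert (z <> y) by (intros ->; lra).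
    split; lra.
Qed.

(** Normalising the second component, at a level where [phi = 0] is stable,
    keeps the limit from losing mass at [- oo] and from being trivial. *)
Record approximation (r b h : R) (a c : nat -> R) (f pf g pg : nat -> R -> R) : Prop := {
  ap_width : forall n, 1 <= a n /\ INR n <= a n;
  ap_speed : forall n, 0 <= c n <= 3 + b;
  ap_truncated : forall n, truncated r b (c n) (c n * h) (a n) (f n) (pf n) (g n) (pg n);
  ap_level : forall n, g n 0 = (r - 1) / (2 * r) }.
Arguments ap_width {r b h a c f pf g pg}.
Arguments ap_speed {r b h a c f pf g pg}.
Arguments ap_truncated {r b h a c f pf g pg}.
Arguments ap_level {r b h a c f pf g pg}.

Lemma approximation_exists r b h :
  1 < r -> 0 < b -> 0 <= h -> exists a c f pf g pg, approximation r b h a c f pf g pg.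
Proof.
  intros Hr Hb Hh. set (th := (r - 1) / (2 * r)).
  destruct (exp_small_left 1 th) as [x0 Hx0]; [lra|unfold th; apply Rdiv_lt_0_compat; lra|].
  set (a := fun n => INR n + 1 + Rabs x0).
  assert (Ha : forall n, 1 <= a n /\ INR n <= a n).
  { intros n. unfold a. pose proof (pos_INR n). pose proof (Rabs_pos x0). lra. }
  destruct (sequence_choice (fun n (x : R * profiles) => 0 <= fst x <= 3 + b /\
     truncated_profiles r b h (a n) (fst x) (snd x) /\ fst (snd (snd x)) 0 = th)) as [x Hx].
  { intros n. destruct (truncated_level r b h (a n) Hr Hb Hh (proj1 (Ha n))) as [c [w Hw]].
    - replace (- a n) with (1 * - a n) by ring. apply Hx0.
      unfold a. pose proof (pos_INR n). pose proof (Rle_abs (- x0)). rewrite Rabs_Ropp in *. lra.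
    - exists (c, w). exact Hw. }
  exists a, (fun n => fst (x n)), (fun n => fst (fst (snd (x n)))), (fun n => snd (fst (snd (x n)))),
    (fun n => fst (snd (snd (x n)))), (fun n => snd (snd (snd (x n)))).
  constructor; [exact Ha|apply Hx|intros n; destruct (Hx n) as [_ [H _]]; exact H|intros n; apply Hx].
Qed.

Lemma approximation_covers {r b h a c f pf g pg} :
  approximation r b h a c f pf g pg ->
  forall y z, ultra (fun n => - a n <= y + 0 /\ z + 0 <= a n).
Proof.
  intros AP y z. destruct (INR_unbounded (Rabs y + Rabs z)) as [N HN].
  apply (ultra_mono _ _ (ultra_ge N)). intros n Hn. apply le_INR in Hn. pose proof (ap_width AP n).
  pose proof (Rle_abs z). pose proof (Rle_abs (- y)). rewrite Rabs_Ropp in *.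
  pose proof (Rabs_pos y). pose proof (Rabs_pos z). lra.
Qed.

Lemma approximation_speed_limit {r b h a c f pf g pg} :
  0 < b -> approximation r b h a c f pf g pg -> ulim c (ultralimit c).
Proof.
  intros Hb AP. apply (ultralimit_spec c (3 + b)), ultra_all. intros n.
  pose proof (ap_speed AP n). rewrite Rabs_pos_eq; lra.
Qed.

Definition translates_limit (u : nat -> R -> R) (s : nat -> R) (t : R) : R :=
  ultralimit (fun n => u n (t + s n)).

Lemma approximation_profiles {r b h a c f pf g pg} (s : nat -> R) :
  1 < r -> 0 < b -> approximation r b h a c f pf g pg ->
  (forall t, ulim (fun n => f n (t + s n)) (translates_limit f s t)) /\
  (forall t, ulim (fun n => g n (t + s n)) (translates_limit g s t)) /\
  (forall t v, t <= v -> translates_limit f s t <= translates_limit f s v) /\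
  (forall t v, t <= v -> translates_limit g s t <= translates_limit g s v).
Proof.
  intros Hr Hb [Ha _ T _].
  assert (Hap : forall n, 0 < a n) by (intros n; specialize (Ha n); lra).
  assert (Lf : forall t, ulim (fun n => f n (t + s n)) (translates_limit f s t)).
  { intros t. apply ultralimit_unit, ultra_all. intros n. apply (tr_phi_bound (T n)). }
  assert (Lg : forall t, ulim (fun n => g n (t + s n)) (translates_limit g s t)).
  { intros t. apply ultralimit_unit, ultra_all. intros n. apply (tr_psi_bound (T n)). }
  split; [exact Lf|]. split; [exact Lg|]. split; intros t v Htv.
  - apply (ulim_le _ _ _ _ (Lf t) (Lf v)), ultra_all. intros n.
    apply (truncated_phi_mono Hr Hb (Hap n) (T n)); lra.
  - apply (ulim_le _ _ _ _ (Lg t) (Lg v)), ultra_all. intros n.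
    apply (truncated_psi_mono Hb (Hap n) (T n)); lra.
Qed.

Lemma approximation_limit {r b h a c f pf g pg} (s : nat -> R) (y z : R) :
  1 < r -> 0 < b -> approximation r b h a c f pf g pg ->
  ultra (fun n => - a n <= y + s n /\ z + s n <= a n) ->
  lip_system r b (ultralimit c) (ultralimit c * h) (4 + r + 2 * b) y z
    (translates_limit f s) (translates_limit pf s) (translates_limit g s) (translates_limit pg s).
Proof.
  intros Hr Hb AP HU. assert (Lc := approximation_speed_limit Hb AP). destruct AP as [Ha Hc T _].
  apply (lip_system_ultralimit r b (4 + r + 2 * b) y z (3 + b) _ _ c (fun n => c n * h)
    (fun n t => f n (t + s n)) (fun n t => pf n (t + s n)) (fun n t => g n (t + s n)) (fun n t => pg n (t + s n)));
    auto; try lra.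
  - apply (ultra_mono _ _ HU). intros n [H1 H2]. split; [specialize (Hc n); rewrite Rabs_pos_eq; lra|].
    apply lip_system_shift. apply (lip_system_restrict (y + s n) (z + s n) H1 H2).
    apply truncated_lip; auto. apply Ha.
  - apply ulim_mult; [auto|apply ulim_const].
Qed.

(** If the speeds tended to 0, the limit of the profiles would have a concave
    bounded second component: constant at the normalisation level, so that the
    first component vanishes. Recentred at the points where the first
    component is 1/2, the profiles would converge on a half-line
    [(- oo, l)] to a pair with second component constant again, hence equal
    to 1; then the first component is concave, hence constant, and 1/2 is not an
    equilibrium value. *)
Lemma approximation_speed_pos {r b h a c f pf g pg} :
  1 < r -> 0 < b -> approximation r b h a c f pf g pg -> 0 < ultralimit c.
Proof.
  intros Hr Hb AP.
  assert (HS := fun y z => approximation_limit (fun _ => 0) y z Hr Hb AP (approximation_covers AP y z)).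
  destruct (approximation_profiles (fun _ => 0) Hr Hb AP) as [Lf [Lg [Mf Mg]]].
  assert (HT := ap_truncated AP).
  assert (Ha1 : forall n, 1 <= a n) by (intros n; apply (ap_width AP n)).
  set (M := 4 + r + 2 * b) in *. assert (HM : 0 < M) by (unfold M; lra).
  assert (Hc0 : 0 <= ultralimit c).
  { apply (ulim_le (fun _ => 0) c _ _ (ulim_const 0) (approximation_speed_limit Hb AP)), ultra_all. intros n. apply (ap_speed AP n). }
  destruct Hc0 as [H|Hz]; [exact H|exfalso]. rewrite <- Hz in *.
  (* a common step: for [c = 0] the second component is constant *)
  assert (Hconst : forall u p v q y, (forall x, lip_system r b 0 (0 * h) M x y u p v q) ->
     (forall s t, s <= t -> v s <= v t) -> forall t, t < y -> q t = 0 /\ b * u t * (1 - v t) = 0).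
  { intros u p v q y HSy Mv t Ht.
    destruct (concave_left v q (rate_psi b 0 u v q) y (fun x => ls_psi_jet (HSy x))) with (t := t) as [E1 E2]; auto.
    - intros z _. unfold rate_psi.
      pose proof (reaction_psi_nonneg b (u z) (v z) Hb (ls_phi_bound (HSy 0) z) (ls_psi_bound (HSy 0) z)). lra.
    - intros z Hzy. apply (increasing_derive_nonneg v z); [auto|]. destruct (ls_psi_jet (HSy (z - 1)) z); [lra|auto].
    - apply (ls_psi_bound (HSy 0)).
    - split; [exact E1|]. unfold rate_psi in E2. lra. }
  assert (Hth : (r - 1) / (2 * r) < 1).
  { apply Rmult_lt_reg_r with (2 * r); [lra|]. unfold Rdiv. rewrite Rmult_assoc, Rinv_l; lra. }
  assert (Phi0 : translates_limit f (fun _ => 0) 0 = 0).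
  { destruct (Hconst _ _ _ _ 1 (fun x => HS x 1) Mg 0 ltac:(lra)) as [_ E].
    assert (Epsi : translates_limit g (fun _ => 0) 0 = (r - 1) / (2 * r)).
    { apply (ulim_unique _ _ _ (Lg 0)). apply (ulim_ext (fun _ => (r - 1) / (2 * r))); [|apply ulim_const].
      apply ultra_all. intros n. rewrite Rplus_0_l. symmetry. apply (ap_level AP). }
    rewrite Epsi in E. apply Rmult_integral in E. destruct E as [E|E]; [|lra].
    apply Rmult_integral in E. destruct E; [lra|auto]. }
  destruct (sequence_choice (fun n s => - a n < s < a n /\ f n s = 1 / 2)) as [s Hs].
  { intros n. specialize (Ha1 n). apply intermediate_value; [lra|apply (tr_phi_cont (HT n))|].
    destruct (tr_left (HT n) (- a n) ltac:(lra)) as [-> _].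
    destruct (tr_right (HT n) (a n) ltac:(lra)) as [-> _]. lra. }
  assert (Hs0 : ultra (fun n => 0 < s n)).
  { apply (ultra_mono _ _ (Lf 0 (1 / 4) ltac:(lra))). intros n H. rewrite Phi0 in H. apply Rabs_def2 in H.
    apply Rnot_le_lt; intros Hle. assert (Han : 0 < a n) by (specialize (Ha1 n); lra).
    apply (truncated_phi_mono Hr Hb Han (HT n)) in Hle. destruct (Hs n) as [_ E].
    rewrite Rplus_0_l in H. lra. }
  set (l := / (2 * M)).
  assert (Hl : 0 < l) by (unfold l; apply Rinv_0_lt_compat; lra).
  (* by the slope bound the right end stays at distance [l] from the new centre *)
  assert (Hsl : forall n, l <= a n - s n).
  { intros n. destruct (Hs n) as [H1 H2].
    assert (HLp := ls_phi_lip (truncated_lip Hr Hb (ap_speed AP n) (Ha1 n) (HT n)) (a n) (s n)).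
    destruct (tr_right (HT n) (a n) ltac:(lra)) as [E _].
    rewrite E, H2, !Rabs_pos_eq in HLp by lra. fold M in HLp.
    apply Rmult_le_reg_l with M; [auto|]. unfold l. replace (M * / (2 * M)) with (1 - 1 / 2) by (field; lra). exact HLp. }
  assert (Hwin2 : forall y, ultra (fun n => - a n <= y + s n /\ l + s n <= a n)).
  { intros y. destruct (INR_unbounded (Rabs y)) as [N HN].
    apply (ultra_mono2 _ _ _ (ultra_ge N) Hs0). intros n Hn Hsn. apply le_INR in Hn.
    pose proof (ap_width AP n). pose proof (Rle_abs (- y)). rewrite Rabs_Ropp in *. specialize (Hsl n). lra. }
  assert (HS2 := fun y => approximation_limit s y l Hr Hb AP (Hwin2 y)). rewrite <- Hz in HS2. fold M in HS2.
  destruct (approximation_profiles s Hr Hb AP) as [Lf2 [Lg2 [Mf2 Mg2]]].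
  set (f2 := translates_limit f s) in *. set (p2 := translates_limit pf s) in *.
  set (g2 := translates_limit g s) in *. set (q2 := translates_limit pg s) in *.
  assert (F0 : f2 0 = 1 / 2).
  { apply (ulim_unique _ _ _ (Lf2 0)). apply (ulim_ext (fun _ => 1 / 2)); [|apply ulim_const].
    apply ultra_all. intros n. rewrite Rplus_0_l. symmetry; apply Hs. }
  assert (Z2 := Hconst f2 p2 g2 q2 l HS2 Mg2).
  assert (G1 : forall t, t < l -> g2 t = 1).
  { intros t Ht. rewrite (derive_zero_const g2 q2 l) with (t := 0); auto.
    - destruct (Z2 0 Hl) as [_ H]. rewrite F0 in H. apply Rmult_integral in H. destruct H; lra.
    - intros u Hu. destruct (ls_psi_jet (HS2 (u - 1)) u); [lra|auto].
    - intros u Hu. apply Z2; auto. }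
  destruct (concave_left f2 p2 (rate_phi r 0 (0 * h) f2 p2 g2) l (fun x => ls_phi_jet (HS2 x))) with (t := 0)
    as [_ H]; auto.
  - intros t Ht. unfold rate_phi. rewrite (G1 (t - 0 * h)) by lra.
    pose proof (ls_phi_bound (HS2 0) t). nra.
  - intros t Ht. apply (increasing_derive_nonneg f2 t); [auto|]. destruct (ls_phi_jet (HS2 (t - 1)) t); [lra|auto].
  - apply (ls_phi_bound (HS2 0)).
  - unfold rate_phi in H. rewrite (G1 (0 - 0 * h)), F0 in H by lra. lra.
Qed.

(** The limit of the approximations. The exponential bounds at [- oo] are
    uniform because the speeds are bounded below; at [+ oo] monotonicity leaves
    only an equilibrium with [phi > 0], and (1, 1) is the only one. *)
Lemma wave_exists r b h :
  1 < r -> 0 < b -> 0 <= h -> exists c phi p psi q, wave r b c (c * h) phi p psi q.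
Proof.
  intros Hr Hb Hh.
  set (th := (r - 1) / (2 * r)).
  assert (Hth0 : 0 < th) by (unfold th; apply Rdiv_lt_0_compat; lra).
  destruct (approximation_exists r b h Hr Hb Hh) as [a [c [f [pf [g [pg AP]]]]]].
  assert (HS := fun y z => approximation_limit (fun _ => 0) y z Hr Hb AP (approximation_covers AP y z)).
  destruct (approximation_profiles (fun _ => 0) Hr Hb AP) as [Lphi [Lpsi [Mphi Mpsi]]].
  assert (Hc' := approximation_speed_pos Hr Hb AP).
  assert (HT := ap_truncated AP).
  assert (Ha1 : forall n, 1 <= a n) by (intros n; apply (ap_width AP n)).
  assert (Lc := approximation_speed_limit Hb AP).
  set (c' := ultralimit c) in *. set (M := 4 + r + 2 * b) in *.
  set (phi := translates_limit f (fun _ => 0)) in *. set (p := translates_limit pf (fun _ => 0)) in *.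
  set (psi := translates_limit g (fun _ => 0)) in *. set (q := translates_limit pg (fun _ => 0)) in *.
  assert (Bphi := ls_phi_bound (HS 0 0)). assert (Bpsi := ls_psi_bound (HS 0 0)).
  assert (J1 := fun y z => ls_phi_jet (HS y z)). assert (J2 := fun y z => ls_psi_jet (HS y z)).
  assert (D3 : forall t, is_derive psi t (q t)) by (intros t; destruct (J2 (t - 1) (t + 1) t); [lra|auto]).
  assert (D4 : forall t, is_derive q t (rate_psi b c' phi psi q t)).
  { intros t; destruct (J2 (t - 1) (t + 1) t); [lra|auto]. }
  assert (Qpos : forall t, 0 <= q t) by (intros t; apply (increasing_derive_nonneg psi t); auto).
  assert (Psi0 : psi 0 = th).
  { apply (ulim_unique _ _ _ (Lpsi 0)). apply (ulim_ext (fun _ => th)); [|apply ulim_const].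
    apply ultra_all. intros n. rewrite Rplus_0_l. symmetry. apply (ap_level AP). }
  set (B := 1 + 4 * b / (c' / 2 * (c' / 2))).
  assert (Hclow : ultra (fun n => c' / 2 < c n)).
  { apply (ultra_mono _ _ (Lc (c' / 2) ltac:(lra))). intros n H. apply Rabs_def2 in H. lra. }
  assert (Hdec : forall t, t <= 0 -> phi t <= exp (c' / 2 * t) /\ psi t <= B * exp (c' / 4 * t)).
  { intros t Ht.
    assert (G : ultra (fun n => f n (t + 0) <= exp (c' / 2 * t) /\ g n (t + 0) <= B * exp (c' / 4 * t))).
    { apply (ultra_mono _ _ Hclow). intros n Hn. rewrite Rplus_0_r.
      assert (Han : 0 < a n) by (specialize (Ha1 n); lra). assert (Hcn : 0 < c n) by lra.
      assert (HD : 0 <= c n * h) by (apply Rmult_le_pos; lra).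
      destruct (truncated_decay Hr Hb Hcn Han HD (HT n) (ap_level AP n) t Ht) as [G1 G2].
      split.
      - eapply Rle_trans; [exact G1|]. apply exp_le. nra.
      - eapply Rle_trans; [exact G2|]. apply Rmult_le_compat.
        + assert (0 < 4 * b / (c n * c n)) by (apply Rdiv_lt_0_compat; nra). lra.
        + left; apply exp_pos.
        + unfold B. apply Rplus_le_compat_l. unfold Rdiv at 1 2. apply Rmult_le_compat_l; [lra|].
          apply Rinv_le_contravar; nra.
        + apply exp_le. nra. }
    split.
    - apply (ulim_le _ (fun _ => exp (c' / 2 * t)) _ _ (Lphi t) (ulim_const _)).
      apply (ultra_mono _ _ G). intros n H; apply H.
    - apply (ulim_le _ (fun _ => B * exp (c' / 4 * t)) _ _ (Lpsi t) (ulim_const _)).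
      apply (ultra_mono _ _ G). intros n H; apply H. }
  assert (HB : 0 < B).
  { unfold B. assert (0 < 4 * b / (c' / 2 * (c' / 2))) by (apply Rdiv_lt_0_compat; nra). lra. }
  assert (Lft1 : vanishes_left phi).
  { intros eps He. destruct (exp_small_left (c' / 2) eps) as [y Hy]; [lra|auto|].
    exists (Rmin y 0). intros t Ht. pose proof (Rmin_l y 0). pose proof (Rmin_r y 0).
    destruct (Hdec t ltac:(lra)) as [H1 _]. specialize (Hy t). lra. }
  assert (Lft2 : vanishes_left psi).
  { intros eps He. destruct (exp_small_left (c' / 4) (eps / B)) as [y Hy]; [lra|apply Rdiv_lt_0_compat; auto|].
    exists (Rmin y 0). intros t Ht. pose proof (Rmin_l y 0). pose proof (Rmin_r y 0).
    destruct (Hdec t ltac:(lra)) as [_ H1]. specialize (Hy t ltac:(lra)).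
    apply (Rmult_lt_compat_l B) in Hy; [|auto]. replace (B * (eps / B)) with eps in Hy by (field; lra). lra. }
  destruct (monotone_limit phi Mphi Bphi) as [L [L1 L2]].
  destruct (monotone_limit psi Mpsi Bpsi) as [K [K1 K2]].
  destruct (constant_equilibrium r b c' (c' * h) M phi p psi q L K) as [Q1 Q2]; auto; try (unfold M; lra).
  { intros t. apply ulim_translates; auto. } { intros t. apply ulim_translates; auto. }
  (* if [phi] vanished, [psi'] would be nondecreasing, hence 0 *)
  assert (HLnz : L <> 0).
  { intros EL.
    assert (Phiz : forall t, phi t = 0) by (intros t; specialize (L1 t); specialize (Bphi t); lra).
    assert (Qz : forall t, q t = 0).
    { intros t0. apply Rle_antisym; [|auto]. apply Rnot_lt_le; intros Hpos.
      apply (no_steep_run psi q t0 (q t0) Hpos Bpsi). intros t Ht. split; [apply D3|].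
      assert (0 * (t - t0) <= q t - q t0); [|lra].
      apply (slope_ge q (rate_psi b c' phi psi q)); [lra| |].
      - intros u _. exact (derive_continuous _ _ _ (D4 u)).
      - intros u _. split; [apply D4|]. unfold rate_psi. rewrite Phiz. specialize (Qpos u). nra. }
    destruct (Lft2 th Hth0) as [y Hy]. specialize (Hy y ltac:(lra)).
    rewrite (derive_zero_const psi q (Rabs y + 1)) with (t := 0) in Hy; auto; [lra| |].
    - pose proof (Rle_abs y). lra.
    - pose proof (Rabs_pos y). lra. }
  assert (EK : K = 1).
  { rewrite Rmult_assoc in Q2. apply Rmult_integral in Q2. destruct Q2 as [Q2|Q2]; [lra|].
    apply Rmult_integral in Q2. destruct Q2; [tauto|lra]. }
  assert (EL : L = 1).
  { apply Rmult_integral in Q1. destruct Q1; [tauto|]. rewrite EK in *. lra. }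
  rewrite EL in *. rewrite EK in *.
  exists c', phi, p, psi, q. constructor; auto.
Qed.

(** * From wavefronts of the system to wave profiles and back *)

Lemma is_derive_affine (f : R -> R) (n m s l : R) :
  is_derive f (n * s + m) l -> is_derive (fun y => f (n * y + m)) s (n * l).
Proof.
  intros H. apply (is_derive_comp f (fun y => n * y + m) s l n H).
  auto_derive; [auto|ring].
Qed.

Lemma ex_derive_affine_inv (f : R -> R) (n s : R) :
  n <> 0 -> ex_derive (fun y => f (n * y)) (s / n) -> ex_derive f s.
Proof.
  intros Hn [l Hl]. exists (/ n * l).
  apply (is_derive_ext (fun y => f (n * (/ n * y + 0)))).
  - intros y. f_equal. simpl. unfold AbsRing.sort; simpl. field; auto.
  - apply (is_derive_affine (fun y => f (n * y))).
    replace (/ n * s + 0) with (s / n) by (field; auto). exact Hl.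
Qed.

Lemma is_derive_planar (nu : R * R) (c : R) (f p : R -> R) (t : R) (x : R * R) :
  (forall s : R, is_derive f s (p s)) ->
  is_derive (fun s => planar_wave nu c f s x) t (planar_wave nu c (fun s => c * p s) t x) /\
  is_derive (fun s => planar_wave nu c f t (s, snd x)) (fst x) (planar_wave nu c (fun s => fst nu * p s) t x) /\
  is_derive (fun s => planar_wave nu c f t (fst x, s)) (snd x) (planar_wave nu c (fun s => snd nu * p s) t x).
Proof.
  intros H. unfold planar_wave; simpl.
  assert (G : forall (n m y z : R) (u : R -> R), (forall s, u s = n * s + m) -> z = n * y + m ->
    is_derive (fun s => f (u s)) y (n * p z)).
  { intros n m y z u Hu ->. apply (is_derive_ext (fun s => f (n * s + m))).
    - intros s. rewrite Hu. reflexivity.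
    - apply is_derive_affine, H. }
  split; [|split].
  - apply (G c (fst nu * fst x + snd nu * snd x)); intros; ring.
  - apply (G (fst nu) (snd nu * snd x + c * t)); intros; ring.
  - apply (G (snd nu) (fst nu * fst x + c * t)); intros; ring.
Qed.

Lemma planar_derivatives (nu : R * R) (c : R) (f p : R -> R) :
  (forall s : R, is_derive f s (p s)) ->
  dt (planar_wave nu c f) = planar_wave nu c (fun s => c * p s) /\
  dx1 (planar_wave nu c f) = planar_wave nu c (fun s => fst nu * p s) /\
  dx2 (planar_wave nu c f) = planar_wave nu c (fun s => snd nu * p s).
Proof.
  intros H. split; [|split]; apply functional_extensionality; intros t; apply functional_extensionality; intros x;
    apply is_derive_unique; apply (is_derive_planar nu c f p t x H).
Qed.

Lemma planar_jointly_continuous (nu : R * R) (c : R) (f : R -> R) :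
  (forall s : R, continuous f s) -> jointly_continuous (planar_wave nu c f).
Proof.
  intros Hf q. unfold planar_wave.
  apply (continuous_comp
    (fun q : R * (R * R) => fst nu * fst (snd q) + snd nu * snd (snd q) + c * fst q) f); [|apply Hf].
  assert (C1 : continuous (fun q : R * (R * R) => fst (snd q)) q).
  { apply (continuous_comp (fun q : R * (R * R) => snd q) fst); [apply continuous_snd|apply continuous_fst]. }
  assert (C2 : continuous (fun q : R * (R * R) => snd (snd q)) q).
  { apply (continuous_comp (fun q : R * (R * R) => snd q) snd); apply continuous_snd. }
  assert (C3 : continuous (fun q : R * (R * R) => fst q) q) by apply continuous_fst.
  assert (Hs : forall (k : R) (u : R * (R * R) -> R), continuous u q -> continuous (fun q => k * u q) q).
  { intros k u Hu. apply (continuous_mult (fun _ => k) u); [apply continuous_const|exact Hu]. }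
  apply (continuous_plus (fun q : R * (R * R) => fst nu * fst (snd q) + snd nu * snd (snd q)) (fun q => c * fst q)).
  - apply (continuous_plus (fun q : R * (R * R) => fst nu * fst (snd q)) (fun q => snd nu * snd (snd q))); apply Hs; auto.
  - apply Hs; auto.
Qed.

Lemma planar_C1 (nu : R * R) (c : R) (f p : R -> R) :
  (forall s : R, is_derive f s (p s)) -> (forall s : R, continuous p s) ->
  C1_t (planar_wave nu c f) /\ C1_x1 (planar_wave nu c f) /\ C1_x2 (planar_wave nu c f).
Proof.
  intros Hf Hp. destruct (planar_derivatives nu c f p Hf) as [E1 [E2 E3]].
  assert (Hk : forall k, jointly_continuous (planar_wave nu c (fun s => k * p s))).
  { intros k. apply planar_jointly_continuous. intros s. apply continuous_cmul, Hp. }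
  unfold C1_t, C1_x1, C1_x2. rewrite E1, E2, E3.
  split; [|split]; (split; [|apply Hk]); intros t x; eexists; apply (is_derive_planar nu c f p t x Hf).
Qed.

Lemma planar_C12 (nu : R * R) (c : R) (f p s : R -> R) :
  (forall t : R, is_derive f t (p t)) -> (forall t : R, is_derive p t (s t)) -> (forall t : R, continuous s t) ->
  C12 (planar_wave nu c f).
Proof.
  intros Hf Hp Hs.
  assert (Cf : forall t, continuous f t) by (intros t; eapply derive_continuous, Hf).
  assert (Cp : forall t, continuous p t) by (intros t; eapply derive_continuous, Hp).
  destruct (planar_C1 nu c f p Hf Cp) as [A1 [A2 A3]].
  assert (Hk : forall k, C1_x1 (planar_wave nu c (fun t => k * p t)) /\ C1_x2 (planar_wave nu c (fun t => k * p t))).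
  { intros k. apply (planar_C1 nu c (fun t => k * p t) (fun t => k * s t)).
    - intros t. apply is_derive_scal. apply Hp.
    - intros t. apply continuous_cmul, Hs. }
  destruct (planar_derivatives nu c f p Hf) as [_ [E2 E3]]. unfold C12. rewrite E2, E3.
  split; [apply planar_jointly_continuous; auto|].
  split; [exact A1|]. split; [exact A2|]. split; [exact A3|].
  split; [apply Hk|]. split; [apply Hk|]. split; apply Hk.
Qed.

Lemma planar_laplacian (nu : R * R) (c : R) (f p s : R -> R) (t : R) (x : R * R) :
  (forall t : R, is_derive f t (p t)) -> (forall t : R, is_derive p t (s t)) ->
  fst nu ^ 2 + snd nu ^ 2 = 1 ->
  laplacian (planar_wave nu c f) t x = planar_wave nu c s t x.
Proof.
  intros Hf Hp Hnu. unfold laplacian.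
  assert (Hk : forall k t : R, is_derive (fun t => k * p t) t (k * s t)) by (intros; apply is_derive_scal, Hp).
  destruct (planar_derivatives nu c f p Hf) as [_ [-> ->]].
  destruct (planar_derivatives nu c (fun t => fst nu * p t) _ (Hk (fst nu))) as [_ [-> _]].
  destruct (planar_derivatives nu c (fun t => snd nu * p t) _ (Hk (snd nu))) as [_ [_ ->]].
  unfold planar_wave. set (z := s _).
  replace (fst nu * (fst nu * z) + snd nu * (snd nu * z)) with ((fst nu ^ 2 + snd nu ^ 2) * z) by ring.
  rewrite Hnu. ring.
Qed.

(** One of the components of the direction is nonzero; the profile is, up to an
    affine change of variable, the restriction of the field to the
    corresponding coordinate axis. *)
Lemma planar_twice_derivable (nu : R * R) (c : R) (f : R -> R) :
  fst nu ^ 2 + snd nu ^ 2 = 1 -> C12 (planar_wave nu c f) ->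
  (forall t : R, is_derive f t (Derive f t)) /\ (forall t : R, is_derive (Derive f) t (Derive (Derive f) t)).
Proof.
  intros Hnu [_ [_ [[H1 _] [[H2 _] [[H11 _] [_ [_ [H22 _]]]]]]]].
  assert (Axis : exists n, n <> 0 /\
    (forall u, (forall t x, ex_derive (fun s => planar_wave nu c u t (s, snd x)) (fst x)) ->
       (forall t x, ex_derive (fun s => planar_wave nu c u t (fst x, s)) (snd x)) -> forall t, ex_derive u t) /\
    ((forall t : R, is_derive f t (Derive f t)) -> forall t, ex_derive (fun s => n * Derive f s) t)).
  { assert (A1 : fst nu <> 0 -> forall u,
      (forall t x, ex_derive (fun s => planar_wave nu c u t (s, snd x)) (fst x)) -> forall t, ex_derive u t).
    { intros Hn u Hu t. apply (ex_derive_affine_inv u (fst nu) t Hn).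
      apply (ex_derive_ext (fun s => planar_wave nu c u 0 (s, 0))); [|apply (Hu 0 (t / fst nu, 0))].
      intros y. unfold planar_wave; simpl. f_equal. ring. }
    assert (A2 : snd nu <> 0 -> forall u,
      (forall t x, ex_derive (fun s => planar_wave nu c u t (fst x, s)) (snd x)) -> forall t, ex_derive u t).
    { intros Hn u Hu t. apply (ex_derive_affine_inv u (snd nu) t Hn).
      apply (ex_derive_ext (fun s => planar_wave nu c u 0 (0, s))); [|apply (Hu 0 (0, t / snd nu))].
      intros y. unfold planar_wave; simpl. f_equal. ring. }
    destruct (Req_dec (fst nu) 0) as [Hz|Hnz].
    - assert (Hn2 : snd nu <> 0) by (intros E; rewrite Hz, E in Hnu; simpl in Hnu; lra).
      exists (snd nu). split; [exact Hn2|]. split; [intros u _; apply A2, Hn2|].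
      intros E1. destruct (planar_derivatives nu c f (Derive f) E1) as [_ [_ E]].
      rewrite E in H22. apply A2; auto.
    - exists (fst nu). split; [exact Hnz|]. split; [intros u Hu _; apply A1; auto|].
      intros E1. destruct (planar_derivatives nu c f (Derive f) E1) as [_ [E _]].
      rewrite E in H11. apply A1; auto. }
  destruct Axis as [n [Hn [A1 A2]]].
  assert (E1 : forall t : R, is_derive f t (Derive f t)) by (intros t; apply Derive_correct, A1; auto).
  split; [exact E1|]. intros t. apply Derive_correct.
  apply (ex_derive_ext (fun s => / n * (n * Derive f s))).
  - intros s. simpl. unfold AbsRing.sort; simpl. field. exact Hn.
  - apply (ex_derive_scal (fun s => n * Derive f s)). apply A2, E1.
Qed.

Lemma is_lim_left_iff (u : R -> R) :
  (forall t, 0 <= u t <= 1) -> is_lim u m_infty 0 <-> vanishes_left u.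
Proof.
  intros Hu. rewrite <- is_lim_spec. split.
  - intros H eps He. destruct (H (mkposreal eps He)) as [x Hx]. exists (x - 1). intros t Ht.
    specialize (Hx t ltac:(lra)). simpl in Hx. apply Rabs_def2 in Hx. lra.
  - intros H eps. destruct (H eps (cond_pos eps)) as [x Hx]. exists x. intros t Ht.
    specialize (Hx t ltac:(lra)). specialize (Hu t). rewrite Rminus_0_r, Rabs_pos_eq; lra.
Qed.

Lemma is_lim_right_iff (u : R -> R) :
  (forall t, 0 <= u t <= 1) -> is_lim u p_infty 1 <-> tends_to_one_right u.
Proof.
  intros Hu. rewrite <- is_lim_spec. split.
  - intros H eps He. destruct (H (mkposreal eps He)) as [x Hx]. exists (x + 1). intros t Ht.
    specialize (Hx t ltac:(lra)). simpl in Hx. apply Rabs_def2 in Hx. lra.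
  - intros H eps. destruct (H eps (cond_pos eps)) as [x Hx]. exists x. intros t Ht.
    specialize (Hx t ltac:(lra)). specialize (Hu t). rewrite Rabs_left1; lra.
Qed.

Lemma wave_of_wavefront b r h c nu phi psi :
  is_wavefront b r h c nu phi psi -> wave r b c (c * h) phi (Derive phi) psi (Derive psi).
Proof.
  intros [Hnu [[Hu [Hv [_ [E1 E2]]]] [Hb [L1 [L2 [R1 R2]]]]]].
  destruct (planar_twice_derivable nu c phi Hnu Hu) as [P1 P2].
  destruct (planar_twice_derivable nu c psi Hnu Hv) as [Q1 Q2].
  destruct (planar_derivatives nu c phi _ P1) as [T1 _]. destruct (planar_derivatives nu c psi _ Q1) as [T2 _].
  assert (Harg : forall t : R, fst nu * (fst nu * t) + snd nu * (snd nu * t) = t).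
  { intros t. replace (fst nu * (fst nu * t) + snd nu * (snd nu * t)) with ((fst nu ^ 2 + snd nu ^ 2) * t) by ring.
    rewrite Hnu. ring. }
  constructor.
  - intros x y t _. split; [apply P1|]. specialize (E1 0 (fst nu * t, snd nu * t)).
    rewrite (planar_laplacian nu c phi _ _ 0 _ P1 P2 Hnu), T1 in E1.
    unfold planar_wave in E1; simpl in E1. rewrite !Harg in E1. unfold rate_phi.
    replace (t + c * 0) with t in E1 by ring. replace (t + c * (0 - h)) with (t - c * h) in E1 by ring.
    replace (c * Derive phi t - phi t * (1 - r - phi t + r * psi (t - c * h))) with (Derive (Derive phi) t) by lra.
    apply P2.
  - intros x y t _. split; [apply Q1|]. specialize (E2 0 (fst nu * t, snd nu * t)).
    rewrite (planar_laplacian nu c psi _ _ 0 _ Q1 Q2 Hnu), T2 in E2.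
    unfold planar_wave in E2; simpl in E2. rewrite !Harg in E2. unfold rate_psi.
    replace (t + c * 0) with t in E2 by ring.
    replace (c * Derive psi t - b * phi t * (1 - psi t)) with (Derive (Derive psi) t) by lra.
    apply Q2.
  - intros t; apply Hb.
  - intros t; apply Hb.
  - apply is_lim_left_iff; auto. intros t; apply Hb.
  - apply is_lim_left_iff; auto. intros t; apply Hb.
  - apply is_lim_right_iff; auto. intros t; apply Hb.
  - apply is_lim_right_iff; auto. intros t; apply Hb.
Qed.

Lemma wavefront_of_wave r b h c phi p psi q :
  wave r b c (c * h) phi p psi q -> is_wavefront b r h c (1, 0) phi psi.
Proof.
  intros W. destruct (wave_continuous W) as [C1 C2]. destruct (wave_derive W) as [W1 [W2 [W3 W4]]].
  destruct W as [_ _ B1 B2 L1 L2 R1 R2].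
  assert (Cp : forall t, continuous p t) by (intros t; exact (derive_continuous _ _ _ (W2 t))).
  assert (Cq : forall t, continuous q t) by (intros t; exact (derive_continuous _ _ _ (W4 t))).
  assert (Cs : forall t, continuous (rate_phi r c (c * h) phi p psi) t).
  { intros t. apply (continuous_minus (fun t => c * p t)); [apply continuous_cmul, Cp|].
    apply (continuous_mult phi); [auto|].
    apply (continuous_plus (fun t => 1 - r - phi t) (fun t => r * psi (t - c * h))).
    - apply (continuous_minus (fun _ => 1 - r) phi); [apply continuous_const|auto].
    - apply continuous_cmul. apply (continuous_shift psi (- (c * h))). auto. }
  assert (Cz : forall t, continuous (rate_psi b c phi psi q) t).
  { intros t. apply (continuous_minus (fun t => c * q t)); [apply continuous_cmul, Cq|].
    apply (continuous_mult (fun t => b * phi t) (fun t => 1 - psi t)); [apply continuous_cmul; auto|].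
    apply (continuous_minus (fun _ => 1) psi); [apply continuous_const|auto]. }
  assert (Hnu : fst (1, 0) ^ 2 + snd (1, 0) ^ 2 = 1) by (simpl; ring).
  destruct (planar_derivatives (1, 0) c phi p W1) as [T1 _]. destruct (planar_derivatives (1, 0) c psi q W3) as [T2 _].
  split; [exact Hnu|]. split; [|split; [intros t; split; auto|]].
  - split; [exact (planar_C12 (1, 0) c phi p _ W1 W2 Cs)|].
    split; [exact (planar_C12 (1, 0) c psi q _ W3 W4 Cz)|].
    split; [intros t x; split; [apply B1|apply B2]|]. split; intros t x.
    + rewrite (planar_laplacian _ c phi p _ t x W1 W2 Hnu), T1.
      unfold planar_wave, rate_phi. set (y := fst (1, 0) * fst x + snd (1, 0) * snd x + c * t).
      replace (fst (1, 0) * fst x + snd (1, 0) * snd x + c * (t - h)) with (y - c * h) by (unfold y; ring). ring.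
    + rewrite (planar_laplacian _ c psi q _ t x W3 W4 Hnu), T2.
      unfold planar_wave, rate_psi. ring.
  - split; [apply is_lim_left_iff; auto|]. split; [apply is_lim_left_iff; auto|].
    split; apply is_lim_right_iff; auto.
Qed.

Theorem theorem1p1 (r b h : R) (hr : 1 < r) (hb : 0 < b) (hh : 0 <= h) :
  exists cstar : R,
    unique (fun c : R => admits_wavefront b r h c) cstar /\
    (forall (nu : R * R) (phi psi : R -> R),
       is_wavefront b r h cstar nu phi psi ->
       forall t : R,
         (ex_derive phi t /\ 0 < Derive phi t) /\
         (ex_derive psi t /\ 0 < Derive psi t) /\
         phi t < psi t) /\
    0 < cstar < 2.
Proof.
  destruct (wave_exists r b h hr hb hh) as [c [phi [p [psi [q W]]]]].
  assert (Hc := wave_speed_pos hr hb W).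
  assert (HD : 0 <= c * h) by (apply Rmult_le_pos; lra).
  exists c. split; [split|split].
  - exists (1, 0), phi, psi. apply (wavefront_of_wave r b h c phi p psi q W).
  - intros c2 [nu [f [g Hfg]]]. apply wave_of_wavefront in Hfg.
    assert (Hc2 := wave_speed_pos hr hb Hfg).
    assert (HD2 : 0 <= c2 * h) by (apply Rmult_le_pos; lra).
    destruct (Rtotal_order c c2) as [H|[H|H]]; [exfalso|exact H|exfalso].
    + refine (wave_speed_unique r b c c2 _ _ _ _ _ _ _ _ _ _ hr hb HD _ H W Hfg).
      apply Rmult_le_compat_r; lra.
    + refine (wave_speed_unique r b c2 c _ _ _ _ _ _ _ _ _ _ hr hb HD2 _ H Hfg W).
      apply Rmult_le_compat_r; lra.
  - intros nu f g Hfg t. apply wave_of_wavefront in Hfg.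
    destruct (wave_derive Hfg) as [D1 [_ [D3 _]]].
    split; [split|split; [split|]].
    + exists (Derive f t). apply D1.
    + apply (wave_phi_incr hr hb HD Hfg).
    + exists (Derive g t). apply D3.
    + apply (wave_psi_incr hr hb Hfg).
    + apply (wave_phi_lt_psi hr hb HD Hfg).
  - split; [exact Hc|]. apply (wave_speed_lt_2 hr hb HD W).
Qed.
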